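(* Let $G$ be a finite group. There is a cofibrantly generated model structure on $\mathsf{isvt\text{-}Top}$ with generating cofibrations given by \[\{\Delta^{\mathbf{H}}_G \times S^{n-1} \to \Delta^{\mathbf{H}}_G \times D^n \}\] and generating acyclic cofibrations given by \[\{\Delta^{\mathbf{H}}_G \times D^n \times \{0\} \to \Delta^{\mathbf{H}}_G \times D^n \times [0,1]\},\] where $\mathbf{H}=H_0 < \cdots < H_k$ is an object of the link orbit category $\mathcal{L}_G$ and $n \in \mathbb{N}$.
   Context: $\mathsf{Top}$ is the category of compactly generated spaces (not necessarily weak Hausdorff). $G$ is a finite group. A $G$-space is a compactly generated space with continuous left $G$-action; $G_x=\{g\in G: g x=x\}$. A continuous map $f:X\to Y$ of $G$-spaces is isovariant if $f(gx)=gf(x)$ and $G_x=G_{f(x)}$ for all $g\in G$, $x\in X$. $\mathsf{isvt\text{-}Top}$ is the category of $G$-spaces and isovariant maps. The spaces $S^{n-1}$, $D^n$, $[0,1]$ carry trivial $G$-action; $S^{-1}=\emptyset$; the maps are induced by the inclusions $S^{n-1}\to D^n$ and $\{0\}\to[0,1]$, and $\mathbb N$ includes $0$. The objects of $\mathcal L_G$ are the strictly increasing chains $\mathbf H=H_0<\cdots<H_k$ ($k\ge0$) of subgroups of $G$ (its morphisms are not needed here). Linking simplices: $\Delta^k=\{(t_0,\dots,t_k)\in[0,1]^{k+1}:\sum t_i=1\}$. For $\mathbf H=H_0<\cdots<H_k$, $\Delta^{\mathbf H}_G=(G\times\Delta^k)/\sim$, where $(g,x)\sim(g',x)$ iff $gH_i=g'H_i$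 when $x=(t_0,\dots,t_{k-i},0,\dots,0)$ with $t_{k-i}\ne0$, $0\le i\le k$. Writing $\langle g,x\rangle$ for the class of $(g,x)$, $G$ acts by $g'\cdot\langle g,x\rangle=\langle g'g,x\rangle$. Here ''model structure'' means classes of weak equivalences, fibrations and cofibrations satisfying the usual axioms (2-out-of-3, retracts, lifting, factorization) on the category, which is not required to have all small limits and colimits. It is cofibrantly generated, with generating cofibrations $I$ and generating acyclic cofibrations $J$, if the domains of $I$ (resp. $J$) are small relative to relative $I$-cell (resp. $J$-cell) complexes, the fibrations are the maps with the right lifting property against $J$, and the acyclic fibrations are the maps with the right lifting property against $I$. *)

(* Defs.v *)
From HB Require Import structures.
From mathcomp Require Import all_boot all_order all_algebra all_fingroup.
From mathcomp Require Import all_classical all_reals all_analysis.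

Set Implicit Arguments.
Unset Strict Implicit.
Unset Printing Implicit Defensive.

Import Order.TTheory GRing.Theory Num.Theory.
Import numFieldNormedType.Exports.
Local Open Scope classical_set_scope.
Local Open Scope ring_scope.

Reserved Notation "g \oc f" (at level 40, left associativity).

Record category := Category {
  obj :> Type;
  mhom : obj -> obj -> Type;
  idm : forall X, mhom X X;
  mcomp : forall X Y Z, mhom Y Z -> mhom X Y -> mhom X Z;
  comp1m : forall X Y (f : mhom X Y), mcomp (idm Y) f = f;
  compm1 : forall X Y (f : mhom X Y), mcomp f (idm X) = f;
  compA : forall X Y Z W (h : mhom Z W) (g : mhom Y Z) (f : mhom X Y),
    mcomp h (mcomp g f) = mcomp (mcomp h g) f }.

Arguments mhom {c} _ _.
Arguments idm {c} _.
Arguments mcomp {c X Y Z} _ _.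
Notation "g \oc f" := (mcomp g f).

Definition mor_class (C : category) := forall X Y : C, mhom X Y -> Prop.

Record arrow (C : category) := Arrow { src : C; tgt : C; mor : mhom src tgt }.

Definition arrow_family (C : category) (A : Type) := A -> arrow C.

Section Lifting.
Variable C : category.

Definition has_lift (A B X Y : C) (i : mhom A B) (p : mhom X Y) :=
  forall (u : mhom A X) (v : mhom B Y), p \oc u = v \oc i ->
  exists h : mhom B X, h \oc i = u /\ p \oc h = v.

Definition rlp (A : Type) (I : arrow_family C A) (X Y : C) (p : mhom X Y) :=
  forall a : A, has_lift (mor (I a)) p.

Definition is_retract (X Y X' Y' : C) (f : mhom X Y) (f' : mhom X' Y') :=
  exists (i : mhom X X') (r : mhom X' X) (j : mhom Y Y') (s : mhom Y' Y),
    [/\ r \oc i = idm X, s \oc j = idm Y,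
        f' \oc i = j \oc f & f \oc r = s \oc f'].

Definition retract_closed (P : mor_class C) :=
  forall (X Y X' Y' : C) (f : mhom X Y) (f' : mhom X' Y'),
    is_retract f f' -> P X' Y' f' -> P X Y f.

Definition two_of_three (P : mor_class C) :=
  forall (X Y Z : C) (f : mhom X Y) (g : mhom Y Z),
    [/\ P X Y f -> P Y Z g -> P X Z (g \oc f),
        P X Y f -> P X Z (g \oc f) -> P Y Z g &
        P Y Z g -> P X Z (g \oc f) -> P X Y f].

Definition factors_as (P Q : mor_class C) :=
  forall (X Y : C) (f : mhom X Y),
    exists (Z : C) (i : mhom X Z) (p : mhom Z Y),
      [/\ P X Z i, Q Z Y p & p \oc i = f].

Definition lifts_against (P Q : mor_class C) :=
  forall (A B X Y : C) (i : mhom A B) (p : mhom X Y),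
    P A B i -> Q X Y p -> has_lift i p.

Definition mor_and (P Q : mor_class C) : mor_class C :=
  fun X Y f => P X Y f /\ Q X Y f.

End Lifting.

Record model_structure (C : category) := ModelStructure {
  weq : mor_class C;
  fib : mor_class C;
  cof : mor_class C;
  weq_two_of_three : two_of_three weq;
  weq_retract : retract_closed weq;
  fib_retract : retract_closed fib;
  cof_retract : retract_closed cof;
  cof_lift : lifts_against cof (mor_and weq fib);
  fib_lift : lifts_against (mor_and weq cof) fib;
  factor_cof : factors_as cof (mor_and weq fib);
  factor_fib : factors_as (mor_and weq cof) fib }.

(** Well-ordered types play the role of ordinals. *)
Record wo_type := WoType {
  wo_disp : Order.disp_t;
  wo_sort :> orderType wo_disp;
  wo_wf : well_founded (fun x y : wo_sort => (x < y)%O) }.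

Section Ordinals.
Variable L : wo_type.

Definition is_bottom (i : L) := forall j : L, (i <= j)%O.

Definition is_succ (i j : L) := (i < j)%O /\ forall k : L, (i < k)%O -> (j <= k)%O.

Definition is_limit (j : L) := ~ is_bottom j /\ forall i, ~ is_succ i j.

(** [L] is a limit ordinal whose cofinality exceeds the cardinality of [K]. *)
Definition filtered_for (K : Type) :=
  [/\ exists i : L, True,
      forall i : L, exists j : L, (i < j)%O &
      forall A : set L, (A #<= [set: K])%card -> has_ubound A].

End Ordinals.

Record sequence (C : category) (L : wo_type) := Sequence {
  sob :> L -> C;
  smap : forall i j : L, (i <= j)%O -> mhom (sob i) (sob j);
  smap1 : forall (i : L) (h : (i <= i)%O), smap h = idm (sob i);
  smapD : forall (i j k : L) (ij : (i <= j)%O) (jk : (j <= k)%O) (ik : (i <= k)%O),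
    smap jk \oc smap ij = smap ik }.

Arguments smap {C L} s {i j} _.
Arguments smapD {C L} s {i j k} ij jk ik.

(** Cocones and colimits of the restriction of a sequence to a set [D] of
    indices. *)
Section Colimit.
Variables (C : category) (L : wo_type) (S : sequence C L) (D : set L).

Definition is_cocone (Y : C) (c : forall i, D i -> mhom (S i) Y) :=
  forall (i j : L) (Di : D i) (Dj : D j) (ij : (i <= j)%O),
    c j Dj \oc smap S ij = c i Di.

Definition is_colimit (Y : C) (c : forall i, D i -> mhom (S i) Y) :=
  is_cocone c /\
  forall (Z : C) (d : forall i, D i -> mhom (S i) Z), is_cocone d ->
    exists! u : mhom Y Z, forall i (Di : D i), u \oc c i Di = d i Di.

End Colimit.

Definition is_continuous_seq (C : category) (L : wo_type) (S : sequence C L) :=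
  forall j : L, is_limit j ->
    is_colimit (D := [set i | (i < j)%O]) (fun i (h : (i < j)%O) => smap S (ltW h)).

Definition steps_in (C : category) (L : wo_type) (P : mor_class C)
    (S : sequence C L) :=
  forall (i j : L) (ij : (i <= j)%O), is_succ i j -> P (S i) (S j) (smap S ij).

Definition is_pushout (C : category) (A B X P : C)
    (i : mhom A B) (f : mhom A X) (g : mhom B P) (j : mhom X P) :=
  g \oc i = j \oc f /\
  forall (Z : C) (u : mhom B Z) (v : mhom X Z), u \oc i = v \oc f ->
    exists! w : mhom P Z, w \oc g = u /\ w \oc j = v.

Definition pushout_of (C : category) (A : Type) (I : arrow_family C A) : mor_class C :=
  fun X P j => exists (a : A) (f : mhom (src (I a)) X) (g : mhom (tgt (I a)) P),
    is_pushout (mor (I a)) f g j.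

(** Transfinite compositions of pushouts of members of [I]. *)
Inductive rel_cell (C : category) (A : Type) (I : arrow_family C A) :
    forall X Y : C, mhom X Y -> Prop :=
  RelCell (L : wo_type) (S : sequence C L) (b : L) (Y : C)
    (c : forall i, [set: L] i -> mhom (S i) Y) :
    is_bottom b -> is_continuous_seq S -> steps_in (pushout_of I) S ->
    is_colimit c -> rel_cell I (c b Logic.I).

Definition TypeCat : category :=
  @Category Type (fun A B => A -> B) (fun A => @id A)
    (fun A B D g f => fun x => g (f x))
    (fun _ _ _ => erefl) (fun _ _ _ => erefl) (fun _ _ _ _ _ _ _ => erefl).

Section HomSeq.
Variables (C : category) (L : wo_type) (A : C) (S : sequence C L).

Let hmap (i j : L) (ij : (i <= j)%O) : @mhom TypeCat (mhom A (S i)) (mhom A (S j)) :=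
  fun h => smap S ij \oc h.

Local Lemma hmap1 (i : L) (h : (i <= i)%O) : hmap h = idm (mhom A (S i) : TypeCat).
Proof. by apply: funext => f; rewrite /hmap smap1 comp1m. Qed.

Local Lemma hmapD (i j k : L) (ij : (i <= j)%O) (jk : (j <= k)%O) (ik : (i <= k)%O) :
  hmap jk \oc hmap ij = hmap ik.
Proof. by apply: funext => f /=; rewrite /hmap compA (smapD S ij jk ik). Qed.

Definition hom_seq : sequence TypeCat L :=
  @Sequence TypeCat L (fun i => mhom A (S i)) hmap hmap1 hmapD.

End HomSeq.

(** [A] is small relative to [P]: for some cardinal [K], the functor
    [Hom(A, -)] preserves the colimits of all sequences with steps in [P]
    indexed by [K]-filtered ordinals. *)
Definition small_rel (C : category) (P : mor_class C) (A : C) :=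
  exists K : Type, forall L : wo_type, filtered_for L K ->
  forall S : sequence C L, is_continuous_seq S -> steps_in P S ->
  forall (Y : C) (c : forall i, [set: L] i -> mhom (S i) Y), is_colimit c ->
    is_colimit (S := hom_seq A S) (Y := mhom A Y : TypeCat)
      (fun i Di (h : mhom A (S i)) => c i Di \oc h).

Definition cofibrantly_generated (C : category) (M : model_structure C)
    (A B : Type) (I : arrow_family C A) (J : arrow_family C B) :=
  [/\ forall a, small_rel (rel_cell I) (src (I a)),
      forall b, small_rel (rel_cell J) (src (J b)),
      forall (X Y : C) (p : mhom X Y), fib M p <-> rlp J p &
      forall (X Y : C) (p : mhom X Y), (weq M p /\ fib M p) <-> rlp I p].

(** Compact generation is tested on all continuous maps from compact Hausdorff
    spaces; no separation condition is imposed on [T]. *)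
Definition kopen (T : topologicalType) (U : set T) :=
  forall (K : topologicalType) (f : K -> T),
    compact [set: K] -> hausdorff_space K -> continuous f -> open (f @^-1` U).

Definition compactly_generated (T : topologicalType) :=
  forall U : set T, kopen U -> open U.

(** The k-ification of [T]. The product of compactly generated spaces is the
    k-ification of their product as topological spaces. *)
Definition kify (T : Type) : Type := T.

Section Kify.
Variable T : topologicalType.

Local Lemma kopenT : @kopen T setT.
Proof. by move=> K f _ _ _; rewrite preimage_setT; exact: openT. Qed.

Local Lemma kopenI : setI_closed (@kopen T).
Proof.
by move=> A B kA kB K f cK hK cf; rewrite preimage_setI; apply: openI;
  [exact: kA | exact: kB].
Qed.

Local Lemma kopen_bigU (I : Type) (f : I -> set T) :
  (forall i, kopen (f i)) -> kopen (\bigcup_i f i).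
Proof.
move=> kf K g cK hK cg; rewrite preimage_bigcup; apply: bigcup_open => i _.
exact: kf.
Qed.

HB.instance Definition _ := Choice.on (kify T).
HB.instance Definition _ :=
  isOpenTopological.Build (kify T) kopenT kopenI kopen_bigU.

End Kify.

Lemma kify_openE (T : topologicalType) (U : set (kify T)) :
  open U = @kopen T U.
Proof. by []. Qed.

Lemma kify_probe (T K : topologicalType) (f : K -> T) :
  compact [set: K] -> hausdorff_space K -> continuous f ->
  continuous (f : K -> kify T).
Proof. by move=> cK hK cf; apply/continuousP => U kU; exact: kU. Qed.

Lemma kify_id_continuous (T : topologicalType) : continuous (id : kify T -> T).
Proof.
apply/continuousP => U oU; rewrite kify_openE.
by move=> K f cK hK /continuousP cf; exact: cf.
Qed.

Lemma kify_continuous (T U : topologicalType) (f : T -> U) :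
  continuous f -> continuous (f : kify T -> kify U).
Proof.
move=> cf; apply/continuousP => V kV; rewrite kify_openE.
move=> K g cK hK cg.
by apply: (kV K (f \o g)) => // x; apply: continuous_comp; [exact: cg | exact: cf].
Qed.

Lemma kify_cg (T : topologicalType) : compactly_generated (kify T).
Proof.
move=> U kU; rewrite kify_openE => K f cK hK cf.
by apply: kU => //; exact: kify_probe.
Qed.

Lemma quotient_cg (T : topologicalType) (Q : quotType T) :
  compactly_generated T -> compactly_generated (quotient_topology Q).
Proof.
move=> cgT U kU; apply: (cgT) => K f cK hK cf.
apply: (kU K (\pi_(quotient_topology Q)%qT \o f)) => // x.
by apply: continuous_comp; [exact: cf | exact: pi_continuous].
Qed.

Record gspace (G : finGroupType) := GSpace {
  carrier :> topologicalType;
  gsp_act : G -> carrier -> carrier;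
  gsp_act1 : forall x, gsp_act 1%g x = x;
  gsp_actM : forall g h x, gsp_act (g * h)%g x = gsp_act g (gsp_act h x);
  gsp_act_continuous :
    continuous (fun p : discrete_topology G * carrier => gsp_act p.1 p.2);
  carrier_cg : compactly_generated carrier }.

Lemma gsp_act_continuousP (G : finGroupType) (T : topologicalType) (a : G -> T -> T) :
  continuous (fun p : discrete_topology G * T => a p.1 p.2) <->
  forall g, continuous (a g).
Proof.
split=> [ca g x U nU | ca [g x] U nU].
  have [[A B] [/= nA nB] AB] := ca (g, x) U nU.
  by apply: filterS nB => y By; apply: (AB (g, y)); split=> //=; exact: nbhs_singleton nA.
exists ([set (g : discrete_topology G)], a g @^-1` U) => /=.
  by split; [exact: discrete_set1 | exact: ca nU].
by move=> [h y] /= [-> Uy].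
Qed.

Definition stab (G : finGroupType) (X : gspace G) (x : X) : {set G} :=
  [set g | gsp_act g x == x]%SET.

Record isvt_map (G : finGroupType) (X Y : gspace G) := IsvtMap {
  isvt_fun :> X -> Y;
  isvt_continuous : continuous isvt_fun;
  isvt_act : forall g x, isvt_fun (gsp_act g x) = gsp_act g (isvt_fun x);
  isvt_stab : forall x, stab x = stab (isvt_fun x) }.

Section IsvtTop.
Variable G : finGroupType.
Implicit Types X Y Z W : gspace G.

Lemma isvt_mapP X Y (f g : isvt_map X Y) : (forall x, f x = g x) -> f = g.
Proof.
case: f g => [f cf af sf] [g cg ag sg] /= /funext fg.
by case: _ / fg in cg ag sg *; congr IsvtMap; exact: Prop_irrelevance.
Qed.

Definition isvt_id X : isvt_map X X :=
  @IsvtMap G X X id (fun x => @cvg_id X (nbhs x)) (fun _ _ => erefl) (fun _ => erefl).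

Section Comp.
Variables (X Y Z : gspace G) (g : isvt_map Y Z) (f : isvt_map X Y).

Local Lemma comp_continuous : continuous (g \o f).
Proof.
by move=> x; apply: continuous_comp; [exact: isvt_continuous | exact: isvt_continuous].
Qed.

Local Lemma comp_act h x : (g \o f) (gsp_act h x) = gsp_act h ((g \o f) x).
Proof. by rewrite /= !isvt_act. Qed.

Local Lemma comp_stab x : stab x = stab ((g \o f) x).
Proof. by rewrite /= -!isvt_stab. Qed.

Definition isvt_comp : isvt_map X Z := IsvtMap comp_continuous comp_act comp_stab.
End Comp.

Definition isvtTop : category.
Proof.
refine (@Category (gspace G) (@isvt_map G) isvt_id isvt_comp _ _ _).
- by move=> X Y f; exact: isvt_mapP.
- by move=> X Y f; exact: isvt_mapP.
- by move=> X Y Z W h g f; exact: isvt_mapP.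
Defined.

(** [G] acts trivially on [K]. *)
Section Product.
Variables (X : gspace G) (K : topologicalType).

Definition gprod_act (g : G) (p : kify (X * K)) : kify (X * K) := (gsp_act g p.1, p.2).

Local Lemma gprod_act1 p : gprod_act 1%g p = p.
Proof. by case: p => x k; rewrite /gprod_act gsp_act1. Qed.

Local Lemma gprod_actM g h p : gprod_act (g * h)%g p = gprod_act g (gprod_act h p).
Proof. by rewrite /gprod_act gsp_actM. Qed.

Local Lemma gprod_act_continuous :
  continuous (fun p : discrete_topology G * kify (X * K) => gprod_act p.1 p.2).
Proof.
apply/gsp_act_continuousP => g; apply: (@kify_continuous (X * K)%type (X * K)%type) => -[x k].
apply: cvg_pair => /=; last exact: cvg_snd.
apply: (@cvg_comp _ _ _ fst (gsp_act g)); first exact: cvg_fst.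
by have /gsp_act_continuousP := @gsp_act_continuous G X; exact.
Qed.

Definition gprod : gspace G :=
  GSpace gprod_act1 gprod_actM gprod_act_continuous (@kify_cg (X * K)%type).
End Product.

Section ProductMap.
Variables (X : gspace G) (K K' : topologicalType) (f : K -> K').
Hypothesis cf : continuous f.

Let gprod_fun (p : gprod X K) : gprod X K' := (p.1, f p.2).

Local Lemma gprod_fun_continuous : continuous gprod_fun.
Proof.
apply: (@kify_continuous (X * K)%type (X * K')%type) => -[x k].
apply: cvg_pair => /=; first exact: cvg_fst.
by apply: (@cvg_comp _ _ _ snd f); [exact: cvg_snd | exact: cf].
Qed.

Local Lemma gprod_fun_act g p : gprod_fun (gsp_act g p) = gsp_act g (gprod_fun p).
Proof. by []. Qed.

Local Lemma gprod_fun_stab p : stab p = stab (gprod_fun p).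
Proof.
by apply/setP => g; rewrite !inE; case: p => x k /=; rewrite !xpair_eqE !eqxx.
Qed.

Definition gprod_map : isvt_map (gprod X K) (gprod X K') :=
  IsvtMap gprod_fun_continuous gprod_fun_act gprod_fun_stab.
End ProductMap.

End IsvtTop.

Section Subspaces.
Variables (T : topologicalType) (A B : set T) (AB : A `<=` B).

Definition set_incl (x : A) : B :=
  exist _ (set_val x) (mem_set (AB (set_valP x))).

Lemma set_incl_continuous : continuous set_incl.
Proof.
apply/continuousP => _ [V oV <-]; by exists V.
Qed.
End Subspaces.

Arguments set_incl_continuous {T A B} AB.

Section Spaces.
Variable R : realType.

Definition disk (n : nat) : set 'rV[R]_n :=
  [set x | \sum_(i < n) x 0 i ^+ 2 <= 1].
Arguments disk : clear implicits.

(** The boundary of [disk n], of dimension [n - 1]; empty for [n = 0]. *)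
Definition bsphere (n : nat) : set 'rV[R]_n :=
  [set x | \sum_(i < n) x 0 i ^+ 2 = 1].
Arguments bsphere : clear implicits.

Lemma bsphere_disk n : bsphere n `<=` disk n.
Proof. by move=> x; rewrite /bsphere /disk /= => ->. Qed.

Definition unit_interval : set R := [set t | 0 <= t <= 1].

Lemma zero_unit_interval : [set 0] `<=` unit_interval.
Proof. by move=> _ ->; rewrite /unit_interval /= lexx ler01. Qed.

Definition simplex (k : nat) : set 'rV[R]_k.+1 :=
  [set t | (forall i, 0 <= t 0 i <= 1) /\ \sum_i t 0 i = 1].

End Spaces.

Arguments disk : clear implicits.
Arguments bsphere : clear implicits.
Arguments simplex : clear implicits.

(** Objects of the link orbit category: chains [H_0 < ... < H_k]. *)
Record link_chain (G : finGroupType) := LinkChain {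
  chain_len : nat;
  chain_grp :> 'I_chain_len.+1 -> {group G};
  chain_lt : forall i j : 'I_chain_len.+1,
    (i < j)%N -> chain_grp i \proper chain_grp j }.

Section LinkingSimplex.
Local Open Scope quotient_scope.
Variables (R : realType) (G : finGroupType) (H : link_chain G).
Let k := chain_len H.

Definition pre_link : topologicalType :=
  kify (discrete_topology G * simplex R k).

(** [vanishes_after t j]: [t] is [(t_0, ..., t_j, 0, ..., 0)] with [t_j != 0]. *)
Definition vanishes_after (t : simplex R k) (j : 'I_k.+1) :=
  set_val t 0 j != 0 /\ forall l : 'I_k.+1, (j < l)%N -> set_val t 0 l = 0.

(** [rev_ord i] is the index [k - i]. *)
Definition link_rel (p q : pre_link) :=
  p.2 = q.2 /\
  forall i : 'I_k.+1, vanishes_after p.2 (rev_ord i) ->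
    ((p.1 : G) *: H i = (q.1 : G) *: H i)%g.

Let link_relb (p q : pre_link) := `[< link_rel p q >].

Local Lemma link_refl : reflexive link_relb.
Proof. by move=> p; apply/asboolP. Qed.

Local Lemma link_sym : symmetric link_relb.
Proof.
by move=> p q; apply/asboolP/asboolP => -[e h]; split=> // i;
  [rewrite -e | rewrite -e] => /h.
Qed.

Local Lemma link_trans : transitive link_relb.
Proof.
move=> q p r /asboolP[e h] /asboolP[e' h']; apply/asboolP; split.
  by rewrite e.
by move=> i vi; rewrite h// h'// -e.
Qed.

Definition link_equiv : equiv_rel pre_link :=
  EquivRel link_relb link_refl link_sym link_trans.

Definition link_space : topologicalType :=
  quotient_topology {eq_quot link_equiv}.

Definition link_class (g : G) (t : simplex R k) : link_space :=
  (\pi_({eq_quot link_equiv}) ((g, t) : pre_link)).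

Lemma link_classP g t g' t' :
  link_class g t = link_class g' t' <-> link_rel (g, t) (g', t').
Proof. by split=> [/eqmodP/asboolP | ?]; last by apply/eqmodP/asboolP. Qed.

Definition link_act (g : G) (q : link_space) : link_space :=
  let p : pre_link := generic_quotient.repr (q : {eq_quot link_equiv}) in link_class (g * p.1)%g p.2.

Lemma link_classK (q : link_space) :
  let p : pre_link := generic_quotient.repr (q : {eq_quot link_equiv}) in link_class p.1 p.2 = q.
Proof. by rewrite /link_class /= -surjective_pairing; exact: reprK. Qed.

Lemma link_actE g h t : link_act g (link_class h t) = link_class (g * h)%g t.
Proof.
apply/link_classP; have /link_classP[/= e r] := link_classK (link_class h t).
by split=> //= i /r rE; rewrite !lcosetM rE.
Qed.

Local Lemma link_act1 q : link_act 1%g q = q.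
Proof. by rewrite -[q]link_classK link_actE mul1g. Qed.

Local Lemma link_actM g h q : link_act (g * h)%g q = link_act g (link_act h q).
Proof. by rewrite -[q]link_classK !link_actE mulgA. Qed.

Local Lemma link_act_continuous :
  continuous (fun p : discrete_topology G * link_space => link_act p.1 p.2).
Proof.
apply/gsp_act_continuousP => g; apply/quotient_continuous.
pose m (p : discrete_topology G * simplex R k) : discrete_topology G * simplex R k :=
  ((g * p.1)%g, p.2).
have -> : link_act g \o \pi_(quotient_topology {eq_quot link_equiv}) =
          \pi_(quotient_topology {eq_quot link_equiv}) \o (m : pre_link -> pre_link).
  by apply: funext => -[h t]; exact: link_actE.
move=> x; apply: continuous_comp; last exact: pi_continuous.
apply: kify_continuous => -[h t] U [[A B] [/= nA nB] AB].
exists ([set h], B) => /=; first by split=> //; exact: discrete_set1.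
move=> [h' t'] /= [-> Bt']; apply: (AB (_, _)); split=> //=.
exact: nbhs_singleton nA.
Qed.

Definition link_simplex : gspace G :=
  GSpace link_act1 link_actM link_act_continuous (quotient_cg (@kify_cg _)).

End LinkingSimplex.

Section Generators.
Variables (R : realType) (G : finGroupType).

Definition gen_cof : arrow_family (isvtTop G) (link_chain G * nat) :=
  fun '(H, n) => @Arrow (isvtTop G) _ _
    (gprod_map (link_simplex R H)
       (set_incl_continuous (@bsphere_disk R n))).

Definition gen_acof : arrow_family (isvtTop G) (link_chain G * nat) :=
  fun '(H, n) => @Arrow (isvtTop G) _ _
    (gprod_map (gprod (link_simplex R H) (disk R n))
       (set_incl_continuous (@zero_unit_interval R))).

End Generators.

Arguments gen_cof : clear implicits.
Arguments gen_acof : clear implicits.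

(* Main.v *)
Require Import Defs.
From HB Require Import structures.
From mathcomp Require Import all_boot all_order all_algebra all_fingroup.
From mathcomp Require Import all_classical all_reals all_analysis.
From mathcomp Require Import ring lra.

Set Implicit Arguments.
Unset Strict Implicit.
Unset Printing Implicit Defensive.

Import Order.TTheory GRing.Theory Num.Theory.
Import numFieldNormedType.Exports.
Local Open Scope classical_set_scope.
Local Open Scope ring_scope.

(** Fix a linking simplex A.  Lifting p against the generating cofibrations
    (resp. generating acyclic cofibrations) built from A means that p is an
    acyclic Serre fibration (resp. a Serre fibration) whose lifting problems are
    all multiplied by A.  Compactness of A enters only in the small object
    argument, so the homotopy theory below is that of Serre fibrations relative
    to an arbitrary G-space A; a map is a fibration, or a weak equivalence, if
    it is one relative to each linking simplex.

    For nontrivial G the category has no terminal object, but it has path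
    spaces.  A map f : X -> Y has a mapping path space N f of pairs (x, c), where
    c is a path in Y from f x along which the isotropy group is constant, and
    maps B -> N f are pairs of B -> X and B x I -> Y.  It factors f as
    X -> N f -> Y, a strong deformation retract ([mpath_const_sdr]) followed by
    a fibration ([mpath_tgt_fib]).  Call f a weak equivalence if N f -> Y is an
    acyclic fibration.

    Two out of three: weak equivalences are insensitive to precomposition with a
    strong deformation retract ([weq_sdr]), so f may be replaced by the fibration
    p : N f -> Y.  Then N (g p) -> N g is a pullback of p, and the three cases
    become composition and cancellation properties of acyclic fibrations
    ([afib_comp], [afib_cancel], [afib_cancel_fib]).  A fibration is a weak
    equivalence exactly when it is an acyclic fibration ([weq_of_afib],
    [afib_of_weq]).  The geometry needed is relative homotopy lifting for
    (D^n, S^(n-1)) ([relative_lifting]) and three consequences of writing a sphere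
    as two hemispheres: lifting along acyclic fibrations from spheres, the
    existence of fibrewise homotopies, and the fact that acyclic fibrations are
    fibrations ([afib_lift_sphere], [afib_fibre_homotopy], [afib_fib]).  Maps out
    of A x K are glued along finite closed covers of K ([glue_gprod]).

    Cofibrations are the maps with the left lifting property against the acyclic
    fibrations.  A countable small object argument factors each map as a
    cofibration followed by an acyclic fibration
    ([small_object_factorization]); it works because A x S^(n-1) is compact and
    each new point of a stage lies in a closed set that misses the earlier stage
    ([chain_compact]).  Applied to X -> N f, it also gives the other
    factorization.  If j : A' -> B is a cofibration and a weak equivalence,
    lifting the identity of B along N j -> B deforms B into A'; lifting j against the
      acyclic
    fibration from the path space of X to N p then solves lifting problems of j
    against a fibration p : X -> Y ([acyclic_cofibration_lifts]).

    Finally, relative cell complexes are closed embeddings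
    ([rel_cell_closed_emb]), by comparison with explicit pushouts and colimits.
    A map into the colimit of a chain of closed embeddings whose cofinality exceeds the
    cardinality of its source lands in one stage, where it is automatically
    continuous; this is smallness ([small_rel_closed_emb]). *)

(** * Compact Hausdorff and compactly generated spaces *)

Definition cpt_hausdorff (K : topologicalType) :=
  compact [set: K] /\ hausdorff_space K.

Lemma inj_hausdorff (T U : topologicalType) (f : T -> U) :
  continuous f -> injective f -> hausdorff_space U -> hausdorff_space T.
Proof.
move=> cf fI hU x y xy; apply: fI; apply: hU => A B fA fB.
have [z [Az Bz]] := xy _ _ (cf x _ fA) (cf y _ fB).
by exists (f z).
Qed.

Lemma prod_hausdorff (T U : topologicalType) :
  hausdorff_space T -> hausdorff_space U -> hausdorff_space (T * U)%type.
Proof.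
move=> hT hU [x1 x2] [y1 y2] xy; congr (_, _).
  apply: hT => A B nA nB.
  have [|| z [Az Bz]] := xy (fst @^-1` A) (fst @^-1` B).
  - exact: (@cvg_fst T U (nbhs x1) (nbhs x2)).
  - exact: (@cvg_fst T U (nbhs y1) (nbhs y2)).
  - by exists z.1.
apply: hU => A B nA nB.
have [|| z [Az Bz]] := xy (snd @^-1` A) (snd @^-1` B).
- exact: (@cvg_snd T U (nbhs x1) (nbhs x2)).
- exact: (@cvg_snd T U (nbhs y1) (nbhs y2)).
- by exists z.2.
Qed.

Lemma cpt_hausdorff_prod (K L : topologicalType) :
  cpt_hausdorff K -> cpt_hausdorff L -> cpt_hausdorff (K * L)%type.
Proof.
move=> [cK hK] [cL hL]; split; last exact: prod_hausdorff.
by rewrite -setXTT; exact: compact_setX.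
Qed.

Lemma set_val_continuous (T : topologicalType) (A : set T) :
  continuous (set_val : A -> T).
Proof. by apply/continuousP => U oU; exists U. Qed.

Lemma set_val_inj (T : Type) (A : set T) : injective (set_val : A -> T).
Proof. exact: val_inj. Qed.

Lemma to_subset_continuous (T U : topologicalType) (A : set U) (f : T -> A) :
  continuous (set_val \o f) -> continuous f.
Proof.
by move=> /continuousP cf; apply/continuousP => _ [V oV <-]; exact: cf.
Qed.

(** A filter on the subset is pushed forward to the ambient space, where it
    clusters at a point of A. *)
Lemma cpt_hausdorff_subset (T : topologicalType) (A : set T) :
  hausdorff_space T -> compact A -> cpt_hausdorff A.
Proof.
move=> hT cA; split; last first.
  exact: (inj_hausdorff (@set_val_continuous T A) (@set_val_inj T A) hT).
move=> F PF _.
have FA : (set_val @ F) A.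
  by apply: (@filterS _ F _ setT) filterT => x _; exact: set_valP.
have [x [Ax xF]] := cA _ (fmap_proper_filter set_val PF) FA.
exists (exist _ x (mem_set Ax)); split=> //; move=> P Q FP [_ [[V oV <-] Vx VQ]].
have [] := xF (set_val @` P) V.
- by apply: (@filterS _ F _ P) FP => y Py; exists y.
- by apply: open_nbhs_nbhs; split.
move=> _ [[y Py <-] Vy]; exists y; split=> //; exact: VQ.
Qed.

Lemma closed_coincide (T U : topologicalType) (f g : T -> U) :
  hausdorff_space U -> continuous f -> continuous g -> closed [set x | f x = g x].
Proof.
move=> hU cf cg x clx; apply: hU => A B fA gB.
have [|y [/= e [Ay By]]] := clx (f @^-1` A `&` g @^-1` B).
  by apply: filterI; [exact: cf | exact: cg].
by exists (f y); split=> //; rewrite e.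
Qed.

Lemma cg_closed (T : topologicalType) (C : set T) : compactly_generated T ->
  (forall (K : topologicalType) (f : K -> T), cpt_hausdorff K -> continuous f ->
     closed (f @^-1` C)) -> closed C.
Proof.
move=> cgT H; rewrite -openC; apply: cgT => K f cK hK cf.
by rewrite preimage_setC openC; exact: H.
Qed.

Lemma cg_continuous (T U : topologicalType) (f : T -> U) : compactly_generated T ->
  (forall (K : topologicalType) (g : K -> T), cpt_hausdorff K -> continuous g ->
     continuous (f \o g)) -> continuous f.
Proof.
move=> cgT H; apply/continuousP => V oV; apply: cgT => K g cK hK cg.
by have /continuousP := H K g (conj cK hK) cg; exact.
Qed.

Lemma to_kify_continuous (T U : topologicalType) (f : T -> U) :
  compactly_generated T -> continuous f -> continuous (f : T -> kify U).
Proof.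
move=> cgT cf; apply: cg_continuous => // K g [cK hK] cg.
by apply: kify_probe => // x; apply: continuous_comp; [exact: cg | exact: cf].
Qed.

Lemma pair_continuous (W T U : topologicalType) (f : W -> T) (g : W -> U) :
  continuous f -> continuous g -> continuous (fun w => (f w, g w)).
Proof. by move=> cf cg w; apply: cvg_pair; [exact: cf | exact: cg]. Qed.

Lemma continuous_after (T U V : topologicalType) (f : T -> U) (g : U -> V) :
  continuous f -> continuous g -> continuous (g \o f).
Proof. by move=> cf cg x; apply: continuous_comp; [exact: cf | exact: cg]. Qed.

(** The image is compact, hence closed; this is where [gprod_closed_map] uses
    compact Hausdorff probes. *)
Lemma fst_closed (M K : topologicalType) (C : set (M * K)) :
  cpt_hausdorff M -> cpt_hausdorff K -> closed C -> closed (fst @` C).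
Proof.
move=> hM hK cC; have hMK := cpt_hausdorff_prod hM hK.
apply: compact_closed; first exact: hM.2.
apply: continuous_compact; last exact: (subclosed_compact cC hMK.1).
by apply: continuous_subspaceT => -[x y]; exact: cvg_fst.
Qed.

Lemma tube (T K : topologicalType) (C : set K) (U : set (T * K)) :
  compact C -> open U -> open [set t | forall k, C k -> U (t, k)].
Proof.
move=> /compact_near_coveringP cC oU; rewrite openE => t /= Ct.
have := cC T (nbhs t) (fun t k => U (t, k)) _; apply => k Ck.
have : nbhs (t, k) U by apply: open_nbhs_nbhs; split => //; exact: Ct.
move=> [[A B] [/= nA nB] AB]; exists (B, A) => //= -[k' t'] [/= Bk At].
exact: (AB (t', k')).
Qed.

(** * Isovariant maps and products with a space of parameters *)

(** [has_lift] read pointwise, which spares rewriting with equalities of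
    isovariant maps. *)
Definition lifts (G : finGroupType) (A B X Y : gspace G) (i : isvt_map A B)
    (p : isvt_map X Y) :=
  forall (u : isvt_map A X) (v : isvt_map B Y), (forall a, p (u a) = v (i a)) ->
  exists h : isvt_map B X, (forall a, h (i a) = u a) /\ (forall b, p (h b) = v b).

Lemma has_liftP (G : finGroupType) (A B X Y : gspace G) (i : isvt_map A B)
    (p : isvt_map X Y) :
  @has_lift (isvtTop G) A B X Y i p <-> lifts i p.
Proof.
split=> [L u v uv | L u v uv].
  have [|h [hu hv]] := L u v; first by apply: isvt_mapP => a; exact: uv.
  exists h; split=> [a|b].
    exact: (congr1 (fun f : isvt_map A X => f a) hu).
  exact: (congr1 (fun f : isvt_map B Y => f b) hv).
have [|h [hu hv]] := L u v.
  by move=> a; exact: (congr1 (fun f : isvt_map A Y => f a) uv).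
by exists h; split; apply: isvt_mapP.
Qed.

Section Tools.
Variable G : finGroupType.
Implicit Types A B X Y Z W : gspace G.

Lemma gprod_stab A K (p : gprod A K) : stab p = stab p.1.
Proof.
by apply/setP => g; rewrite !inE; case: p => x k /=; rewrite xpair_eqE eqxx andbT.
Qed.

Lemma gsp_actK X g : cancel (@gsp_act G X g) (gsp_act g^-1%g).
Proof. by move=> x; rewrite -gsp_actM mulVg gsp_act1. Qed.

Lemma gsp_act_cont X g : continuous (@gsp_act G X g).
Proof. by have /gsp_act_continuousP := @gsp_act_continuous G X; exact. Qed.

Lemma gfst_continuous A K : continuous (fst : gprod A K -> A).
Proof.
move=> p; apply: (@continuous_comp (kify (A * K)) (A * K)%type A id fst).
  exact: (@kify_id_continuous (A * K)%type).
by case: p => a k; exact: cvg_fst.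
Qed.

Lemma gsnd_continuous A K : continuous (snd : gprod A K -> K).
Proof.
move=> p; apply: (@continuous_comp (kify (A * K)) (A * K)%type K id snd).
  exact: (@kify_id_continuous (A * K)%type).
by case: p => a k; exact: cvg_snd.
Qed.

Definition gfst A (K : topologicalType) : isvt_map (gprod A K) A :=
  @IsvtMap G (gprod A K) A fst (@gfst_continuous A K) (fun _ _ => erefl)
    (@gprod_stab A K).

Lemma to_gprod_continuous W A (K : topologicalType) (f : W -> A) (m : W -> K) :
  continuous f -> continuous m -> continuous (fun w => (f w, m w) : gprod A K).
Proof.
move=> cf cm; apply: (@to_kify_continuous W (A * K)%type); first exact: carrier_cg.
exact: pair_continuous.
Qed.

Section Pair.
Variables (W A : gspace G) (K : topologicalType) (b : isvt_map W A) (m : W -> K).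
Hypothesis cm : continuous m.
Hypothesis mG : forall g w, m (gsp_act g w) = m w.

Let pair_fun (w : W) : gprod A K := (b w, m w).

Local Lemma pair_fun_act g w : pair_fun (gsp_act g w) = gsp_act g (pair_fun w).
Proof. by rewrite /pair_fun isvt_act mG. Qed.

Local Lemma pair_fun_stab w : stab w = stab (pair_fun w).
Proof. by rewrite gprod_stab /= -isvt_stab. Qed.

Definition gpair : isvt_map W (gprod A K) :=
  IsvtMap (to_gprod_continuous (@isvt_continuous _ _ _ b) cm) pair_fun_act
    pair_fun_stab.
End Pair.

Lemma gprod_probe A (K M : topologicalType) (a : M -> A) (k : M -> K) :
  cpt_hausdorff M -> continuous a -> continuous k ->
  continuous (fun m => (a m, k m) : gprod A K).
Proof.
move=> [cM hM] ca ck; apply: (@kify_probe (A * K)%type M) => //.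
exact: pair_continuous.
Qed.

(** The image of C under id x f, described without mentioning the map.  Closedness
    is tested on a compact Hausdorff probe M -> A x K, where the preimage is the
    projection to M of a closed subset of M x K'. *)
Lemma gprod_closed_map A (K' K : topologicalType) (f : K' -> K) (C : set (gprod A K')) :
  cpt_hausdorff K' -> hausdorff_space K -> continuous f -> closed C ->
  closed [set p : gprod A K | exists2 k, f k = p.2 & C (p.1, k)].
Proof.
move=> hK' hK cf cC; apply: cg_closed; first exact: carrier_cg.
move=> M q hM cq.
pose E := [set x : M * K' | f x.2 = (q x.1).2] `&`
          (fun x : M * K' => ((q x.1).1, x.2) : gprod A K') @^-1` C.
have hMK := cpt_hausdorff_prod hM hK'.
have cfst : continuous (fst : M * K' -> M) by case=> x y; exact: cvg_fst.
have csnd : continuous (snd : M * K' -> K') by case=> x y; exact: cvg_snd.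
have cE : closed E.
  apply: closedI.
    apply: closed_coincide => //; first exact: continuous_after csnd cf.
    exact: (continuous_after cfst (continuous_after cq (@gsnd_continuous A K))).
  have /continuous_closedP := gprod_probe hMK
    (continuous_after cfst (continuous_after cq (@gfst_continuous A K))) csnd.
  by apply.
suff -> : q @^-1` [set p : gprod A K | exists2 k, f k = p.2 & C (p.1, k)] = fst @` E.
  exact: fst_closed.
apply/seteqP; split=> [m [k fk Ck] | _ [[m k] [/= fk Ck] <-]].
  by exists (m, k).
by exists k.
Qed.

Lemma closed_continuous (T U : topologicalType) (f : T -> U) :
  (forall C, closed C -> closed (f @^-1` C)) -> continuous f.
Proof. by move/continuous_closedP. Qed.

(** Maps out of A x K glue along a finite closed cover of K by images of compact
    spaces: the preimage of a closed set is a union of two images under the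
    closed maps of [gprod_closed_map]. *)
Lemma glue_gprod A E (K K1 K2 : topologicalType) (f1 : K1 -> K) (f2 : K2 -> K)
    (u1 : isvt_map (gprod A K1) E) (u2 : isvt_map (gprod A K2) E) :
  hausdorff_space K -> cpt_hausdorff K1 -> cpt_hausdorff K2 ->
  continuous f1 -> continuous f2 ->
  (forall k, (exists k1, f1 k1 = k) \/ (exists k2, f2 k2 = k)) ->
  (forall a k k', f1 k = f1 k' -> u1 (a, k) = u1 (a, k')) ->
  (forall a k k', f2 k = f2 k' -> u2 (a, k) = u2 (a, k')) ->
  (forall a k k', f1 k = f2 k' -> u1 (a, k) = u2 (a, k')) ->
  exists F : isvt_map (gprod A K) E,
    (forall a k, F (a, f1 k) = u1 (a, k)) /\ (forall a k, F (a, f2 k) = u2 (a, k)).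
Proof.
move=> hK h1 h2 c1 c2 cov e1 e2 e12.
have /choice[F HF] : forall p : gprod A K, exists e : E,
    (forall k, f1 k = p.2 -> u1 (p.1, k) = e) /\
    (forall k, f2 k = p.2 -> u2 (p.1, k) = e).
  move=> [a k] /=; have [[k1 <-]|[k2 <-]] := cov k.
    exists (u1 (a, k1)); split=> k' ek'; first exact: e1.
    by apply/esym/e12.
  exists (u2 (a, k2)); split=> k' ek'; last exact: e2.
  exact: e12.
have HF' p : (exists2 k, f1 k = p.2 & F p = u1 (p.1, k)) \/
             (exists2 k, f2 k = p.2 & F p = u2 (p.1, k)).
  have [[k e]|[k e]] := cov p.2; [left|right]; exists k => //.
    by rewrite (HF p).1.
  by rewrite (HF p).2.
have cF : continuous F.
  apply: closed_continuous => C cC.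
  have -> : F @^-1` C =
      [set p | exists2 k, f1 k = p.2 & (u1 @^-1` C) (p.1, k)] `|`
      [set p | exists2 k, f2 k = p.2 & (u2 @^-1` C) (p.1, k)].
    apply/seteqP; split=> [p /= Cp | p /= [[k e Ck] | [k e Ck]]].
    - by have [[k e eF]|[k e eF]] := HF' p; [left|right]; exists k => //;
        rewrite -eF.
    - by rewrite -((HF p).1 k).
    - by rewrite -((HF p).2 k).
  apply: closedU; apply: gprod_closed_map => //.
  - by have /continuous_closedP := @isvt_continuous _ _ _ u1; exact.
  - by have /continuous_closedP := @isvt_continuous _ _ _ u2; exact.
have FG g p : F (gsp_act g p) = gsp_act g (F p).
  have [[k e ->]|[k e ->]] := HF' p; rewrite -isvt_act.
    by rewrite -((HF (gsp_act g p)).1 k).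
  by rewrite -((HF (gsp_act g p)).2 k).
have Fs p : stab p = stab (F p).
  by have [[k e ->]|[k e ->]] := HF' p; rewrite -isvt_stab !gprod_stab.
exists (IsvtMap cF FG Fs); split=> a k /=.
  by rewrite -((HF (a, f1 k)).1 k).
by rewrite -((HF (a, f2 k)).2 k).
Qed.

Definition closed_emb X Y (f : X -> Y) :=
  injective f /\ forall C, closed C -> closed (f @` C).

Lemma closed_emb_gprod A (K' K : topologicalType) (f : K' -> K) (cf : continuous f) :
  cpt_hausdorff K' -> hausdorff_space K -> injective f ->
  closed_emb (gprod_map A cf).
Proof.
move=> hK' hK fI; split=> [[a k] [a' k'] [-> /fI ->] //|C cC].
have := gprod_closed_map hK' hK cf cC.
congr closed; apply/seteqP; split=> [[a k] [k' /= <- Ck] | _ [[a k] Ck <-]].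
  by exists (a, k').
by exists k.
Qed.

Lemma closed_emb_comp X Y Z (g : Y -> Z) (f : X -> Y) :
  closed_emb g -> closed_emb f -> closed_emb (g \o f).
Proof.
move=> [gI gc] [fI fc]; split=> [x y /gI/fI //|C /fc/gc].
by rewrite image_comp.
Qed.

Lemma closed_emb_id X : closed_emb (@id X).
Proof. by split=> // C cC; rewrite image_id. Qed.

(** Lifting a map through a closed embedding is a matter of points only:
    continuity, equivariance and isovariance are inherited. *)
Lemma closed_emb_factor X Y A (c : isvt_map X Y) (u : isvt_map A Y) :
  closed_emb c -> (forall a, exists x, c x = u a) ->
  exists v : isvt_map A X, forall a, c (v a) = u a.
Proof.
move=> [cI cC] /choice[v hv].
have cv : continuous v.
  apply: closed_continuous => C /cC ccC.
  have -> : v @^-1` C = u @^-1` (c @` C).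
    apply/seteqP; split=> [a Ca | a [x Cx e]]; first by exists (v a).
    by rewrite /preimage/= -(cI x (v a))// hv.
  by have /continuous_closedP := @isvt_continuous _ _ _ u; exact.
have vG g a : v (gsp_act g a) = gsp_act g (v a).
  by apply: cI; rewrite isvt_act !hv isvt_act.
have vs a : stab a = stab (v a) by rewrite (isvt_stab c) hv -isvt_stab.
by exists (IsvtMap cv vG vs).
Qed.

End Tools.

(** * Continuity of formulas and the Euclidean norm *)

Section RealFunctions.
Variables (R : realType) (W : topologicalType).
Implicit Types f g : W -> R.

Lemma cont_add f g : continuous f -> continuous g -> continuous (fun w => f w + g w).
Proof. by move=> cf cg w; apply: cvgD; [exact: cf | exact: cg]. Qed.

Lemma cont_opp f : continuous f -> continuous (fun w => - f w).
Proof. by move=> cf w; apply: cvgN; exact: cf. Qed.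

Lemma cont_sub f g : continuous f -> continuous g -> continuous (fun w => f w - g w).
Proof. by move=> cf cg; apply: cont_add => //; exact: cont_opp. Qed.

Lemma cont_mul f g : continuous f -> continuous g -> continuous (fun w => f w * g w).
Proof. by move=> cf cg w; apply: cvgM; [exact: cf | exact: cg]. Qed.

Lemma cont_cst (c : R) : continuous (fun _ : W => c).
Proof. by move=> w; exact: cvg_cst. Qed.

Lemma cont_max f g : continuous f -> continuous g ->
  continuous (fun w => Num.max (f w) (g w)).
Proof. by move=> cf cg w; apply: continuous_max; [exact: cf | exact: cg]. Qed.

Lemma cont_min f g : continuous f -> continuous g ->
  continuous (fun w => Num.min (f w) (g w)).
Proof. by move=> cf cg w; apply: continuous_min; [exact: cf | exact: cg]. Qed.

Lemma cont_sqrt f : continuous f -> continuous (fun w => Num.sqrt (f w)).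
Proof.
by move=> cf w; apply: (@continuous_comp _ _ _ f Num.sqrt);
  [exact: cf | exact: sqrt_continuous].
Qed.

Lemma cont_inv f : (forall w, f w != 0) -> continuous f -> continuous (fun w => (f w)^-1).
Proof. by move=> f0 cf w; apply: cvgV; [exact: f0 | exact: cf]. Qed.

Lemma cont_sum (I : Type) (r : seq I) (F : I -> W -> R) :
  (forall i, continuous (F i)) -> continuous (fun w => \sum_(i <- r) F i w).
Proof.
move=> cF; elim: r => [|i r IH].
  by rewrite (_ : (fun w => _) = (fun=> 0)); [exact: cont_cst |
    apply: funext => w; rewrite big_nil].
rewrite (_ : (fun w => _) = (fun w => F i w + \sum_(j <- r) F j w)).
  exact: cont_add.
by apply: funext => w; rewrite big_cons.
Qed.

(** Neighbourhoods of a matrix are generated by products of neighbourhoods of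
    its entries. *)
Lemma to_rV_continuous n (f : W -> 'rV[R]_n) :
  (forall i, continuous (fun w => f w 0 i)) -> continuous f.
Proof.
move=> cf w A [P nP PA]; rewrite /nbhs /=.
have H : nbhs w [set w' | forall i : 'I_n, P 0 i (f w' 0 i)].
  apply: filter_forall => i; apply: (cf i w); exact: nP.
apply: filterS H => w' /= Hw'; apply: PA => i j.
by rewrite (ord1 i); exact: Hw'.
Qed.

Lemma from_rV_continuous n (f : W -> 'rV[R]_n) i :
  continuous f -> continuous (fun w => f w 0 i).
Proof.
move=> cf w; apply: (@continuous_comp _ _ _ f (fun M : 'rV[R]_n => M 0 i)).
  exact: cf.
exact: coord_continuous.
Qed.

End RealFunctions.

Section Geometry.
Variable R : realType.

Definition enorm n (x : 'rV[R]_n) : R := Num.sqrt (\sum_(i < n) x 0 i ^+ 2).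

Lemma sumsq_ge0 n (x : 'rV[R]_n) : 0 <= \sum_(i < n) x 0 i ^+ 2.
Proof. by apply: sumr_ge0 => i _; exact: sqr_ge0. Qed.

Lemma enorm_ge0 n (x : 'rV[R]_n) : 0 <= enorm x.
Proof. exact: sqrtr_ge0. Qed.

Lemma enorm_sq n (x : 'rV[R]_n) : enorm x ^+ 2 = \sum_(i < n) x 0 i ^+ 2.
Proof. by rewrite sqr_sqrtr// sumsq_ge0. Qed.

Lemma sumsqZ n (a : R) (x : 'rV[R]_n) :
  \sum_(i < n) (a *: x) 0 i ^+ 2 = a ^+ 2 * \sum_(i < n) x 0 i ^+ 2.
Proof. by rewrite mulr_sumr; apply: eq_bigr => i _; rewrite !mxE exprMn. Qed.

Lemma enormZ n (a : R) (x : 'rV[R]_n) : 0 <= a -> enorm (a *: x) = a * enorm x.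
Proof.
by move=> a0; rewrite /enorm sumsqZ sqrtrM ?sqr_ge0// sqrtr_sqr ger0_norm.
Qed.

Lemma diskE n (x : 'rV[R]_n) : disk R n x <-> enorm x <= 1.
Proof.
rewrite /disk /= -enorm_sq; split=> h.
  by rewrite -(@ler_pXn2r _ 2) ?nnegrE ?enorm_ge0 // expr1n.
by rewrite -(expr1n _ 2) ler_pXn2r ?nnegrE ?enorm_ge0.
Qed.

Lemma sphereE n (x : 'rV[R]_n) : bsphere R n x <-> enorm x = 1.
Proof.
rewrite /bsphere /= -enorm_sq; split=> [/eqP|->]; last by rewrite expr1n.
by rewrite sqrp_eq1 ?enorm_ge0 // => /eqP.
Qed.

Lemma row_mx_sumsq n (x : 'rV[R]_n) (s : 'rV[R]_1) :
  \sum_(i < n + 1) (row_mx x s) 0 i ^+ 2 = \sum_(i < n) x 0 i ^+ 2 + s 0 0 ^+ 2.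
Proof.
rewrite big_split_ord /= big_ord1; congr (_ + _).
  by apply: eq_bigr => i _; rewrite row_mxEl.
by rewrite row_mxEr.
Qed.

Lemma enorm_continuous (W : topologicalType) n (f : W -> 'rV[R]_n) :
  continuous f -> continuous (fun w => enorm (f w)).
Proof.
move=> cf; apply: cont_sqrt; apply: cont_sum => i.
by apply: (cont_mul (W := W)); exact: from_rV_continuous.
Qed.

Lemma rVZ_continuous (W : topologicalType) n (a : W -> R) (f : W -> 'rV[R]_n) :
  continuous a -> continuous f -> continuous (fun w => a w *: f w).
Proof.
move=> ca cf; apply: to_rV_continuous => i.
rewrite (_ : (fun w => _) = (fun w => a w * f w 0 i)).
  by apply: cont_mul => //; exact: from_rV_continuous.
by apply: funext => w; rewrite mxE.
Qed.

Lemma row_mx_continuous (W : topologicalType) m n (f : W -> 'rV[R]_m)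
    (g : W -> 'rV[R]_n) :
  continuous f -> continuous g -> continuous (fun w => row_mx (f w) (g w)).
Proof.
move=> cf cg; apply: to_rV_continuous => i.
case: (split_ordP i) => j ->.
  rewrite (_ : (fun w => _) = (fun w => f w 0 j)); first exact: from_rV_continuous.
  by apply: funext => w; rewrite row_mxEl.
rewrite (_ : (fun w => _) = (fun w => g w 0 j)); first exact: from_rV_continuous.
by apply: funext => w; rewrite row_mxEr.
Qed.

Lemma scalar_mx_continuous (W : topologicalType) (f : W -> R) :
  continuous f -> continuous (fun w => (f w)%:M : 'rV[R]_1).
Proof.
move=> cf; apply: to_rV_continuous => i.
rewrite (_ : (fun w => _) = f) //.
by apply: funext => w; rewrite ord1 mxE.
Qed.

Lemma lsubmx_continuous (W : topologicalType) m n (f : W -> 'rV[R]_(m + n)) :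
  continuous f -> continuous (fun w => lsubmx (f w)).
Proof.
move=> cf; apply: to_rV_continuous => i.
rewrite (_ : (fun w => _) = (fun w => f w 0 (lshift n i))).
  exact: from_rV_continuous.
by apply: funext => w; rewrite mxE.
Qed.

Lemma rV_hausdorff n : hausdorff_space 'rV[R]_n.
Proof. exact: norm_hausdorff. Qed.

Lemma sumsq_continuous n : continuous (fun x : 'rV[R]_n => \sum_(i < n) x 0 i ^+ 2).
Proof.
apply: (cont_sum (W := 'rV[R]_n)) => i.
by apply: (cont_mul (W := 'rV[R]_n)); apply: (from_rV_continuous (W := 'rV[R]_n)) => x;
  exact: cvg_id.
Qed.

Lemma disk_compact n : compact (disk R n).
Proof.
have cD : closed (disk R n).
  have /continuous_closedP H := @sumsq_continuous n.
  exact: (H [set t | t <= 1] (@closed_le R 1)).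
have cB : compact [set v : 'rV[R]_n | forall i, `[-1, 1]%classic (v ord0 i)].
  by exact: (@rV_compact R n (fun=> `[-1, 1]%classic) (fun=> @segment_compact R _ _)).
apply: (subclosed_compact cD cB) => x /= x1 i /=.
rewrite in_itv /= -ler_norml -(@ler_pXn2r _ 2) ?nnegrE // expr1n.
rewrite real_normK ?num_real //; apply: le_trans x1.
by rewrite (bigD1 i) //= lerDl; apply: sumr_ge0 => j _; exact: sqr_ge0.
Qed.

Lemma sphere_closed n : closed (bsphere R n).
Proof.
have /continuous_closedP H := @sumsq_continuous n.
exact: (H [set t | t = 1] (@closed_eq R 1)).
Qed.

End Geometry.

(** * The interval, disks and spheres *)

Section Spaces.
Variable R : realType.
Local Notation II := (set_type (@unit_interval R)).
Local Notation DD n := (set_type (disk R n)).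
Local Notation SS n := (set_type (bsphere R n)).

Lemma clamp_subproof (t : R) : @unit_interval R (Num.max 0 (Num.min 1 t)).
Proof.
rewrite /unit_interval /= le_max lexx /= ge_max ler01 /=.
by rewrite ge_min lexx.
Qed.

(** The retractions of the line onto I and of Euclidean space onto the disk give
    total functions, so that points and maps can be written by formulas. *)
Definition to_I (t : R) : II := exist (fun x => x \in _) _ (mem_set (clamp_subproof t)).

Lemma to_IK (t : R) : 0 <= t <= 1 -> set_val (to_I t) = t.
Proof.
by move=> /andP[t0 t1]; rewrite set_valE /=; rewrite (min_idPr t1) (max_idPr t0).
Qed.

Lemma I01 (t : II) : 0 <= set_val t <= 1.
Proof. exact: (set_valP t). Qed.

Lemma to_I_val (t : II) : to_I (set_val t) = t.
Proof. by apply: set_val_inj; rewrite to_IK // I01. Qed.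

Lemma to_I_continuous (W : topologicalType) (f : W -> R) :
  continuous f -> continuous (fun w => to_I (f w)).
Proof.
move=> cf; apply: to_subset_continuous.
by apply: cont_max; [exact: cont_cst | apply: cont_min => //; exact: cont_cst].
Qed.

Definition i0 : II := to_I 0.
Definition i1 : II := to_I 1.

Lemma i0E : set_val i0 = 0. Proof. by rewrite to_IK // lexx ler01. Qed.
Lemma i1E : set_val i1 = 1. Proof. by rewrite to_IK // lexx ler01. Qed.

Lemma shrink_subproof n (x : 'rV[R]_n) : disk R n ((Num.max 1 (enorm x))^-1 *: x).
Proof.
apply/diskE; have m1 : 0 < Num.max 1 (enorm x) by rewrite lt_max ltr01.
rewrite enormZ; last by rewrite invr_ge0 ltW.
by rewrite ler_pdivrMl// mulr1 le_max lexx orbT.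
Qed.

Definition to_disk n (x : 'rV[R]_n) : DD n := exist (fun x => x \in _) _ (mem_set
  (shrink_subproof x)).

Lemma to_diskK n (x : 'rV[R]_n) : enorm x <= 1 -> set_val (to_disk x) = x.
Proof. by move=> x1; rewrite set_valE /= (max_idPl x1) invr1 scale1r. Qed.

Lemma disk_norm_le1 n (x : DD n) : enorm (set_val x) <= 1.
Proof. by apply/diskE; exact: (set_valP x). Qed.

Lemma sphere_norm1 n (x : SS n) : enorm (set_val x) = 1.
Proof. by apply/sphereE; exact: (set_valP x). Qed.

Lemma to_disk_val n (x : DD n) : to_disk (set_val x) = x.
Proof. by apply: set_val_inj; rewrite to_diskK // disk_norm_le1. Qed.

Lemma to_disk_continuous (W : topologicalType) n (f : W -> 'rV[R]_n) :
  continuous f -> continuous (fun w => to_disk (f w)).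
Proof.
move=> cf; apply: to_subset_continuous.
rewrite (_ : set_val \o _ = fun w => (Num.max 1 (enorm (f w)))^-1 *: f w) //.
apply: rVZ_continuous => //; apply: cont_inv.
  by move=> w; rewrite gt_eqF // lt_max ltr01.
by apply: cont_max; [exact: cont_cst | exact: enorm_continuous].
Qed.

Definition sphere_incl n : SS n -> DD n := set_incl (@bsphere_disk R n).

Lemma sphere_incl_val n (s : SS n) : set_val (sphere_incl s) = set_val s.
Proof. by []. Qed.

Lemma sphere_incl_continuous n : continuous (@sphere_incl n).
Proof. exact: set_incl_continuous. Qed.

Lemma sphere_incl_inj n : injective (@sphere_incl n).
Proof. by move=> s s' e; apply: set_val_inj; rewrite -!sphere_incl_val e. Qed.

Lemma sphere_of_norm1 n (x : 'rV[R]_n) : enorm x = 1 -> exists s : SS n, set_val s = x.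
Proof. by move=> /sphereE x1; exists (exist _ x (mem_set x1)). Qed.

Lemma disk_to_sphere n (x : DD n) :
  enorm (set_val x) = 1 -> exists s : SS n, sphere_incl s = x.
Proof.
by move=> /sphere_of_norm1[s e]; exists s; apply: set_val_inj; rewrite sphere_incl_val.
Qed.

Lemma I_cpt_hausdorff : cpt_hausdorff II.
Proof.
apply: cpt_hausdorff_subset; first exact: Rhausdorff.
have -> : @unit_interval R = `[0, 1]%classic.
  by apply/seteqP; split=> t; rewrite /unit_interval /= in_itv.
exact: segment_compact.
Qed.

Lemma disk_cpt_hausdorff n : cpt_hausdorff (DD n).
Proof. by apply: cpt_hausdorff_subset; [exact: rV_hausdorff | exact: disk_compact]. Qed.

Lemma sphere_cpt_hausdorff n : cpt_hausdorff (SS n).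
Proof.
apply: cpt_hausdorff_subset; first exact: rV_hausdorff.
apply: (subclosed_compact (@sphere_closed R n) (@disk_compact R n)).
exact: bsphere_disk.
Qed.

Lemma sphere_I_cpt_hausdorff n : cpt_hausdorff (SS n * II)%type.
Proof. exact: cpt_hausdorff_prod (sphere_cpt_hausdorff n) I_cpt_hausdorff. Qed.

Definition continuous_set_val (W : topologicalType) (T : topologicalType) (A : set T)
    (f : W -> A) (cf : continuous f) :=
  continuous_after cf (@set_val_continuous T A).

Lemma continuous_fst_pair (T U : topologicalType) : continuous (fst : T * U -> T).
Proof. by case=> x y; exact: cvg_fst. Qed.

Lemma continuous_snd_pair (T U : topologicalType) : continuous (snd : T * U -> U).
Proof. by case=> x y; exact: cvg_snd. Qed.

Lemma continuous_idfun (T : topologicalType) : continuous (@id T).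
Proof. by move=> x; exact: cvg_id. Qed.

Section Collar.
(** Flow the point (x, t) of D^n x I backwards along the lines
    a |-> (y / (1 + a), s + a) until it meets D^n x 0 or S^(n-1) x I.  With r = |x|,
    [collar r t] is the time this takes: t if the bottom is met first, and the a
    with (1 + a) r = 1 if the side is.  It vanishes on the bottom and the side.
    Replacing r by 1/2 when it is smaller keeps the formula continuous at x = 0,
    and is harmless because there the bottom is always met first. *)
Definition collar (r t : R) : R := Num.min t ((Num.max r 2^-1)^-1 - 1).

Lemma collarP (r t : R) : 0 <= r <= 1 -> 0 <= t <= 1 ->
  0 <= collar r t <= t /\
  ((collar r t = t /\ (1 + t) * r <= 1) \/ (1 + collar r t) * r = 1).
Proof.
move=> /andP[r0 r1] /andP[t0 t1]; rewrite /collar.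
have m0 : 0 < Num.max r 2^-1 by rewrite lt_max invr_gt0 ltr0n orbT.
have m1 : Num.max r 2^-1 <= 1 by rewrite ge_max r1 /= invf_le1 ?ler1n ?ltr0n.
have i1 : 1 <= (Num.max r 2^-1)^-1 by rewrite invf_ge1.
have mr : r <= Num.max r 2^-1 by rewrite le_max lexx.
have mi : (Num.max r 2^-1) * (Num.max r 2^-1)^-1 = 1 by rewrite divff // gt_eqF.
have m2 : Num.max r 2^-1 = r \/ (Num.max r 2^-1 = 2^-1 /\ r <= 2^-1).
  by case: (leP r 2^-1) => h; [right | left].
set m := Num.max r 2^-1 in m0 m1 i1 mr mi m2 *.
split; first by rewrite le_min t0 subr_ge0 i1 ge_min lexx.
have [h|h] := leP t (m^-1 - 1).
  by left; split => //; nra.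
have [e|[e re]] := m2; first by right; rewrite addrCA subrr addr0 -e mulrC.
by exfalso; rewrite e invrK in h; lra.
Qed.

Lemma collar0 r : 0 <= r <= 1 -> collar r 0 = 0.
Proof.
move=> hr; have h0 : 0 <= (0 : R) <= 1 by rewrite lexx ler01.
by have [h _] := collarP hr h0; apply/eqP; rewrite eq_le andbC.
Qed.

Lemma collar1 t : 0 <= t <= 1 -> collar 1 t = 0.
Proof.
move=> ht; have h0 : 0 <= (1 : R) <= 1 by rewrite lexx ler01.
have [/andP[h1 h2] [[e h]|e]] := collarP h0 ht.
- by apply/eqP; rewrite eq_le h1 andbT e; lra.
- by lra.
Qed.

Lemma collar_continuous (W : topologicalType) (r t : W -> R) :
  continuous r -> continuous t -> continuous (fun w => collar (r w) (t w)).
Proof.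
move=> cr ct; apply: cont_min => //; apply: cont_sub; last exact: cont_cst.
apply: cont_inv; first by move=> w; rewrite gt_eqF // lt_max invr_gt0 ltr0n orbT.
apply: cont_max => //.  exact: cont_cst.
Qed.

End Collar.

Variable G : finGroupType.
Implicit Types A B X Y Z : gspace G.

(** Concatenation of homotopies.  Later homotopies assembled from two pieces are
    obtained by reparametrising this one, so this is the only place where their
    continuity is checked piecewise. *)
Lemma gprod_glue_cat A Y (h v : isvt_map (gprod A II) Y) :
  (forall a, h (a, i1) = v (a, i0)) ->
  exists c : isvt_map (gprod A II) Y,
    (forall a s, c (a, to_I (set_val s / 2)) = h (a, s)) /\
    (forall a s, c (a, to_I ((1 + set_val s) / 2)) = v (a, s)).
Proof.
move=> hv; apply: glue_gprod.
- exact: I_cpt_hausdorff.2.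
- exact: I_cpt_hausdorff.
- exact: I_cpt_hausdorff.
- apply: to_I_continuous; apply: cont_mul; last exact: cont_cst.
  exact: set_val_continuous.
- apply: to_I_continuous; apply: cont_mul; last exact: cont_cst.
  by apply: cont_add; [exact: cont_cst | exact: set_val_continuous].
- move=> t; have /andP[t0 t1] := I01 t.
  have [ht|ht] := leP (set_val t) 2^-1; [left; exists (to_I (2 * set_val t)) |
      right; exists (to_I (2 * set_val t - 1))];
    by apply: set_val_inj; rewrite !to_IK; lra.
- move=> a s s' /(congr1 set_val); have := I01 s; have := I01 s' => hs hs'.
  rewrite !to_IK; [|lra|lra] => e; suff -> : s = s' by [].
  by apply: set_val_inj; lra.
- move=> a s s' /(congr1 set_val); have := I01 s; have := I01 s' => hs hs'.
  rewrite !to_IK; [|lra|lra] => e; suff -> : s = s' by [].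
  by apply: set_val_inj; lra.
- move=> a s s' /(congr1 set_val); have := I01 s; have := I01 s' => hs hs'.
  rewrite !to_IK; [|lra|lra] => e.
  have -> : s = i1 by apply: set_val_inj; rewrite i1E; lra.
  have -> : s' = i0 by apply: set_val_inj; rewrite i0E; lra.
  exact: hv.
Qed.

End Spaces.

(** * Serre fibrations relative to a G-space and relative homotopy lifting *)

Section Serre.
Variables (R : realType) (G : finGroupType).
Local Notation II := (set_type (@unit_interval R)).
Local Notation DD n := (set_type (disk R n)).
Local Notation SS n := (set_type (bsphere R n)).
Local Notation i0 := (i0 R).
Local Notation i1 := (i1 R).
Variable A : gspace G.
Implicit Types B X Y Z E : gspace G.

(** Maps that induce Serre fibrations on spaces of isovariant maps out of A,
    phrased without mapping spaces; likewise for acyclic fibrations below. *)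
Definition serre_fib E Z (p : isvt_map E Z) :=
  forall n (w : isvt_map (gprod A (DD n)) E) (V : isvt_map (gprod (gprod A (DD n)) II) Z),
  (forall x, p (w x) = V (x, i0)) ->
  exists L : isvt_map (gprod (gprod A (DD n)) II) E,
    (forall x, L (x, i0) = w x) /\ (forall y, p (L y) = V y).

Definition serre_afib E Z (p : isvt_map E Z) :=
  forall n (u : isvt_map (gprod A (SS n)) E) (v : isvt_map (gprod A (DD n)) Z),
  (forall a s, p (u (a, s)) = v (a, sphere_incl s)) ->
  exists h : isvt_map (gprod A (DD n)) E,
    (forall a s, h (a, sphere_incl s) = u (a, s)) /\ (forall y, p (h y) = v y).

Definition gprod_assoc (K L : topologicalType) :
    isvt_map (gprod A (K * L)%type) (gprod (gprod A K) L) :=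
  @gpair G (gprod A (K * L)%type) (gprod A K) L
    (gprod_map A (@continuous_fst_pair K L)) _
    (continuous_after (@gsnd_continuous G A (K * L)%type) (@continuous_snd_pair K L))
    (fun _ _ => erefl).

(** A homotopy of maps on A x K is a map on (A x K) x I; this reparametrises it
    by K x I as a whole, not in the variables of K and I separately. *)
Definition gprod_repar (K L M : topologicalType) (f : K * L -> M) (cf : continuous f) :
    isvt_map (gprod (gprod A K) L) (gprod A M).
Proof.
apply: (@gpair G (gprod (gprod A K) L) A M
    (isvt_comp (gfst A K) (gfst (gprod A K) L)) (fun x => f (x.1.2, x.2))).
  apply: (continuous_after (U := (K * L)%type) _ cf).
  apply: pair_continuous; last exact: gsnd_continuous.
  exact: (continuous_after (@gfst_continuous _ _ _) (@gsnd_continuous _ _ _)).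
by [].
Defined.

Definition gprod_repar2 (K L K' L' : topologicalType) (f : K * L -> K') (g : K * L -> L')
    (cf : continuous f) (cg : continuous g) :
    isvt_map (gprod (gprod A K) L) (gprod (gprod A K') L') :=
  isvt_comp (gprod_assoc K' L') (gprod_repar (pair_continuous cf cg)).

(** D^n is homeomorphic to D^n x 0 together with S^(n-1) x I: the inner half-disk
    is the bottom, and the outer annulus is the side in polar coordinates.  A map
    on bottom and side thus becomes a map ub on A x D^n. *)
Lemma glue_boundary n E (w : isvt_map (gprod A (DD n)) E)
    (k : isvt_map (gprod (gprod A (SS n)) II) E) :
  (forall a s, w (a, sphere_incl s) = k ((a, s), i0)) ->
  exists ub : isvt_map (gprod A (DD n)) E,
    (forall a x, ub (a, to_disk (2^-1 *: set_val x)) = w (a, x)) /\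
    (forall a s t, ub (a, to_disk (((1 + set_val t) / 2) *: set_val s)) = k ((a, s), t)).
Proof.
move=> wk.
pose f1 (x : DD n) : DD n := to_disk (2^-1 *: set_val x).
pose f2 (p : SS n * II) : DD n := to_disk (((1 + set_val p.2) / 2) *: set_val p.1).
have f1v x : set_val (f1 x) = 2^-1 *: set_val x.
  by rewrite to_diskK // enormZ; have := disk_norm_le1 x; lra.
have f2v s t : set_val (f2 (s, t)) = ((1 + set_val t) / 2) *: set_val s.
  by have := I01 t => ht; rewrite to_diskK // enormZ ?sphere_norm1; lra.
have f2I p p' : f2 p = f2 p' -> p = p'.
  case: p p' => [s t] [s' t'] /(congr1 set_val); rewrite !f2v => e.
  have ht := I01 t; have ht' := I01 t'.
  have et : set_val t = set_val t'.
    by have := congr1 (@enorm R n) e; rewrite !enormZ ?sphere_norm1; lra.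
  congr (_, _); last exact: set_val_inj.
  apply: set_val_inj; move: e; rewrite et; apply: scalerI.
  by rewrite gt_eqF //; lra.
have := @glue_gprod G A E (DD n) (DD n) (SS n * II)%type f1 f2 w
  (isvt_comp k (gprod_assoc (SS n) II)).
case.
- exact: (disk_cpt_hausdorff _ _).2.
- exact: disk_cpt_hausdorff.
- exact: sphere_I_cpt_hausdorff.
- apply: to_disk_continuous; apply: rVZ_continuous; first exact: cont_cst.
  exact: set_val_continuous.
- apply: to_disk_continuous; apply: rVZ_continuous.
    apply: cont_mul; last exact: cont_cst.
    by apply: cont_add; [exact: cont_cst | apply: continuous_set_val; exact:
      continuous_snd_pair].
  by apply: continuous_set_val; exact: continuous_fst_pair.
- move=> x; have [h|h] := leP (enorm (set_val x)) 2^-1; [left|right].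
    exists (to_disk (2 *: set_val x)); apply: set_val_inj.
    rewrite f1v to_diskK; last by rewrite enormZ //; lra.
    by rewrite scalerA mulVf // scale1r.
  have x1 := disk_norm_le1 x.
  have [s es] : exists s : SS n, set_val s = (enorm (set_val x))^-1 *: set_val x.
    by apply: sphere_of_norm1; rewrite enormZ ?invr_ge0 ?enorm_ge0// mulVf // gt_eqF //;
      lra.
  exists (s, to_I (2 * enorm (set_val x) - 1)); apply: set_val_inj.
  rewrite f2v to_IK; last by lra.
  rewrite es scalerA (_ : _ * _ = 1) ?scale1r //.
  by field; rewrite gt_eqF //; lra.
- move=> a x x' e; suff -> : x = x' by [].
  apply: set_val_inj; apply: (@scalerI _ _ (2^-1 : R)); first by rewrite invr_eq0.
  by rewrite -!f1v e.
- by move=> a p p' /f2I ->.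
- move=> a x [s t] e; have := congr1 (@enorm R n) (congr1 set_val e).
  rewrite f1v f2v !enormZ ?sphere_norm1 //; have := I01 t => ht; [|lra] => e'.
  have x1 := disk_norm_le1 x.
  have -> : t = i0 by apply: set_val_inj; rewrite i0E; lra.
  rewrite -[RHS]wk; congr (w (a, _)); apply: set_val_inj; rewrite sphere_incl_val.
  move: (congr1 set_val e); rewrite f1v f2v.
  rewrite (_ : set_val t = 0) ?addr0 ?mul1r; last by lra.
  by apply: scalerI; rewrite invr_eq0.
move=> ub [u1 u2]; exists ub; split=> [a x|a s t]; first exact: u1.
exact: (u2 a (s, t)).
Qed.

(** The point of the disk that [glue_boundary] assigns to the end of the backward
    flow line of (x, t); the end itself is ((1 + a) x, t - a), with a the collar
    time [collar_depth]. *)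
Let collar_proj (n : nat) (p : DD n * II) : DD n :=
  to_disk (((1 + collar (enorm (set_val p.1)) (set_val p.2)) *
     (1 + set_val p.2 - collar (enorm (set_val p.1)) (set_val p.2)) / 2) *: set_val p.1).
Let collar_depth (n : nat) (p : DD n * II) : II := to_I (collar (enorm (set_val p.1))
  (set_val p.2)).

Lemma collar_norm_continuous n :
  continuous (fun p : DD n * II => collar (enorm (set_val p.1)) (set_val p.2)).
Proof.
apply: collar_continuous.
  by apply: enorm_continuous; apply: continuous_set_val; exact: continuous_fst_pair.
by apply: continuous_set_val; exact: continuous_snd_pair.
Qed.

Lemma collar_proj_continuous n : continuous (@collar_proj n).
Proof.
apply: to_disk_continuous; apply: rVZ_continuous; last by apply: continuous_set_val;
  exact: continuous_fst_pair.
have cl := @collar_norm_continuous n; have ct : continuous (fun p : DD n * II => set_val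
  p.2).
  by apply: continuous_set_val; exact: continuous_snd_pair.
apply: cont_mul; last exact: cont_cst.
apply: cont_mul; first by apply: cont_add => //; exact: cont_cst.
by apply: cont_sub => //; apply: cont_add => //; exact: cont_cst.
Qed.

Lemma collar_depth_continuous n : continuous (@collar_depth n).
Proof. by apply: to_I_continuous; exact: collar_norm_continuous. Qed.

Lemma disk_norm01 n (x : DD n) : 0 <= enorm (set_val x) <= 1.
Proof. by rewrite enorm_ge0 disk_norm_le1. Qed.

Lemma collar_proj0 n (x : DD n) : collar_proj (x, i0) = to_disk (2^-1 *: set_val x).
Proof.
rewrite /collar_proj /= i0E collar0 ?disk_norm01 //.
by apply: (congr1 (fun c => to_disk (c *: set_val x))); lra.
Qed.

Lemma collar_depth0 n (x : DD n) : collar_depth (x, i0) = i0.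
Proof. by rewrite /collar_depth /= i0E collar0 ?disk_norm01. Qed.

Lemma collar_proj1 n (s : SS n) t : collar_proj (sphere_incl s, t) = to_disk (((1 +
  set_val t) / 2) *: set_val s).
Proof.
rewrite /collar_proj /= sphere_incl_val sphere_norm1 collar1 ?I01 //.
by apply: (congr1 (fun c => to_disk (c *: set_val s))); lra.
Qed.

Lemma collar_depth1 n (s : SS n) t : collar_depth (sphere_incl s, t) = i0.
Proof. by rewrite /collar_depth /= sphere_incl_val sphere_norm1 collar1 ?I01. Qed.

(** Flowing back retracts D^n x I onto its bottom and side. *)
Lemma homotopy_extension n E (w : isvt_map (gprod A (DD n)) E)
    (k : isvt_map (gprod (gprod A (SS n)) II) E) :
  (forall a s, w (a, sphere_incl s) = k ((a, s), i0)) ->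
  exists L : isvt_map (gprod (gprod A (DD n)) II) E,
    (forall x, L (x, i0) = w x) /\ (forall a s t, L ((a, sphere_incl s), t) = k ((a, s),
      t)).
Proof.
move=> /glue_boundary[ub [u1 u2]].
exists (isvt_comp ub (gprod_repar (@collar_proj_continuous n))); split=> [[a x]|a s t].
  by rewrite -u1 -collar_proj0.
by rewrite -u2 -collar_proj1.
Qed.

(** The flow exhibits the pair formed by D^n x I and its bottom and side as a
    retract of the pair formed by D^n x I and D^n x 0.  The homotopy V is pulled
    back along the forward flow, lifted from [ub], and the lift is read off at the
    point ([collar_proj], [collar_depth]) from which (x, t) is reached. *)
Lemma relative_lifting n E Z (p : isvt_map E Z) (w : isvt_map (gprod A (DD n)) E)
    (k : isvt_map (gprod (gprod A (SS n)) II) E)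
    (V : isvt_map (gprod (gprod A (DD n)) II) Z) :
  serre_fib p ->
  (forall a s, w (a, sphere_incl s) = k ((a, s), i0)) ->
  (forall x, p (w x) = V (x, i0)) ->
  (forall a s t, p (k ((a, s), t)) = V ((a, sphere_incl s), t)) ->
  exists L : isvt_map (gprod (gprod A (DD n)) II) E,
    [/\ forall x, L (x, i0) = w x,
        forall a s t, L ((a, sphere_incl s), t) = k ((a, s), t) &
        forall y, p (L y) = V y].
Proof.
move=> fp wk pw pk; have [ub [u1 u2]] := glue_boundary wk.
(* (bf, tf) is the forward flow, for time q.2, from the point of the bottom or
   side that corresponds to q.1 in [glue_boundary]. *)
pose bf (q : DD n * II) : DD n :=
  to_disk ((2 / (Num.max 1 (2 * enorm (set_val q.1)) * (1 + set_val q.2))) *: set_val q.1).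
pose tf (q : DD n * II) : II :=
  to_I (Num.max 0 (2 * enorm (set_val q.1) - 1) + set_val q.2).
have ce : continuous (fun q : DD n * II => enorm (set_val q.1)).
  by apply: enorm_continuous; apply: continuous_set_val; exact: continuous_fst_pair.
have ct : continuous (fun q : DD n * II => set_val q.2).
  by apply: continuous_set_val; exact: continuous_snd_pair.
have cb : continuous bf.
  apply: to_disk_continuous; apply: rVZ_continuous; last by apply: continuous_set_val;
    exact: continuous_fst_pair.
  apply: cont_mul; first exact: cont_cst.
  apply: cont_inv => [q|].
    rewrite gt_eqF // mulr_gt0 // ?lt_max ?ltr01//.
    by have := I01 q.2; lra.
  apply: cont_mul; last by apply: cont_add => //; exact: cont_cst.
  by apply: cont_max; [exact: cont_cst | apply: cont_mul => //; exact: cont_cst].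
have ctf : continuous tf.
  apply: to_I_continuous; apply: cont_add => //; apply: cont_max; first exact: cont_cst.
  by apply: cont_sub; [apply: cont_mul => //; exact: cont_cst | exact: cont_cst].
have [|T [T0 pT]] := fp n ub (isvt_comp V (gprod_repar2 cb ctf)).
  move=> [a x] /=; rewrite /bf /tf /= i0E !addr0 mulr1.
  have [h|h] := leP (enorm (set_val x)) 2^-1.
    have ex : x = to_disk (2^-1 *: set_val (to_disk (2 *: set_val x))).
      apply: set_val_inj.
      rewrite (to_diskK (x := 2 *: _)); last by rewrite enormZ //; lra.
      by rewrite scalerA mulVf // scale1r to_disk_val.
    rewrite {1}ex u1 pw; congr (V ((a, _), _)).
      by rewrite (max_idPl _) ?divr1 //; lra.
    by congr to_I; rewrite (max_idPl _) //; lra.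
  have x1 := disk_norm_le1 x.
  have [s es] : exists s : SS n, set_val s = (enorm (set_val x))^-1 *: set_val x.
    by apply: sphere_of_norm1; rewrite enormZ ?invr_ge0 ?enorm_ge0// mulVf // gt_eqF //;
      lra.
  have ex : x = to_disk (((1 + set_val (to_I (2 * enorm (set_val x) - 1))) / 2) *:
    set_val s).
    rewrite to_IK; last by lra.
    rewrite es scalerA (_ : _ * _ = 1) ?scale1r ?to_disk_val //.
    by field; rewrite gt_eqF //; lra.
  rewrite {1}ex u2 pk; congr (V ((a, _), _)).
    rewrite (max_idPr _); last by lra.
    rewrite -[LHS]to_disk_val sphere_incl_val es.
    apply: (congr1 (fun c => to_disk (c *: set_val x))).
    by field; rewrite gt_eqF //; lra.
  by congr to_I; rewrite (max_idPr _) //; lra.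
exists (isvt_comp T (gprod_repar2 (@collar_proj_continuous n) (@collar_depth_continuous
  n))); split.
- move=> [a x] /=; rewrite -u1 -collar_proj0 -T0; congr (T _).
  by rewrite /gprod_repar2 /= collar_depth0.
- move=> a s t /=; rewrite -u2 -collar_proj1 -T0; congr (T _).
  by rewrite /gprod_repar2 /= collar_depth1.
move=> [[a x] t] /=; rewrite pT /=; congr (V _).
rewrite /= /bf /tf /= /collar_proj /collar_depth /=.
have hx := disk_norm01 x; have ht := I01 t.
set r := enorm (set_val x) in hx *.
have [/andP[l0 lt] ll] := collarP hx ht.
set l := collar r (set_val t) in l0 lt ll *.
have l1 : 0 <= l <= 1 by lra.
have r1 : (1 + l) * r <= 1.
  by case: ll => [[-> //]|->].
set c := (1 + l) * (1 + set_val t - l) / 2.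
have c0 : 0 <= c by rewrite /c; nra.
have cr : c * r <= 1 by rewrite /c; nra.
have e1 : enorm (c *: set_val x) = c * r by rewrite enormZ.
rewrite !to_diskK ?e1 // to_IK //.
have ecr : 2 * (c * r) = (1 + l) * r * (1 + set_val t - l) by rewrite /c; field.
have lp : 1 + l != 0 by rewrite gt_eqF //; lra.
case: ll => [[el h]|h].
  have ct' : 1 + set_val t - l = 1 by rewrite el; ring.
  rewrite ecr ct' mulr1 (max_idPl _) // (max_idPl _); last by lra.
  rewrite scalerA (_ : _ * c = 1) ?scale1r ?to_disk_val ?add0r ?el ?to_I_val //.
  by rewrite /c ct' -el; field.
have tp : 1 + set_val t - l != 0 by rewrite gt_eqF //; lra.
rewrite ecr h mul1r (max_idPr _); last by lra.
rewrite (max_idPr _); last by lra.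
rewrite scalerA (_ : _ * c = 1) ?scale1r ?to_disk_val //.
  by congr (_, _); rewrite -[RHS]to_I_val; congr to_I; ring.
by rewrite /c; field; rewrite tp lp.
Qed.

End Serre.

(** * Spheres as pairs of hemispheres *)

Section Hemi.
Variables (R : realType) (G : finGroupType).
Local Notation II := (set_type (@unit_interval R)).
Local Notation DD n := (set_type (disk R n)).
Local Notation SS n := (set_type (bsphere R n)).
Local Notation i0 := (i0 R).
Local Notation i1 := (i1 R).

(** The height above x of the unit sphere of one dimension more. *)
Definition height n (x : 'rV[R]_n) : R := Num.sqrt (1 - \sum_(i < n) x 0 i ^+ 2).

Lemma height_sq n (x : DD n) :
  height (set_val x) ^+ 2 = 1 - \sum_(i < n) set_val x 0 i ^+ 2.
Proof. by rewrite sqr_sqrtr // subr_ge0; exact: (set_valP x). Qed.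

Lemma height_ge0 n (x : 'rV[R]_n) : 0 <= height x.
Proof. exact: sqrtr_ge0. Qed.

Lemma height_sphere n (x : SS n) : height (set_val x) = 0.
Proof.
by rewrite /height (_ : \sum_(i < n) _ = 1) ?subrr ?sqrtr0 //; exact: (set_valP x).
Qed.

Lemma height_eq0 n (x : DD n) : height (set_val x) = 0 -> exists s : SS n, sphere_incl s
  = x.
Proof.
move=> h0; apply: disk_to_sphere; apply/sphereE; rewrite /bsphere /=.
by have := height_sq x; rewrite h0; lra.
Qed.

Lemma height_continuous (W : topologicalType) n (f : W -> 'rV[R]_n) :
  continuous f -> continuous (fun w => height (f w)).
Proof.
move=> cf; apply: cont_sqrt; apply: cont_sub; first exact: cont_cst.
apply: cont_sum => i.
by apply: (cont_mul (W := W)); exact: from_rV_continuous.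
Qed.

Lemma hemi_subproof n (b : bool) (x : DD n) :
  bsphere R (n + 1) (row_mx (set_val x) (((-1) ^+ b * height (set_val x))%:M)).
Proof.
rewrite /bsphere /= row_mx_sumsq mxE eqxx mulr1n exprMn height_sq sqrr_sign mul1r.
by rewrite addrC subrK.
Qed.

Definition hemi n (b : bool) (x : DD n) : SS (n + 1) :=
  exist (fun x => x \in _) _ (mem_set (hemi_subproof b x)).

Lemma hemi_val n b (x : DD n) :
  set_val (hemi b x) = row_mx (set_val x) (((-1) ^+ b * height (set_val x))%:M).
Proof. by rewrite set_valE. Qed.

Lemma hemi_continuous n b : continuous (@hemi n b).
Proof.
apply: to_subset_continuous; apply: row_mx_continuous; first exact: set_val_continuous.
apply: scalar_mx_continuous; apply: cont_mul; first exact: cont_cst.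
by apply: height_continuous; exact: set_val_continuous.
Qed.

Lemma hemi_sphere n b b' (s : SS n) : hemi b (sphere_incl s) = hemi b' (sphere_incl s).
Proof.
by apply: set_val_inj; rewrite !hemi_val sphere_incl_val height_sphere !mulr0.
Qed.

Lemma to_diskK_sumsq n (x : 'rV[R]_n) : \sum_(i < n) x 0 i ^+ 2 <= 1 -> set_val (to_disk
  x) = x.
Proof. by move=> h; rewrite to_diskK //; apply/diskE. Qed.

Lemma hemi_surj n (k : SS (n + 1)) : exists b x, k = @hemi n b x.
Proof.
have kS : \sum_(i < n) lsubmx (set_val k) 0 i ^+ 2 + (rsubmx (set_val k) 0 0) ^+ 2 = 1.
  by rewrite -row_mx_sumsq hsubmxK; exact: (set_valP k).
have kD : \sum_(i < n) lsubmx (set_val k) 0 i ^+ 2 <= 1.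
  by have := sqr_ge0 (rsubmx (set_val k) 0 0); lra.
have hk : height (lsubmx (set_val k)) = `|rsubmx (set_val k) 0 0|.
  by rewrite /height -kS addrAC subrr add0r sqrtr_sqr.
exists (rsubmx (set_val k) 0 0 < 0), (to_disk (lsubmx (set_val k))).
apply: set_val_inj; rewrite hemi_val to_diskK_sumsq // hk.
rewrite -[LHS]hsubmxK; congr row_mx.
apply/rowP => i; rewrite ord1 [RHS]mxE eqxx mulr1n; set t := rsubmx _ 0 0.
have [h|h] := ltP t 0; first by rewrite ltr0_norm // expr1 mulN1r opprK.
by rewrite ger0_norm // mul1r.
Qed.

Variable A : gspace G.
Implicit Types X Y Z E : gspace G.

(** The hemispheres meet where the height vanishes, that is, over S^(n-1). *)
Lemma glue_hemispheres n E (f : bool -> isvt_map (gprod A (DD n)) E) :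
  (forall a s, f true (a, sphere_incl s) = f false (a, sphere_incl s)) ->
  exists u : isvt_map (gprod A (SS (n + 1))) E,
    forall a b x, u (a, hemi b x) = f b (a, x).
Proof.
move=> ff.
have hI b : injective (@hemi n b).
  move=> x x' /(congr1 set_val); rewrite !hemi_val => /eq_row_mx[e _].
  exact: set_val_inj.
have := @glue_gprod G A E (SS (n + 1)) (DD n) (DD n) (@hemi n true) (@hemi n false)
  (f true) (f false).
case; last by move=> u [u1 u2]; exists u => a [] x; [exact: u1 | exact: u2].
- exact: (sphere_cpt_hausdorff _ _).2.
- exact: disk_cpt_hausdorff.
- exact: disk_cpt_hausdorff.
- exact: hemi_continuous.
- exact: hemi_continuous.
- by move=> k; have [[] [x ->]] := hemi_surj k; [left|right]; exists x.
- by move=> a k k' /hI ->.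
- by move=> a k k' /hI ->.
- move=> a k k' e; move/(congr1 set_val): e; rewrite !hemi_val => /eq_row_mx[e1 e2].
  have ek : k = k' by apply: set_val_inj.
  subst k'; have /height_eq0[s <-] : height (set_val k) = 0.
    move/(congr1 (fun M : 'M[R]_1 => M 0 0)): e2.
    by rewrite !mxE eqxx !mulr1n mul1r expr1 mulN1r; have := height_ge0 (set_val k); lra.
  exact: ff.
Qed.

Lemma empty_map X E : (X -> False) -> exists f : isvt_map X E, True.
Proof.
move=> X0; have f : X -> E by move=> /X0.
by unshelve eexists (@IsvtMap G X E f _ _ _) => // x; case: (X0 x).
Qed.

Lemma afib_lift_disk_of_sphere n E Z (p : isvt_map E Z) (v : isvt_map (gprod A (DD n)) Z) :
  serre_afib R A p ->
  (forall v' : isvt_map (gprod A (SS n)) Z,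
     exists h : isvt_map (gprod A (SS n)) E, forall x, p (h x) = v' x) ->
  exists h : isvt_map (gprod A (DD n)) E, forall x, p (h x) = v x.
Proof.
move=> ap /(_ (isvt_comp v (gprod_map A (@sphere_incl_continuous R n))))[u hu].
have [a s|h [_ ph]] := ap n u v; first exact: hu.
by exists h.
Qed.

(** Spheres are cofibrant: lift over the equator by induction, extend over one
    hemisphere, and then over the other relative to the equator. *)
Lemma afib_lift_sphere n E Z (p : isvt_map E Z) (v : isvt_map (gprod A (SS n)) Z) :
  serre_afib R A p ->
  exists h : isvt_map (gprod A (SS n)) E, forall x, p (h x) = v x.
Proof.
move=> ap; elim: n v => [v|n IH].
  have S0 (x : gprod A (SS 0)) : False.
    case: x => a s; have := set_valP s; rewrite /bsphere /= big_ord0 => /esym/eqP.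
    by rewrite oner_eq0.
  by have [f _] := empty_map E S0; exists f => x; case: (S0 x).
rewrite -[n.+1]addn1 => v.
have [f0 hf0] := afib_lift_disk_of_sphere
  (isvt_comp v (gprod_map A (@hemi_continuous n false))) ap IH.
have [|f1 [f1s hf1]] := ap n (isvt_comp f0 (gprod_map A (@sphere_incl_continuous R n)))
  (isvt_comp v (gprod_map A (@hemi_continuous n true))).
  move=> a s; rewrite [LHS]hf0 /=; congr (v (_, _)); exact: hemi_sphere.
have [a s|u hu] := @glue_hemispheres n E (fun b => if b then f1 else f0).
  exact: f1s.
exists u => -[a k]; have [b [x ->]] := hemi_surj k.
by rewrite hu; case: b; [rewrite hf1 | rewrite hf0].
Qed.

(** Together f1 and f2 form a map on S^n, which extends over D^(n+1) along p; the
    homotopy is the restriction along the lens (x, t) |-> (x, (2 t - 1) height x)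
    from D^n x I to D^(n+1), which collapses S^(n-1) x I onto the equator and so
    makes the homotopy relative to S^(n-1). *)
Lemma afib_fibre_homotopy n E Z (p : isvt_map E Z) (f1 f2 : isvt_map (gprod A (DD n)) E) :
  serre_afib R A p ->
  (forall x, p (f1 x) = p (f2 x)) ->
  (forall a s, f1 (a, sphere_incl s) = f2 (a, sphere_incl s)) ->
  exists K : isvt_map (gprod (gprod A (DD n)) II) E,
    [/\ forall x, K (x, i0) = f1 x, forall x, K (x, i1) = f2 x,
        forall a s t, K ((a, sphere_incl s), t) = f1 (a, sphere_incl s) &
        forall x t, p (K (x, t)) = p (f1 x)].
Proof.
move=> ap pf fs.
have [u hu] := @glue_hemispheres n E (fun b => if b then f1 else f2) fs.
pose pr (z : DD (n + 1)) : DD n := to_disk (lsubmx (set_val z)).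
have cpr : continuous pr.
  by apply: to_disk_continuous; apply: lsubmx_continuous; exact: set_val_continuous.
have pr_hemi b x : pr (sphere_incl (@hemi n b x)) = x.
  by rewrite /pr sphere_incl_val hemi_val row_mxKl to_disk_val.
have [a s|h [hs ph]] := ap _ u (isvt_comp (isvt_comp p f1) (gprod_map A cpr)).
  have [b [x ->]] := hemi_surj s.
  by rewrite hu /= /gprod_map /= pr_hemi; case: b.
pose lens (q : DD n * II) : DD (n + 1) :=
  to_disk (row_mx (set_val q.1) (((2 * set_val q.2 - 1) * height (set_val q.1))%:M)).
have cl : continuous lens.
  apply: to_disk_continuous; apply: row_mx_continuous.
    by apply: continuous_set_val; exact: continuous_fst_pair.
  apply: scalar_mx_continuous; apply: cont_mul.
    apply: cont_sub; last exact: cont_cst; apply: cont_mul; first exact: cont_cst.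
    by apply: continuous_set_val; exact: continuous_snd_pair.
  by apply: height_continuous; apply: continuous_set_val; exact: continuous_fst_pair.
have lens_val x t : set_val (lens (x, t)) =
    row_mx (set_val x) (((2 * set_val t - 1) * height (set_val x))%:M).
  rewrite to_diskK_sumsq // row_mx_sumsq mxE eqxx mulr1n exprMn height_sq /=.
  have := set_valP x; rewrite /disk /=; set S := \sum_(i < n) _ => sphere_norm1.
  have : (2 * set_val t - 1) ^+ 2 <= 1 by have := I01 t; nra.
  by nra.
exists (isvt_comp h (gprod_repar A cl)); split=> [[a x]|[a x]|a s t|[a x] t].
- rewrite -[RHS](hu a true) -hs; congr (h (a, _)); apply: set_val_inj.
  rewrite lens_val sphere_incl_val hemi_val i0E; congr (row_mx _ (_ %:M)).
  by rewrite expr1; lra.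
- rewrite -[RHS](hu a false) -hs; congr (h (a, _)); apply: set_val_inj.
  rewrite lens_val sphere_incl_val hemi_val i1E; congr (row_mx _ (_ %:M)).
  by rewrite expr0; lra.
- rewrite -[RHS](hu a true) -hs; congr (h (a, _)); apply: set_val_inj.
  by rewrite lens_val !sphere_incl_val hemi_val !sphere_incl_val height_sphere !mulr0.
rewrite ph /= /pr; congr (p (f1 (a, _))).
by rewrite lens_val row_mxKl to_disk_val.
Qed.

(** The pair (D^n x I, D^n x 0) is a retract of D^(n+1) with its lower hemisphere,
    and the lower hemisphere is extended first to the upper one and then to the
    whole disk. *)
Lemma afib_fib E Z (p : isvt_map E Z) : serre_afib R A p -> serre_fib R A p.
Proof.
move=> ap n w V pw.
(* The retraction sends (y, s) to (2 y, s + height y), truncated to D^n x I; the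
   section e sends (x, t) to (x / 2, t - height (x / 2)).  The factors 2 keep the
   boundary of D^n away from the equator, where the height vanishes. *)
pose dbl (x : DD n) : DD n := to_disk (2 *: set_val x).
have cdbl : continuous dbl.
  apply: to_disk_continuous; apply: rVZ_continuous; first exact: cont_cst.
  exact: set_val_continuous.
pose um := isvt_comp w (gprod_map A cdbl).
pose tf (z : DD (n + 1)) : II :=
  to_I (set_val z 0 (rshift n 0) + height (lsubmx (set_val z))).
pose pf (z : DD (n + 1)) : DD n := to_disk (2 *: lsubmx (set_val z)).
have cz : continuous (fun z : DD (n + 1) => lsubmx (set_val z)).
  by apply: lsubmx_continuous; exact: set_val_continuous.
have ctf : continuous tf.
  apply: to_I_continuous; apply: cont_add; last exact: height_continuous.
  by apply: from_rV_continuous; exact: set_val_continuous.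
have cpf : continuous pf by apply: to_disk_continuous; apply: rVZ_continuous => //;
  exact: cont_cst.
pose r : isvt_map (gprod A (DD (n + 1))) (gprod (gprod A (DD n)) II) :=
  isvt_comp (gprod_assoc A (DD n) II) (gprod_map A (pair_continuous cpf ctf)).
have pf_hemi b x : pf (sphere_incl (@hemi n b x)) = dbl x.
  by rewrite /pf sphere_incl_val hemi_val row_mxKl.
have tf_low x : tf (sphere_incl (@hemi n true x)) = i0.
  rewrite /tf sphere_incl_val hemi_val row_mxKl row_mxEr mxE eqxx mulr1n expr1 mulN1r.
  by rewrite addrC subrr.
have [a s|up [ups pup]] := ap n (isvt_comp um (gprod_map A (@sphere_incl_continuous R n)))
    (isvt_comp (isvt_comp V r) (isvt_comp (gprod_map A (@sphere_incl_continuous R (n + 1)))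
      (gprod_map A (@hemi_continuous n false)))).
  rewrite [LHS]pw /= /gprod_repar /=; congr (V _).
  by rewrite (hemi_sphere false true) tf_low pf_hemi.
have [a s|u hu] := @glue_hemispheres n E (fun b => if b then um else up).
  by rewrite [RHS]ups.
have [a s|h [hs ph]] := ap _ u (isvt_comp V r).
  have [[] [x ->]] := hemi_surj s; rewrite hu.
    rewrite [LHS]pw /=; congr (V _).
    by rewrite tf_low pf_hemi.
  by rewrite pup.
pose e (q : DD n * II) : DD (n + 1) :=
  to_disk (row_mx (2^-1 *: set_val q.1) ((set_val q.2 - height (2^-1 *: set_val q.1))%:M)).
have cx : continuous (fun q : DD n * II => 2^-1 *: set_val q.1).
  by apply: rVZ_continuous; [exact: cont_cst | apply: continuous_set_val; exact:
    continuous_fst_pair].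
have ce : continuous e.
  apply: to_disk_continuous; apply: row_mx_continuous => //.
  apply: scalar_mx_continuous; apply: cont_sub; last exact: height_continuous.
  by apply: continuous_set_val; exact: continuous_snd_pair.
have half x : to_disk (2 *: (2^-1 *: set_val x)) = x :> DD n.
  by rewrite scalerA divff // scale1r to_disk_val.
have half1 (x : DD n) : set_val (to_disk (2^-1 *: set_val x)) = 2^-1 *: set_val x.
  by rewrite to_diskK // enormZ //; have := disk_norm_le1 x; lra.
have e_val x t : set_val (e (x, t)) =
    row_mx (2^-1 *: set_val x) ((set_val t - height (2^-1 *: set_val x))%:M).
  rewrite to_diskK_sumsq // row_mx_sumsq mxE eqxx mulr1n /=.
  have h2 := height_sq (to_disk (2^-1 *: set_val x)); rewrite half1 in h2.
  have h0 := height_ge0 (2^-1 *: set_val x).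
  have := set_valP x; rewrite /disk /= => x1; have ht := I01 t.
  move: h2; rewrite sumsqZ; set S := \sum_(i < n) _ in x1 *.
  by have : 0 <= S := sumsq_ge0 _; nra.
exists (isvt_comp h (gprod_repar A ce)); split=> [[a x]|[[a x] t]].
  have ex : e (x, i0) = sphere_incl (hemi true (to_disk (2^-1 *: set_val x))).
    apply: set_val_inj; rewrite e_val sphere_incl_val hemi_val half1 i0E.
    by congr (row_mx _ (_ %:M)); rewrite sub0r expr1 mulN1r.
  rewrite /= ex hs hu /= /dbl half1 half //.
rewrite ph.
have -> : isvt_comp V r (gprod_repar A ce ((a, x), t)) = V ((a, pf (e (x, t))), tf (e (x,
  t))).
  by [].
congr (V ((a, _), _)); first by rewrite /pf e_val row_mxKl.
by rewrite /tf e_val row_mxKl row_mxEr mxE eqxx mulr1n subrK to_I_val.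
Qed.

End Hemi.

(** * Mapping path spaces *)

Section MapPath.
Variables (R : realType) (G : finGroupType) (X Y : gspace G) (f : isvt_map X Y).
Local Notation II := (set_type (@unit_interval R)).
Local Notation i0 := (i0 R).
Local Notation i1 := (i1 R).

Definition mpath : Type :=
  {xg : X * (II -> Y) | [/\ continuous xg.2, f xg.1 = xg.2 i0 &
                            forall t, stab (xg.2 t) = stab xg.1]}.

(** The topology of N f is the finest one for which compact Hausdorff families of
    points and paths are continuous.  It is compactly generated by construction,
    and maps from a compactly generated space into N f are continuous as soon as
    their two components are. *)
Definition mpath_probe (K : topologicalType) (k : K -> mpath) :=
  [/\ compact [set: K], hausdorff_space K, continuous (fun m => (sval (k m)).1) &
      continuous (fun q : K * II => (sval (k q.1)).2 q.2)].

Definition mpath_open (U : set mpath) :=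
  forall (K : topologicalType) (k : K -> mpath), mpath_probe k -> open (k @^-1` U).

Local Lemma mpath_openT : mpath_open setT.
Proof. by move=> K k _; rewrite preimage_setT; exact: openT. Qed.

Local Lemma mpath_openI : setI_closed mpath_open.
Proof.
by move=> U V oU oV K k pk; rewrite preimage_setI; apply: openI;
  [exact: oU | exact: oV].
Qed.

Local Lemma mpath_open_bigU (I : Type) (F : I -> set mpath) :
  (forall i, mpath_open (F i)) -> mpath_open (\bigcup_i F i).
Proof.
move=> oF K k pk; rewrite preimage_bigcup; apply: bigcup_open => i _.
exact: oF.
Qed.

HB.instance Definition _ := gen_eqMixin mpath.
HB.instance Definition _ := gen_choiceMixin mpath.
HB.instance Definition _ :=
  isOpenTopological.Build mpath mpath_openT mpath_openI mpath_open_bigU.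

Lemma mpath_openE (U : set mpath) : open U = mpath_open U.
Proof. by []. Qed.

Lemma mpath_eq (n n' : mpath) :
  (sval n).1 = (sval n').1 -> (forall t, (sval n).2 t = (sval n').2 t) -> n = n'.
Proof.
case: n n' => [[x a] ha] [[x' a'] ha'] /= e /funext e'.
by subst x' a'; congr exist; exact: Prop_irrelevance.
Qed.

Lemma mpath_probe_continuous (K : topologicalType) (k : K -> mpath) :
  mpath_probe k -> continuous k.
Proof. by move=> pk; apply/continuousP => U; rewrite mpath_openE => /(_ K k pk). Qed.

Lemma mpath_cg : compactly_generated mpath.
Proof.
move=> U kU; rewrite mpath_openE => K k pk; have [cK hK _ _] := pk.
by apply: kU => //; exact: mpath_probe_continuous.
Qed.

Definition mpath_act_fun (g : G) (n : mpath) : X * (II -> Y) :=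
  (gsp_act g (sval n).1, fun t => gsp_act g ((sval n).2 t)).

Lemma stab_act (Z Z' : gspace G) (g : G) (z : Z) (z' : Z') :
  stab z = stab z' -> stab (gsp_act g z) = stab (gsp_act g z').
Proof.
have E (W : gspace G) (w : W) h :
    (h \in stab (gsp_act g w)) = ((g^-1 * h * g)%g \in stab w).
  rewrite !inE -[RHS](can_eq (@gsp_actK G W g)); congr (_ == _).
  by rewrite -!gsp_actM !mulgA mulgV mul1g.
by move=> e; apply/setP => h; rewrite !E e.
Qed.

Lemma mpath_act_subproof (g : G) (n : mpath) :
  [/\ continuous (mpath_act_fun g n).2,
      f (mpath_act_fun g n).1 = (mpath_act_fun g n).2 i0 &
      forall t, stab ((mpath_act_fun g n).2 t) = stab (mpath_act_fun g n).1].
Proof.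
case: n => [[x a] [/= ca fa sa]]; split=> /=.
- exact: (continuous_after ca (@gsp_act_cont G Y g)).
- by rewrite isvt_act fa.
- by move=> t; exact: stab_act.
Qed.

Definition mpath_act (g : G) (n : mpath) : mpath :=
  exist _ (mpath_act_fun g n) (mpath_act_subproof g n).

Local Lemma mpath_act1 n : mpath_act 1%g n = n.
Proof. by apply: mpath_eq => [|t] /=; rewrite gsp_act1. Qed.

Local Lemma mpath_actM g h n : mpath_act (g * h)%g n = mpath_act g (mpath_act h n).
Proof. by apply: mpath_eq => [|t] /=; rewrite gsp_actM. Qed.

Local Lemma mpath_act_continuous :
  continuous (fun p : discrete_topology G * mpath => mpath_act p.1 p.2).
Proof.
apply/gsp_act_continuousP => g; apply/continuousP => U; rewrite !mpath_openE.
move=> oU K k [cK hK c1 c2]; apply: (oU K (mpath_act g \o k)); split=> //=.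
  exact: (continuous_after c1 (@gsp_act_cont G X g)).
exact: (continuous_after c2 (@gsp_act_cont G Y g)).
Qed.

Definition mpath_space : gspace G :=
  GSpace mpath_act1 mpath_actM mpath_act_continuous mpath_cg.

Lemma mpath_stab (n : mpath_space) : stab n = stab (sval n).1.
Proof.
apply/setP => g; rewrite !inE; apply/eqP/eqP => [e|e].
  exact: (congr1 (fun m => (sval m).1) e).
case: n e => [[x a] [/= ca fa sa]] e; apply: mpath_eq => //= t.
have : g \in stab x by rewrite inE; apply/eqP.
by rewrite -(sa t) inE => /eqP.
Qed.

Lemma mpath_src_continuous : continuous (fun n : mpath_space => (sval n).1).
Proof.
apply/continuousP => U oU; rewrite mpath_openE => K k [cK hK c1 c2].
by have /continuousP := c1; exact.
Qed.

Definition mpath_src : isvt_map mpath_space X :=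
  @IsvtMap G mpath_space X (fun n => (sval n).1) mpath_src_continuous
    (fun _ _ => erefl) mpath_stab.

(** The topology of N f refines the compact-open one: by the tube lemma, paths
    mapping a compact set into an open set form an open set. *)
Lemma mpath_eval_continuous :
  continuous (fun q : gprod mpath_space II => (sval q.1).2 q.2).
Proof.
suff H : continuous (fun q : mpath_space * II => (sval q.1).2 q.2).
  apply: (continuous_after (f := id : gprod mpath_space II -> mpath_space * II) _ H).
  exact: (@kify_id_continuous (mpath_space * II)%type).
move=> [n t] V nV.
have [V' [[oV' V't] V'V]] : exists V', open_nbhs ((sval n).2 t) V' /\ V' `<=` V.
  by move: nV; rewrite nbhsE => -[V' oV' V'V]; exists V'.
have [ca _ _] := svalP n.
have [cI hI] := I_cpt_hausdorff R.
have nW : nbhs t ((sval n).2 @^-1` V') by apply: ca; exact: open_nbhs_nbhs.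
have [B nB BV] := @compact_regular II t setT hI cI filterT _ nW.
have cB : compact (closure B).
  by apply: (subclosed_compact (@closed_closure _ B) cI).
exists ([set m | forall s, closure B s -> V' ((sval m).2 s)], B) => /=.
  split=> //; apply: open_nbhs_nbhs; split; last by move=> s /BV.
  rewrite mpath_openE => K k [cK hK c1 c2].
  have := @tube K II _ ((fun q => (sval (k q.1)).2 q.2) @^-1` V') cB.
  by apply; move/continuousP: c2; exact.
move=> [m s] [/= Hm Bs]; apply: V'V; apply: Hm; exact: subset_closure.
Qed.

Lemma mpath_eval_stab (q : gprod mpath_space II) : stab q = stab ((sval q.1).2 q.2).
Proof.
rewrite gprod_stab mpath_stab; case: q => [[[x a] [/= ca fa sa]] t] /=.
by rewrite sa.
Qed.

Definition mpath_eval : isvt_map (gprod mpath_space II) Y :=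
  @IsvtMap G (gprod mpath_space II) Y _ mpath_eval_continuous
    (fun _ _ => erefl) mpath_eval_stab.

Lemma mpath_eval0 n : mpath_eval (n, i0) = f (mpath_src n).
Proof. by case: n => [[x a] [/= ca fa sa]] /=. Qed.

Section Pairing.
Variables (A : gspace G) (a : isvt_map A X) (h : isvt_map (gprod A II) Y).
Hypothesis ha : forall x, h (x, i0) = f (a x).

Lemma mpath_pair_subproof (x : A) :
  [/\ continuous (fun t : II => h (x, t)), f (a x) = h (x, i0) &
      forall t, stab (h (x, t)) = stab (a x)].
Proof.
split=> [|//|t]; last by rewrite -!isvt_stab gprod_stab.
apply: (continuous_after (U := gprod A II) _ (@isvt_continuous _ _ _ h)).
apply: (@gprod_probe G A II II (fun=> x) id); [exact: I_cpt_hausdorff| |exact: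
  continuous_idfun].
exact: cst_continuous.
Qed.

Definition mpath_pair_fun (x : A) : mpath_space :=
  exist _ (a x, fun t => h (x, t)) (mpath_pair_subproof x).

Local Lemma mpath_pair_continuous : continuous mpath_pair_fun.
Proof.
apply/continuousP => U; rewrite mpath_openE => oU.
apply: carrier_cg => K k cK hK ck.
apply: (oU K (mpath_pair_fun \o k)); split=> //=.
  exact: (continuous_after ck (@isvt_continuous _ _ _ a)).
apply: (continuous_after (U := gprod A II) (f := fun q => (k q.1, q.2)) _
  (@isvt_continuous _ _ _ h)).
apply: gprod_probe; last exact: continuous_snd_pair.
  by apply: cpt_hausdorff_prod; [split | exact: I_cpt_hausdorff].
exact: (continuous_after (@continuous_fst_pair _ _) ck).
Qed.

Local Lemma mpath_pair_act g x :
  mpath_pair_fun (gsp_act g x) = gsp_act g (mpath_pair_fun x).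
Proof.
apply: mpath_eq => [|t] /=; first exact: isvt_act.
exact: (isvt_act h g (x, t)).
Qed.

Local Lemma mpath_pair_stab x : stab x = stab (mpath_pair_fun x).
Proof. by rewrite mpath_stab /= -isvt_stab. Qed.

(** With [mpath_src] and [mpath_eval], the universal property of N f. *)
Definition mpath_pair : isvt_map A mpath_space :=
  IsvtMap mpath_pair_continuous mpath_pair_act mpath_pair_stab.

Lemma mpath_pair_src x : mpath_src (mpath_pair x) = a x.
Proof. by []. Qed.

Lemma mpath_pair_eval x t : mpath_eval (mpath_pair x, t) = h (x, t).
Proof. by []. Qed.
End Pairing.

Lemma mpath_ext (n n' : mpath_space) : mpath_src n = mpath_src n' ->
  (forall t, mpath_eval (n, t) = mpath_eval (n', t)) -> n = n'.
Proof. exact: mpath_eq. Qed.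

Definition gslice (A : gspace G) (K : topologicalType) (k : K) : isvt_map A (gprod A K) :=
  @gpair G A A K (isvt_id A) (fun=> k) (@cst_continuous _ _ _) (fun _ _ => erefl).

Definition mpath_tgt : isvt_map mpath_space Y :=
  isvt_comp mpath_eval (gslice mpath_space i1).

Definition mpath_const : isvt_map X mpath_space :=
  @mpath_pair X (isvt_id X) (isvt_comp f (gfst X II)) (fun _ => erefl).

End MapPath.

(** * Weak equivalences *)

Section Weq.
Variables (R : realType) (G : finGroupType).
Local Notation II := (set_type (@unit_interval R)).
Local Notation DD n := (set_type (disk R n)).
Local Notation SS n := (set_type (bsphere R n)).
Local Notation i0 := (i0 R).
Local Notation i1 := (i1 R).
Local Notation N f := (mpath_space R f).
Local Notation src f := (mpath_src R f).
Local Notation ev f := (mpath_eval R f).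
Local Notation tgt f := (mpath_tgt R f).
Implicit Types A B X Y Z E : gspace G.

Definition gtimes X Y (f : isvt_map X Y) (K : topologicalType) :
    isvt_map (gprod X K) (gprod Y K) :=
  @gpair G (gprod X K) Y K (isvt_comp f (gfst X K)) _ (@gsnd_continuous G X K)
    (fun _ _ => erefl).

Lemma i0M (t : R) : to_I (set_val i0 * t) = i0.
Proof. by rewrite i0E mul0r. Qed.

(** Append to the path of w the part of V up to time t, reparametrised so that at
    t = 0 nothing has changed: the path at time t is s |-> c (s (1 + t) / 2). *)
Lemma mpath_tgt_hurewicz X Y (f : isvt_map X Y) B (w : isvt_map B (N f))
    (V : isvt_map (gprod B II) Y) :
  (forall x, tgt f (w x) = V (x, i0)) ->
  exists L : isvt_map (gprod B II) (N f),
    (forall x, L (x, i0) = w x) /\ (forall y, tgt f (L y) = V y).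
Proof.
move=> wV; have [c [c1 c2]] := gprod_glue_cat (h := isvt_comp (ev f) (gtimes w II)) wV.
pose phi (q : II * II) : II := to_I (set_val q.2 * (1 + set_val q.1) / 2).
have cphi : continuous phi.
  apply: to_I_continuous; apply: cont_mul; last exact: cont_cst; apply: cont_mul.
    by apply: continuous_set_val; exact: continuous_snd_pair.
  by apply: cont_add; [exact: cont_cst | apply: continuous_set_val; exact:
    continuous_fst_pair].
have start y : isvt_comp c (gprod_repar B cphi) (y, i0) =
    f (isvt_comp (src f) (isvt_comp w (gfst B II)) y).
  case: y => b t; rewrite -[RHS](mpath_eval0 (w b)) -[RHS](c1 b i0).
  congr (c (_, _)).
  by rewrite /phi /= i0E !mul0r.
exists (mpath_pair start); split=> [x|[b t]].
  apply: mpath_ext => // s; rewrite mpath_pair_eval -[RHS](c1 x s).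
  congr (c (_, _)).
  by rewrite /phi /= i0E addr0 mulr1.
rewrite -[RHS]c2 /=; congr (c (_, _)).
by rewrite /phi /= i1E mul1r.
Qed.

(** The homotopy runs from i r to the identity, which is the direction in which
    it is concatenated with paths starting at k x. *)
Definition is_sdr X X' (i : isvt_map X X') :=
  exists (r : isvt_map X' X) (H : isvt_map (gprod X' II) X'),
    [/\ forall x, r (i x) = x, forall x, H (x, i0) = i (r x),
        forall x, H (x, i1) = x & forall x t, H (i x, t) = i x].

(** Shrink each path to its starting point. *)
Lemma mpath_const_sdr X Y (f : isvt_map X Y) : is_sdr (mpath_const R f).
Proof.
pose mu (q : II * II) : II := to_I (set_val q.2 * set_val q.1).
have cmu : continuous mu.
  by apply: to_I_continuous; apply: cont_mul; apply: continuous_set_val; [exact: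
    continuous_snd_pair | exact: continuous_fst_pair].
have start y : isvt_comp (ev f) (gprod_repar (N f) cmu) (y, i0) =
    f (isvt_comp (src f) (gfst (N f) II) y).
  by case: y => n t; rewrite -[RHS](mpath_eval0 n) /= /mu /= i0M.
exists (src f), (mpath_pair start); split=> // [n|n|x t].
- apply: mpath_ext => // s; rewrite mpath_pair_eval /=.
  by rewrite /mu /= i0E mulr0 -[RHS](mpath_eval0 n).
- apply: mpath_ext => // s; rewrite mpath_pair_eval /=.
  by rewrite /mu /= i1E mulr1 to_I_val.
by apply: mpath_ext => // s; rewrite mpath_pair_eval.
Qed.

Section FixedA.
Variable A : gspace G.
Local Notation fib := (serre_fib R A).
Local Notation afib := (serre_afib R A).

(** This says that f induces a weak homotopy equivalence on spaces of isovariant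
    maps out of A; going through N f turns 2-out-of-3 into a statement on acyclic
    fibrations. *)
Definition serre_weq X Y (f : isvt_map X Y) := afib (tgt f).

Lemma mpath_tgt_fib X Y (f : isvt_map X Y) : fib (tgt f).
Proof. by move=> n w V; exact: mpath_tgt_hurewicz. Qed.

Lemma afib_comp X Y Z (g : isvt_map Y Z) (f : isvt_map X Y) :
  afib g -> afib f -> afib (isvt_comp g f).
Proof.
move=> ag af n u v uv; have [h [hu gh]] := ag n (isvt_comp f u) v uv.
have [a s|k [ku fk]] := af n u h; first by rewrite hu.
by exists k; split=> // y; rewrite /= fk gh.
Qed.

Lemma fib_comp X Y Z (g : isvt_map Y Z) (f : isvt_map X Y) :
  fib g -> fib f -> fib (isvt_comp g f).
Proof.
move=> ag af n u v uv; have [h [hu gh]] := ag n (isvt_comp f u) v uv.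
have [x|k [ku fk]] := af n u h; first by rewrite hu.
by exists k; split=> // y; rewrite /= fk gh.
Qed.

(** The products A x S^(n-1) are cofibrant, so the boundary condition can be moved
    up to X. *)
Lemma afib_cancel X Y Z (g : isvt_map Y Z) (f : isvt_map X Y) :
  afib f -> afib (isvt_comp g f) -> afib g.
Proof.
move=> af agf n u v uv; have [u' fu'] := afib_lift_sphere u af.
have [a s|h [hu gh]] := agf n u' v; first by rewrite /= fu'.
by exists (isvt_comp f h); split=> [a s|y]; [rewrite /= hu fu' | exact: gh].
Qed.

(** A lift w for g f need not cover v, but f w and v agree after g; the fibrewise
    homotopy between them lifts along the fibration f, starting at w. *)
Lemma afib_cancel_fib X Y Z (g : isvt_map Y Z) (f : isvt_map X Y) :
  fib f -> afib g -> afib (isvt_comp g f) -> afib f.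
Proof.
move=> ff ag agf n u v uv.
have [a s|w [wu gw]] := agf n u (isvt_comp g v); first by rewrite /= uv.
have [x|a s|K [K0 K1 Ks _]] := afib_fibre_homotopy (f1 := isvt_comp f w) (f2 := v) ag.
- exact: gw.
- by rewrite /= wu uv.
pose k : isvt_map (gprod (gprod A (SS n)) II) X := isvt_comp u (gfst _ _).
have [a s|x|a s t|L [L0 Ls fL]] := @relative_lifting R G A n X Y f w k K ff.
- exact: wu.
- by rewrite K0.
- by rewrite Ks /= wu.
exists (isvt_comp L (gslice _ i1)); split=> [a s|x] /=; first by rewrite Ls.
by rewrite fL K1.
Qed.

(** Solve the problem in E', transport the solution to E, and correct it along
    the fibrewise homotopy K on the boundary. *)
Lemma afib_of_fibre_homotopy E E' Z (p : isvt_map E Z) (p' : isvt_map E' Z)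
    (q : isvt_map E E') (e : isvt_map E' E) (K : isvt_map (gprod E II) E) :
  fib p -> afib p' ->
  (forall x, p' (q x) = p x) -> (forall x, p (e x) = p' x) ->
  (forall x, K (x, i0) = e (q x)) -> (forall x, K (x, i1) = x) ->
  (forall x t, p (K (x, t)) = p x) -> afib p.
Proof.
move=> fp ap' qp ep K0 K1 Kp n u v uv.
have [a s|w [wu pw]] := ap' n (isvt_comp q u) v; first by rewrite /= qp uv.
have [a s|x|a s t|L [L0 Ls pL]] := @relative_lifting R G A n E Z p (isvt_comp e w)
    (isvt_comp K (gtimes u II)) (isvt_comp v (gfst _ _)) fp.
- by rewrite /= wu K0.
- by rewrite /= ep pw.
- by rewrite /= Kp uv.
exists (isvt_comp L (gslice _ i1)); split=> [a s|x] /=; last exact: pL.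
by rewrite Ls /= K1.
Qed.

Section Sdr.
Variables (X X' Z : gspace G) (k : isvt_map X' Z) (i : isvt_map X X').
Let ki := isvt_comp k i.
Variables (r : isvt_map X' X) (H : isvt_map (gprod X' II) X').
Hypotheses (ri : forall x, r (i x) = x) (H0 : forall x, H (x, i0) = i (r x)).
Hypotheses (H1 : forall x, H (x, i1) = x) (Hi : forall x t, H (i x, t) = i x).

(** N (k i) and N k are fibrewise homotopy equivalent over Z.  In one direction
    precompose with i; in the other prepend to a path from k x the path k H from
    k i r x to k x.  Both homotopies drop the prepended path gradually: if c is the
    concatenation, then Sg at time t is s |-> c ((t + s (2 - t)) / 2), which runs
    over the part of c from t / 2 to 1 and is the original path at t = 1. *)
Lemma mpath_sdr_maps :
  exists (e : isvt_map (N ki) (N k)) (q : isvt_map (N k) (N ki))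
         (K : isvt_map (gprod (N k) II) (N k))
         (K' : isvt_map (gprod (N ki) II) (N ki)),
    [/\ forall x, tgt k (e x) = tgt ki x, forall x, tgt ki (q x) = tgt k x,
      [/\ forall x, K (x, i0) = e (q x), forall x, K (x, i1) = x &
        forall x t, tgt k (K (x, t)) = tgt k x] &
      [/\ forall x, K' (x, i0) = q (e x), forall x, K' (x, i1) = x &
        forall x t, tgt ki (K' (x, t)) = tgt ki x]].
Proof.
have he x : ev ki (x, i0) = k (isvt_comp i (src ki) x) by exact: mpath_eval0.
pose e := mpath_pair he.
have [|c [c1 c2]] := gprod_glue_cat (A := N k) (v := ev k)
    (h := isvt_comp (isvt_comp k H) (gtimes (src k) II)).
  by move=> n; rewrite mpath_eval0 /= H1.
pose phi (q : II * II) : II := to_I ((set_val q.1 + set_val q.2 * (2 - set_val q.1)) / 2).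
have cphi : continuous phi.
  have cx : continuous (fun q : II * II => set_val q.1) by apply: continuous_set_val;
    exact: continuous_fst_pair.
  have cy : continuous (fun q : II * II => set_val q.2) by apply: continuous_set_val;
    exact: continuous_snd_pair.
  apply: to_I_continuous; apply: cont_mul; last exact: cont_cst; apply: cont_add => //;
    apply: cont_mul => //.
  by apply: cont_sub => //; exact: cont_cst.
pose Sg := isvt_comp c (gprod_repar (N k) cphi).
have SgE n t s : Sg ((n, t), s) = c (n, phi (t, s)) by [].
have Sg0 n t : Sg ((n, t), i0) = k (H (src k n, t)).
  rewrite SgE -[RHS](c1 n t); congr (c (_, _)).
  by rewrite /phi /= i0E mul0r addr0.
have Sg1 n t : Sg ((n, t), i1) = tgt k n.
  rewrite SgE -[RHS](c2 n i1); congr (c (_, _)).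
  by rewrite /phi /= i1E mul1r addrC subrK.
have Sgt n s : Sg ((n, i1), s) = ev k (n, s).
  rewrite SgE -[RHS](c2 n s); congr (c (_, _)).
  by rewrite /phi /= i1E; congr to_I; lra.
pose Sq : isvt_map (gprod (N k) II) Z := isvt_comp Sg (gtimes (gslice _ i0) II).
have hq n : Sq (n, i0) = ki (isvt_comp r (src k) n).
  by rewrite [LHS](Sg0 n i0) H0.
pose q := mpath_pair hq.
have hK y : Sg (y, i0) = k (isvt_comp H (gtimes (src k) II) y).
  by case: y => n t; rewrite Sg0.
pose K := mpath_pair hK.
pose SK' : isvt_map (gprod (gprod (N ki) II) II) Z :=
  isvt_comp Sg (gtimes (gtimes e II) II).
have hK' y : SK' (y, i0) = ki (isvt_comp (src ki) (gfst _ _) y).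
  by case: y => n t; rewrite [LHS](Sg0 (e n) t) [H _](Hi (src ki n) t).
pose K' := mpath_pair hK'.
exists e, q, K, K'; split.
- by [].
- by move=> n; rewrite -(Sg1 n i0).
- split=> [n|n|n t].
  + by apply: mpath_ext => [|s]; rewrite /= ?H0.
  + by apply: mpath_ext => [|s]; [rewrite /= H1 | exact: Sgt].
  + exact: Sg1.
split=> [n|n|n t].
- by apply: mpath_ext => [|s]; rewrite /= ?ri.
- by apply: mpath_ext => // s; exact: Sgt.
- exact: Sg1.
Qed.

End Sdr.

Lemma weq_sdr X X' Z (k : isvt_map X' Z) (i : isvt_map X X') :
  is_sdr i -> serre_weq (isvt_comp k i) <-> serre_weq k.
Proof.
move=> [r [H [ri H0 H1 Hi]]].
have [e [q [K [K' [ek qk [K0 K1 Kk] [K0' K1' Kk']]]]]] := mpath_sdr_maps k ri H0 H1 Hi.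
split=> w.
  exact: (@afib_of_fibre_homotopy _ _ _ _ _ q e K (@mpath_tgt_fib _ _ k) w qk ek K0 K1 Kk).
exact: (@afib_of_fibre_homotopy _ _ _ _ _ e q K' (@mpath_tgt_fib _ _ _) w ek qk K0' K1'
  Kk').
Qed.

Section Pullback.
Variables (X Y Z : gspace G) (g : isvt_map Y Z) (p : isvt_map X Y).

Lemma mpath_pull_start n : ev (isvt_comp g p) (n, i0) =
  g (isvt_comp p (src (isvt_comp g p)) n).
Proof. exact: mpath_eval0. Qed.

Definition mpath_pull : isvt_map (N (isvt_comp g p)) (N g) := mpath_pair mpath_pull_start.

Lemma mpath_tgt_pull : isvt_comp (tgt g) mpath_pull = tgt (isvt_comp g p).
Proof. exact: isvt_mapP. Qed.

(** N (g p) is the pullback of p along N g -> Y. *)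
Lemma mpath_pull_univ B (h : isvt_map B X) (v : isvt_map B (N g)) :
  (forall x, p (h x) = src g (v x)) ->
  exists w : isvt_map B (N (isvt_comp g p)),
    [/\ forall x, src _ (w x) = h x, forall x, mpath_pull (w x) = v x &
      forall x (n : N (isvt_comp g p)), src _ n = h x -> mpath_pull n = v x -> n = w x].
Proof.
move=> hv; have st x : isvt_comp (ev g) (gtimes v II) (x, i0) = isvt_comp g p (h x).
  by rewrite /= hv; exact: (mpath_eval0 (v x)).
exists (mpath_pair st); split=> // [x|x n e1 e2].
  by apply: mpath_ext => // ; rewrite /= hv.
by apply: mpath_ext => // s; rewrite mpath_pair_eval /= -e2.
Qed.

Lemma mpath_pull_afib : afib p -> afib mpath_pull.
Proof.
move=> ap n u v uv.
have [a s|h [hu ph]] := ap n (isvt_comp (src _) u) (isvt_comp (src _) v).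
  by rewrite /= -uv.
have [w [w1 w2 w3]] := mpath_pull_univ ph.
exists w; split=> // a s; apply/esym/w3; last exact: uv.
by rewrite hu.
Qed.

Lemma mpath_pull_fib : fib p -> fib mpath_pull.
Proof.
move=> fp n u v uv.
have [x|h [hu ph]] := fp n (isvt_comp (src _) u) (isvt_comp (src _) v).
  by rewrite /= -uv.
have [w [w1 w2 w3]] := mpath_pull_univ ph.
exists w; split=> // x; apply/esym/w3; last exact: uv.
by rewrite hu.
Qed.

(** Constant paths embed Y in N g, and p is the restriction of [mpath_pull]. *)
Lemma afib_of_mpath_pull : afib mpath_pull -> afib p.
Proof.
move=> ap n u v uv.
have [a s|h [hu ph]] := ap n (isvt_comp (mpath_const R _) u)
    (isvt_comp (mpath_const R _) v).
  by apply: mpath_ext => [|t] /=; rewrite uv.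
exists (isvt_comp (src _) h); split=> [a s|x]; first by rewrite /= hu.
exact: (congr1 (fun m => src g m) (ph x)).
Qed.

End Pullback.

Lemma weq_comp X Y Z (g : isvt_map Y Z) (f : isvt_map X Y) :
  serre_weq f -> serre_weq g -> serre_weq (isvt_comp g f).
Proof.
move=> wf wg.
have -> : isvt_comp g f = isvt_comp (isvt_comp g (tgt f)) (mpath_const R f).
  exact: isvt_mapP.
apply/(weq_sdr _ (mpath_const_sdr f)).
by rewrite /serre_weq -mpath_tgt_pull; apply: afib_comp => //; exact: mpath_pull_afib.
Qed.

Lemma weq_cancelr X Y Z (g : isvt_map Y Z) (f : isvt_map X Y) :
  serre_weq f -> serre_weq (isvt_comp g f) -> serre_weq g.
Proof.
move=> wf.
have -> : isvt_comp g f = isvt_comp (isvt_comp g (tgt f)) (mpath_const R f).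
  exact: isvt_mapP.
move/(weq_sdr _ (mpath_const_sdr f)).
rewrite /serre_weq -mpath_tgt_pull; apply: afib_cancel.
exact: mpath_pull_afib.
Qed.

Lemma weq_cancell X Y Z (g : isvt_map Y Z) (f : isvt_map X Y) :
  serre_weq g -> serre_weq (isvt_comp g f) -> serre_weq f.
Proof.
move=> wg.
have -> : isvt_comp g f = isvt_comp (isvt_comp g (tgt f)) (mpath_const R f).
  exact: isvt_mapP.
move/(weq_sdr _ (mpath_const_sdr f)).
rewrite /serre_weq -mpath_tgt_pull => w; apply: (@afib_of_mpath_pull _ _ _ g).
apply: (afib_cancel_fib _ wg w); apply: mpath_pull_fib; exact: mpath_tgt_fib.
Qed.

(** Given a homotopy on the boundary from p u to v, extend it backwards from v
    over the disk and lift its starting point. *)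
Lemma weq_of_afib X Y (p : isvt_map X Y) : afib p -> serre_weq p.
Proof.
move=> ap n u v uv.
pose rev (t : II) : II := to_I (1 - set_val t).
have crev : continuous rev.
  by apply: to_I_continuous; apply: cont_sub; [exact: cont_cst | exact: set_val_continuous].
have revK t : rev (rev t) = t.
  apply: set_val_inj; have ht := I01 t; rewrite /rev !to_IK; lra.
have rev0 : rev i0 = i1 by rewrite /rev i0E subr0.
have rev1 : rev i1 = i0 by rewrite /rev i1E subrr.
pose k := isvt_comp (isvt_comp (ev p) (gtimes u II)) (gprod_map (gprod A (SS n)) crev).
have [a s|L [L0 Ls]] := homotopy_extension (w := v) (k := k).
  by rewrite -uv /= rev0.
pose L' := isvt_comp L (gprod_map (gprod A (DD n)) crev).
have [a s|h [hu ph]] := ap n (isvt_comp (src p) u) (isvt_comp L' (gslice _ i0)).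
  by rewrite /= rev0 Ls /= rev1 [RHS](mpath_eval0 (u (a, s))).
have st x : L' (x, i0) = p (h x) by rewrite ph.
exists (mpath_pair st); split=> [a s|x].
  apply: mpath_ext => [|t]; first by rewrite /= hu.
  by rewrite mpath_pair_eval /= Ls /= revK.
by rewrite /= rev1 L0.
Qed.

(** A solution up to a homotopy relative to the boundary is corrected by lifting
    that homotopy. *)
Lemma afib_of_weq X Y (p : isvt_map X Y) : fib p -> serre_weq p -> afib p.
Proof.
move=> fp wp n u v uv.
have [a s|h [hu ph]] := wp n (isvt_comp (mpath_const R p) u) v; first exact: uv.
have [a s|x|a s t|L [L0 Ls pL]] := @relative_lifting R G A n X Y p
  (isvt_comp (src p) h) (isvt_comp u (gfst _ _)) (isvt_comp (ev p) (gtimes h II)) fp.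
- by rewrite /= hu.
- by rewrite -[LHS](mpath_eval0 (h x)).
- by rewrite /= hu.
exists (isvt_comp L (gslice _ i1)); split=> [a s|x] /=; first by rewrite Ls.
by rewrite pL -ph.
Qed.

Lemma mpath_gap_start X Y (p : isvt_map X Y) n :
  isvt_comp p (ev (isvt_id X)) (n, i0) = p (src (isvt_id X) n).
Proof. by rewrite -[RHS](congr1 p (mpath_eval0 n)). Qed.

(** Sends a path in X to its starting point and its image under p.  Lifting
    against this map amounts to lifting homotopies along p. *)
Definition mpath_gap X Y (p : isvt_map X Y) : isvt_map (N (isvt_id X)) (N p) :=
  mpath_pair (mpath_gap_start p).

Lemma mpath_gap_afib X Y (p : isvt_map X Y) : fib p -> afib (mpath_gap p).
Proof.
move=> fp n u v uv.
have uv1 a s : src _ (u (a, s)) = src _ (v (a, sphere_incl s)).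
  exact: (congr1 (src _) (uv a s)).
have [a s|x|a s t|L [L0 Ls pL]] := @relative_lifting R G A n X Y p
    (isvt_comp (src _) v) (isvt_comp (ev _) (gtimes u II))
    (isvt_comp (ev _) (gtimes v II)) fp.
- exact: (etrans (esym (uv1 a s)) (esym (mpath_eval0 (u (a, s))))).
- by rewrite -[LHS](mpath_eval0 (v x)).
- exact: (congr1 (fun m => ev p (m, t)) (uv a s)).
exists (mpath_pair (f := isvt_id X) (a := isvt_comp (src _) v) L0); split=> [a s|x].
  by apply: mpath_ext => [|t]; [exact: esym (uv1 a s) | exact: Ls].
by apply: mpath_ext => // t; exact: pL.
Qed.

End FixedA.
End Weq.

(** * Attaching cells and colimits of closed embeddings *)

Lemma existT_inj (I : Type) (P : I -> Type) (i : I) (x y : P i) :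
  existT P i x = existT P i y -> x = y.
Proof.
by move=> e; have := projT2_eq e; rewrite (Prop_irrelevance (projT1_eq e) erefl).
Qed.

(** A G-space glued from G-spaces S i: the identifications are given by a code,
    equal codes meaning equal points, and a set is open if all its preimages are.
    Pushouts and sequential colimits are instances. *)
Section FinalSpace.
Variables (G : finGroupType) (I T : Type) (S : I -> gspace G) (code : forall i, S i -> T).

Definition final_space : Type := {t : T | exists i x, @code i x = t}.

Definition final_class (i : I) (x : S i) : final_space :=
  exist _ (code x) (ex_intro _ i (ex_intro _ x erefl)).

Lemma final_classP (i j : I) (x : S i) (y : S j) :
  final_class x = final_class y <-> code x = code y.
Proof.
split=> [/(congr1 sval) //|e].
by rewrite /final_class; apply: eq_exist.
Qed.

Lemma final_class_surj (q : final_space) : exists i (x : S i), final_class x = q.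
Proof.
by case: q => t [i [x e]]; exists i, x; apply: eq_exist.
Qed.

Definition final_open (U : set final_space) := forall i, open (@final_class i @^-1` U).

Local Lemma final_openT : final_open setT.
Proof. by move=> i; rewrite preimage_setT; exact: openT. Qed.

Local Lemma final_openI : setI_closed final_open.
Proof. by move=> U V oU oV i; rewrite preimage_setI; apply: openI. Qed.

Local Lemma final_open_bigU (J : Type) (F : J -> set final_space) :
  (forall i, final_open (F i)) -> final_open (\bigcup_i F i).
Proof.
by move=> oF i; rewrite preimage_bigcup; apply: bigcup_open => j _; exact: oF.
Qed.

HB.instance Definition _ := gen_eqMixin final_space.
HB.instance Definition _ := gen_choiceMixin final_space.
HB.instance Definition _ :=
  isOpenTopological.Build final_space final_openT final_openI final_open_bigU.

Lemma final_openE (U : set final_space) : open U = final_open U.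
Proof. by []. Qed.

Lemma final_closedP (C : set final_space) :
  (forall i, closed (@final_class i @^-1` C)) -> closed C.
Proof.
by move=> h; rewrite -openC final_openE => i; rewrite preimage_setC openC; exact: h.
Qed.

Lemma final_class_continuous i : continuous (@final_class i).
Proof. by apply/continuousP => U; rewrite final_openE. Qed.

Lemma final_continuous (U : topologicalType) (f : final_space -> U) :
  (forall i, continuous (f \o @final_class i)) -> continuous f.
Proof.
move=> cf; apply/continuousP => V oV; rewrite final_openE => i.
by have /continuousP := cf i; exact.
Qed.

Lemma final_cg : compactly_generated final_space.
Proof.
move=> U kU; rewrite final_openE => i; apply: carrier_cg => K k cK hK ck.
apply: (kU K (@final_class i \o k)) => //.
exact: (continuous_after ck (@final_class_continuous i)).
Qed.

Hypothesis code_act : forall i j (x : S i) (y : S j) g,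
  code x = code y -> code (gsp_act g x) = code (gsp_act g y).
Hypothesis code_stab : forall i (x : S i) g, code (gsp_act g x) = code x -> gsp_act g x = x.

Definition final_act (g : G) (q : final_space) : final_space :=
  let s := cid (final_class_surj q) in final_class (gsp_act g (sval (cid (svalP s)))).

Lemma final_actE g i (x : S i) : final_act g (final_class x) = final_class (gsp_act g x).
Proof.
rewrite /final_act; apply/final_classP; apply: code_act; apply/final_classP.
exact: (svalP (cid (svalP (cid (final_class_surj (final_class x)))))).
Qed.

Local Lemma final_act1 q : final_act 1%g q = q.
Proof. by have [i [x <-]] := final_class_surj q; rewrite final_actE gsp_act1. Qed.

Local Lemma final_actM g h q : final_act (g * h)%g q = final_act g (final_act h q).
Proof. by have [i [x <-]] := final_class_surj q; rewrite !final_actE gsp_actM. Qed.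

Local Lemma final_act_continuous :
  continuous (fun p : discrete_topology G * final_space => final_act p.1 p.2).
Proof.
apply/gsp_act_continuousP => g; apply: final_continuous => i.
rewrite (_ : _ \o _ = @final_class i \o gsp_act g); last first.
  by apply: funext => x /=; rewrite final_actE.
exact: (continuous_after (@gsp_act_cont _ _ g) (@final_class_continuous i)).
Qed.

Definition final_gspace : gspace G :=
  GSpace final_act1 final_actM final_act_continuous final_cg.

Lemma final_class_stab i (x : S i) : stab x = stab (final_class x : final_gspace).
Proof.
apply/setP => g; rewrite !inE; apply/eqP/eqP => [e|]; rewrite /= final_actE; first by
  rewrite e.
by move/final_classP/code_stab.
Qed.

Definition final_in (i : I) : isvt_map (S i) final_gspace :=
  @IsvtMap G (S i) final_gspace (@final_class i) (@final_class_continuous i)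
    (fun g x => esym (final_actE g x)) (@final_class_stab i).

Lemma final_univ (W : gspace G) (h : forall i, isvt_map (S i) W) :
  (forall i j (x : S i) (y : S j), code x = code y -> h i x = h j y) ->
  exists w : isvt_map final_gspace W, forall i x, w (final_in i x) = h i x.
Proof.
move=> hc.
have /choice[w hw] : forall q : final_space, exists z : W,
    forall i (x : S i), final_class x = q -> h i x = z.
  move=> q; have [i [x <-]] := final_class_surj q.
  by exists (h i x) => j y /final_classP/hc.
have wE i x : w (final_class x) = h i x by apply/esym/hw.
have cw : continuous (w : final_gspace -> W).
  apply: final_continuous => i.
  rewrite (_ : _ \o _ = h i); first exact: isvt_continuous.
  by apply: funext => x; exact: wE.
have aw g (q : final_gspace) : w (gsp_act g q) = gsp_act g (w q).
  by have [i [x <-]] := final_class_surj q; rewrite /= final_actE !wE isvt_act.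
have sw (q : final_gspace) : stab q = stab (w q).
  by have [i [x <-]] := final_class_surj q; rewrite wE -isvt_stab -final_class_stab.
by exists (IsvtMap cw aw sw) => i x; exact: wE.
Qed.

End FinalSpace.

Section Attach.
Variables (G : finGroupType) (X : gspace G) (L : Type) (A B : L -> gspace G).
Variables (i : forall l, isvt_map (A l) (B l)) (u : forall l, isvt_map (A l) X).
Hypothesis ci : forall l, closed_emb (i l).

Let S (o : option L) : gspace G := if o is Some l then B l else X.

(* None is the space X to which the cells are attached; a point of a cell has a
   code in X if it lies on the attaching part. *)
Let code (o : option L) : S o -> X + {l : L & B l} :=
  match o return S o -> X + {l : L & B l} with
  | None => fun x => inl x
  | Some l => fun b =>
      if pselect (exists a, i l a = b) is left e then inl (u l (sval (cid e)))
      else inr (existT B l b)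
  end.

Let codeI l (a : A l) : code (o := Some l) (i l a) = inl (u l a).
Proof.
rewrite /code; case: pselect => [e|]; last by case; exists a.
by congr (inl (u l _)); apply: (ci l).1; exact: (svalP (cid e)).
Qed.

Let codeE l (b : B l) : ~ (exists a, i l a = b) ->
  code (o := Some l) b = inr (existT B l b).
Proof. by rewrite /code; case: pselect. Qed.

Let code_case o (x : S o) :
  (exists y : X, code x = inl y /\ forall g, code (gsp_act g x) = inl (gsp_act g y)
     /\ (gsp_act g y = y -> gsp_act g x = x)) \/
  (exists l (b : B l), code x = inr (existT B l b) /\
     forall g, code (gsp_act g x) = inr (existT B l (gsp_act g b))
     /\ (gsp_act g b = b -> gsp_act g x = x)).
Proof.
case: o x => [l|] x; last by left; exists x.
have [[a <-]|nx] := pselect (exists a, i l a = x).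
  left; exists (u l a); split=> [|g]; first exact: codeI.
  split=> [|e]; first by rewrite -isvt_act -[RHS]codeI isvt_act.
  rewrite /S -isvt_act; congr (i l _).
  have : g \in stab a by rewrite (isvt_stab (u l)) inE e.
  by rewrite inE => /eqP.
right; exists l, x; split=> [|g]; first exact: codeE.
split=> [|//]; apply: codeE => -[a e]; apply: nx; exists (gsp_act g^-1%g a).
by rewrite isvt_act e gsp_actK.
Qed.

Let code_act o o' (x : S o) (y : S o') g :
  code x = code y -> code (gsp_act g x) = code (gsp_act g y).
Proof.
have [[z [-> hz]]|[l [b [-> hb]]]] := code_case x;
have [[z' [-> hz']]|[l' [b' [-> hb']]]] := code_case y => //.
  by move=> [e]; rewrite (hz g).1 (hz' g).1 e.
by move=> [e]; subst l' => /(@existT_inj L (fun l => B l) l) eb; subst b'; rewrite (hb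
  g).1 (hb' g).1.
Qed.

Let code_stab o (x : S o) g : code (gsp_act g x) = code x -> gsp_act g x = x.
Proof.
have [[z [-> hz]]|[l [b [-> hb]]]] := code_case x.
  by have [-> h] := hz g => -[/h].
by have [-> h] := hb g => -[/(@existT_inj L (fun l => B l) l)/h].
Qed.

Let P := final_gspace code_act.
Let j : isvt_map X P := final_in code_act code_stab None.
Let gl l : isvt_map (B l) P := final_in code_act code_stab (Some l).

(** The last clause provides the closed sets that separate new points from X in
    the compactness argument. *)
Lemma attach_exists : exists (P : gspace G) (j : isvt_map X P)
    (gl : forall l, isvt_map (B l) P),
  [/\ forall l a, gl l (i l a) = j (u l a),
      forall (W : gspace G) (h : isvt_map X W) (k : forall l, isvt_map (B l) W),
        (forall l a, k l (i l a) = h (u l a)) ->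
        exists w : isvt_map P W,
          (forall x, w (j x) = h x) /\ (forall l b, w (gl l b) = k l b),
      forall z, (exists x, j x = z) \/
        (exists l b, ~ (exists a, i l a = b) /\ gl l b = z),
      closed_emb j &
      forall l (C : set (B l)), closed C -> (forall a, ~ C (i l a)) ->
        closed (gl l @` C) /\ (forall x b, C b -> gl l b <> j x)].
Proof.
have jI : injective j by move=> x y /final_classP [].
have gj l (b : B l) x : gl l b = j x <-> exists2 a, i l a = b & u l a = x.
  split=> [/final_classP|[a <- <-]]; last by apply/final_classP; exact: codeI.
  have [[a <-]|nb] := pselect (exists a, i l a = b); last by rewrite codeE.
  by rewrite codeI => -[e]; exists a.
exists P, j, gl; split.
- by move=> l a; apply/gj; exists a.
- move=> W h k kh.
  pose hk (o : option L) : isvt_map (S o) W :=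
    match o return isvt_map (S o) W with Some l => k l | None => h end.
  have [|w hw] := final_univ code_act code_stab (h := hk).
    have H o (x : S o) : (exists2 y, code x = inl y & hk o x = h y) \/
       (exists l b, code x = inr (existT B l b) /\ hk o x = k l b).
      case: o x => [l|] x; last by left; exists x.
      have [[a <-]|nx] := pselect (exists a, i l a = x).
        by left; exists (u l a); [exact: codeI | exact: kh].
      by right; exists l, x; split=> //; exact: codeE.
    move=> o o' x y; have [[z -> ->]|[l [b [-> ->]]]] := H o x;
      have [[z' -> ->]|[l' [b' [-> ->]]]] := H o' y => //.
      by move=> [->].
    by move=> [e]; subst l' => /(@existT_inj L (fun l => B l) l) eb; subst b'.
  by exists w; split=> [x|l b]; [exact: (hw None) | exact: (hw (Some l))].
- move=> z; have [[l|] [x <-]] := final_class_surj z; last by left; exists x.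
  have [[a <-]|nx] := pselect (exists a, i l a = x).
    by left; exists (u l a); apply/esym/gj; exists a.
  by right; exists l, x.
- split=> // C cC; apply: final_closedP => -[l|] /=; last first.
    rewrite (_ : _ @^-1` _ = C) //; apply/seteqP; split=> [x [y Cy /jI <-] //|x Cx].
    by exists x.
  rewrite (_ : _ @^-1` _ = i l @` (u l @^-1` C)).
    apply: (ci l).2; have /continuous_closedP := @isvt_continuous _ _ _ (u l); exact.
  apply/seteqP; split=> [b [y Cy /esym/gj[a <- e]]|_ [a Ca <-]].
    by exists a => //; rewrite /preimage /= e.
  by exists (u l a) => //; apply/esym/gj; exists a.
move=> l C cC nC; split=> [|x b Cb /gj[a e _]]; last by apply: (nC a); rewrite e.
apply: final_closedP => -[l'|] /=; last first.
  rewrite (_ : _ @^-1` _ = set0); first exact: closed0.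
  by apply/seteqP; split=> // x [b Cb /gj[a e _]]; apply: (nC a); rewrite e.
have glE (b : B l) (b' : B l') : C b -> gl l b = gl l' b' -> existT B l b = existT B l' b'.
  move=> Cb /final_classP; rewrite codeE; last by move=> [a e]; apply: (nC a); rewrite e.
  have [[a <-]|nb] := pselect (exists a, i l' a = b'); first by rewrite codeI.
  by rewrite codeE // => -[].
have [e|ne] := pselect (l = l'); last first.
  rewrite (_ : _ @^-1` _ = set0); first exact: closed0.
  by apply/seteqP; split=> // b' [b Cb /(glE _ _ Cb) [/ne]].
subst l'; rewrite (_ : _ @^-1` _ = C) //.
apply/seteqP; split=> [b' [b Cb /(glE _ _ Cb)/(@existT_inj L (fun l => B l) l) eb]|b Cb];
  last by exists b.
by rewrite -eb.
Qed.

End Attach.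

Section Colim.
Variables (G : finGroupType) (L : wo_type) (S : Defs.sequence (isvtTop G) L) (D : set L).

Definition smap_fun i j (ij : (i <= j)%O) : isvt_map (S i) (S j) := smap S ij.

Hypothesis cS : forall i j (Di : D i) (Dj : D j) (ij : (i <= j)%O), closed_emb (smap_fun
  ij).

Lemma smap_funD i j k (ij : (i <= j)%O) (jk : (j <= k)%O) (ik : (i <= k)%O) x :
  smap_fun jk (smap_fun ij x) = smap_fun ik x.
Proof. exact: (congr1 (fun f : isvt_map (S i) (S k) => f x) (smapD S ij jk ik)). Qed.

Lemma smap_fun1 i (h : (i <= i)%O) x : smap_fun h x = x.
Proof. exact: (congr1 (fun f : isvt_map (S i) (S i) => f x) (smap1 S h)). Qed.

Let F (o : {i : L | D i}) : gspace G := S (sval o).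

(* The code of x is its equivalence class: all points that become equal to it
   further along. *)
Let germ (o : {i : L | D i}) (x : F o) : set {o : {i : L | D i} & F o} :=
  [set s | exists k (h : (sval o <= k)%O) (h' : (sval (projT1 s) <= k)%O),
     D k /\ smap_fun h x = smap_fun h' (projT2 s)].

Let germP o o' (x : F o) (y : F o') : germ x = germ y <->
  exists k (h : (sval o <= k)%O) (h' : (sval o' <= k)%O),
     D k /\ smap_fun h x = smap_fun h' y.
Proof.
split=> [e|[k [h [h' [Dk e]]]]].
  have : germ y (existT F o' y).
    by exists (sval o'), (lexx _), (lexx _); split=> //; exact: (svalP o').
  by rewrite -e.
apply/seteqP; split => -[d2 z] [m [h1 [h2 [Dm /= e1]]]].
  have [km|/ltW mk] := leP k m.
    exists m, (le_trans h' km), h2; split=> //=; rewrite -e1.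
    by rewrite -(smap_funD h km h1) e (smap_funD h' km (le_trans h' km)).
  exists k, h', (le_trans h2 mk); split=> //=; rewrite -e.
  by rewrite -(smap_funD h1 mk h) e1 (smap_funD h2 mk (le_trans h2 mk)).
have [km|/ltW mk] := leP k m.
  exists m, (le_trans h km), h2; split=> //=; rewrite -e1.
  by rewrite -(smap_funD h' km h1) -e (smap_funD h km (le_trans h km)).
exists k, h, (le_trans h2 mk); split=> //=; rewrite e.
by rewrite -(smap_funD h1 mk h') e1 (smap_funD h2 mk (le_trans h2 mk)).
Qed.

Let germ_act o o' (x : F o) (y : F o') g :
  germ x = germ y -> germ (gsp_act g x) = germ (gsp_act g y).
Proof.
move=> /germP[k [h [h' [Dk e]]]]; apply/germP; exists k, h, h'; split=> //.
by rewrite !isvt_act e.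
Qed.

Let germ_stab o (x : F o) g : germ (gsp_act g x) = germ x -> gsp_act g x = x.
Proof.
move=> /germP[k [h [h' [Dk e]]]]; apply: (cS (svalP o) Dk h).1.
by rewrite e; congr (smap_fun _ _); exact: bool_irrelevance.
Qed.

Let Y := final_gspace germ_act.
Let c i (Di : D i) : isvt_map (S i) Y := final_in germ_act germ_stab (exist D i Di).

(** Isotropy groups do not change along isovariant maps, so the colimit of
    spaces is also the colimit in the isovariant category. *)
Lemma seq_colimit_exists : exists (Y : gspace G) (c : forall i, D i -> isvt_map (S i) Y),
  [/\ @is_colimit (isvtTop G) L S D Y c,
      forall i Di, closed_emb (c i Di),
      forall y, exists i Di x, c i Di x = y &
      forall C : set Y, (forall i Di, closed (c i Di @^-1` C)) -> closed C].
Proof.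
have cP i j (Di : D i) (Dj : D j) x y : c Di x = c Dj y <->
  exists k (h : (i <= k)%O) (h' : (j <= k)%O), D k /\ smap_fun h x = smap_fun h' y.
  by split=> [/final_classP/germP|h] //; apply/final_classP/germP.
have ccS i j (Di : D i) (Dj : D j) (ij : (i <= j)%O) x : c Dj (smap_fun ij x) = c Di x.
  by apply/cP; exists j, (lexx j), ij; split=> //; rewrite smap_fun1.
have csurj y : exists i (Di : D i) x, c Di x = y.
  by have [[i Di] [x <-]] := final_class_surj y; exists i, Di, x.
exists Y, c; split=> //.
- split=> [i j Di Dj ij|Z d dS]; first by apply: isvt_mapP => x; exact: ccS.
  have [|w hw] := final_univ germ_act germ_stab (W := Z)
      (h := fun o => d (proj1_sig o) (proj2_sig o)).
    move=> [i Di] [j Dj] x y /germP[k [h [h' [Dk /= e]]]].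
    have H i' (Di' : D i') (hi : (i' <= k)%O) (z : S i') :
        (d i' Di' : isvt_map _ _) z = (d k Dk : isvt_map _ _) (smap_fun hi z).
      exact: (esym (congr1 (fun f : isvt_map (S i') Z => f z) (dS i' k Di' Dk hi))).
    by rewrite (H i _ h) (H j _ h') e.
  exists w; split=> [i Di|w' hw']; first by apply: isvt_mapP => x; exact: (hw (exist D i
    Di) x).
  apply: isvt_mapP => y; have [i [Di [x <-]]] := csurj y.
  rewrite [LHS](hw (exist D i Di) x); exact: (esym (congr1 (fun f : isvt_map (S i) Z => f
    x) (hw' i Di))).
- move=> i Di; have cI : injective (c Di).
    move=> x y /cP[k [h [h' [Dk e]]]]; apply: (cS Di Dk h).1; rewrite e.
    by congr (smap_fun _ _); exact: bool_irrelevance.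
  split=> // C cC; apply: final_closedP => -[j Dj] /=.
  have [ij|/ltW ji] := leP i j.
    rewrite (_ : _ @^-1` _ = smap_fun ij @` C); first exact: (cS Di Dj ij).2.
    apply/seteqP; split=> [y [x Cx exy]|_ [x Cx <-]].
      have /cP[k [h [h' [Dk e]]]] : c Dj (smap_fun ij x) = c Dj y by rewrite ccS.
      exists x => //.
      apply: (cS Dj Dk h).1; rewrite e.
      by congr (smap_fun _ _); exact: bool_irrelevance.
    by exists x => //; exact: (esym (ccS _ _ Di Dj ij x)).
  rewrite (_ : _ @^-1` _ = smap_fun ji @^-1` C).
    by have /continuous_closedP := @isvt_continuous _ _ _ (smap_fun ji); exact.
  apply/seteqP; split=> [y [x Cx exy]|y Cy].
    have /cI ex : c Di x = c Di (smap_fun ji y) by rewrite ccS.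
    by rewrite /preimage /= -ex.
  by exists (smap_fun ji y) => //; exact: ccS.
move=> C cC; apply: final_closedP => -[i Di]; exact: cC.
Qed.

End Colim.

(** * Countable chains *)

Definition nat_wo : wo_type.
Proof.
refine (@WoType _ nat _).
by apply: (Wf_nat.well_founded_lt_compat nat id) => x y; rewrite ltEnat => /ssrnat.ltP.
Defined.

Section Chain.
Variables (G : finGroupType) (X : nat -> gspace G) (j : forall n, isvt_map (X n) (X n.+1)).

(** Composites of consecutive maps j, as a relation: a function of n <= m would
    need transports along equalities of indices. *)
Inductive chain_map (n : nat) : forall m, isvt_map (X n) (X m) -> Prop :=
| Chain0 : chain_map (isvt_id (X n))
| ChainS m t : @chain_map n m t -> chain_map (isvt_comp (j m) t).

(** The canonical form to which all composites reduce, which makes them unique;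
    its type is correct up to computation because addition recurses on its first
    argument. *)
Fixpoint iter_map (n k : nat) : isvt_map (X n) (X (k + n)) :=
  if k is k'.+1 then isvt_comp (j (k' + n)) (iter_map n k') else isvt_id (X n).

Lemma chain_map_iter n m (t : isvt_map (X n) (X m)) : chain_map t ->
  exists k, existT (fun m => isvt_map (X n) (X m)) m t = existT _ (k + n)%N (iter_map n k).
Proof.
elim=> [|{}m {}t _ [k e]]; first by exists 0%N.
exists k.+1.
exact: (congr1 (fun s : {m & isvt_map (X n) (X m)} =>
  existT (fun m => isvt_map (X n) (X m)) (projT1 s).+1
         (isvt_comp (j (projT1 s)) (projT2 s))) e).
Qed.

Lemma chain_map_uniq n m (t t' : isvt_map (X n) (X m)) :
  chain_map t -> chain_map t' -> t = t'.
Proof.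
move=> /chain_map_iter[k e] /chain_map_iter[k' e'].
have kk : k = k'.
  by apply: (@addIn n); rewrite -[LHS](congr1 (@projT1 _ _) e) -[RHS](congr1 (@projT1 _
    _) e').
by apply: (@existT_inj nat (fun m => isvt_map (X n) (X m)) m); rewrite e e' kk.
Qed.

Lemma chain_map_ex n m : (n <= m)%N -> exists t : isvt_map (X n) (X m), chain_map t.
Proof.
elim: m => [|m IH]; first by rewrite leqn0 => /eqP ->; exists (isvt_id _); exact: Chain0.
rewrite leq_eqVlt => /predU1P[->|]; first by exists (isvt_id _); exact: Chain0.
by rewrite ltnS => /IH[t ct]; exists (isvt_comp (j m) t); exact: ChainS.
Qed.

Lemma chain_map_comp n m l (t : isvt_map (X n) (X m)) (s : isvt_map (X m) (X l)) :
  chain_map t -> chain_map s -> chain_map (isvt_comp s t).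
Proof.
move=> ct; elim=> [|{}l {}s _ IH].
  by rewrite (_ : isvt_comp _ _ = t) //; exact: isvt_mapP.
rewrite (_ : isvt_comp _ _ = isvt_comp (j l) (isvt_comp s t)); last exact: isvt_mapP.
exact: ChainS.
Qed.

Definition chain_smap (n m : nat_wo) (h : (n <= m)%O) : isvt_map (X n) (X m) :=
  sval (cid (chain_map_ex h)).

Lemma chain_smapP (n m : nat_wo) (h : (n <= m)%O) : chain_map (chain_smap h).
Proof. exact: (svalP (cid (chain_map_ex h))). Qed.

Lemma chain_smap1 (n : nat_wo) (h : (n <= n)%O) : chain_smap h = isvt_id (X n).
Proof. exact: chain_map_uniq (chain_smapP h) (Chain0 n). Qed.

Lemma chain_smapD (n m l : nat_wo) (nm : (n <= m)%O) (ml : (m <= l)%O) (nl : (n <= l)%O) :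
  isvt_comp (chain_smap ml) (chain_smap nm) = chain_smap nl.
Proof.
exact: chain_map_uniq (chain_map_comp (chain_smapP nm) (chain_smapP ml)) (chain_smapP nl).
Qed.

Definition chain_seq : Defs.sequence (isvtTop G) nat_wo :=
  @Defs.Sequence (isvtTop G) nat_wo X chain_smap chain_smap1 chain_smapD.

Lemma chain_map_closed_emb n m (t : isvt_map (X n) (X m)) :
  (forall n, closed_emb (j n)) -> chain_map t -> closed_emb t.
Proof.
move=> cj; elim=> [|{}m {}t _ IH]; first exact: closed_emb_id.
exact: (closed_emb_comp (cj m) IH).
Qed.

Lemma chain_colimit : (forall n, closed_emb (j n)) ->
  exists (Z : gspace G) (c : forall n, isvt_map (X n) Z),
  [/\ forall n x, c n.+1 (j n x) = c n x,
      forall (W : gspace G) (d : forall n, isvt_map (X n) W),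
        (forall n x, d n.+1 (j n x) = d n x) ->
        exists w : isvt_map Z W, forall n x, w (c n x) = d n x,
      forall n, closed_emb (c n),
      forall z, exists n x, c n x = z &
      forall C : set Z, (forall n, closed (c n @^-1` C)) -> closed C].
Proof.
move=> cj.
have [|Z [c [[cc cu] ce cs cC]]] := @seq_colimit_exists G nat_wo chain_seq setT.
  by move=> n m _ _ h; exact: chain_map_closed_emb (chain_smapP h).
exists Z, (fun n => c n Logic.I); split.
- move=> n x; have h : ((n : nat_wo) <= n.+1)%O by rewrite leEnat.
  have := congr1 (fun f : isvt_map (X n) Z => f x) (cc n n.+1 Logic.I Logic.I h).
  move=> <- /=; congr (c n.+1 Logic.I _).
  have -> // : chain_smap h = isvt_comp (j n) (isvt_id _).
  by apply: chain_map_uniq; [exact: chain_smapP | exact: ChainS (Chain0 n)].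
- move=> W d dj.
  have dt n m (t : isvt_map (X n) (X m)) x : chain_map t -> d m (t x) = d n x.
    by move=> ct; elim: ct x => // {}m {}t _ IH x; rewrite /= dj.
  have [|w [hw _]] := cu W (fun n _ => d n).
    by move=> n m _ _ h; apply: isvt_mapP => x; apply: dt; exact: chain_smapP.
  exists w => n x; exact: (congr1 (fun f : isvt_map (X n) W => f x) (hw n Logic.I)).
- by move=> n; exact: ce.
- by move=> z; have [n [[] [x e]]] := cs z; exists n, x.
by move=> C hC; apply: cC => n [].
Qed.

End Chain.

Lemma finite_union_closed (T : topologicalType) (E : nat -> set T) (m l : nat) :
  (forall n, closed (E n)) -> closed [set z | exists2 n, (m <= n < l)%N & E n z].
Proof.
move=> cE; elim: l => [|l IH].
  rewrite (_ : mkset _ = set0); first exact: closed0.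
  by apply/seteqP; split=> // z [n]; rewrite ltn0 andbF.
have [ml|lm] := leqP m l; last first.
  rewrite (_ : mkset _ = set0); first exact: closed0.
  apply/seteqP; split=> // z [n /andP[mn]]; rewrite ltnS => nl _.
  by have := leq_trans lm (leq_trans mn nl); rewrite ltnn.
rewrite (_ : mkset _ = [set z | exists2 n, (m <= n < l)%N & E n z] `|` E l).
  exact: closedU.
apply/seteqP; split=> z [].
- move=> n /andP[mn]; rewrite ltnS leq_eqVlt => /predU1P[-> Ez|nl Ez]; first by right.
  by left; exists n => //; rewrite mn.
- by move=> [n /andP[mn nl] Ez]; exists n => //; rewrite mn ltnS ltnW.
by move=> Ez; exists l => //; rewrite ml ltnS leqnn.
Qed.

(** If no stage contains the image of K, choose for each n a point of the image
    outside stage n and a closed set E n that contains it and misses stage n.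
    The unions F m of the E n with n >= m are closed, since each stage meets only
    finitely many E n.  They decrease to the empty set, but all meet the compact
    image of K. *)
Lemma chain_compact (G : finGroupType) (X : nat -> gspace G)
    (j : forall n, isvt_map (X n) (X n.+1)) (Z : gspace G)
    (c : forall n, isvt_map (X n) Z) (K : topologicalType) (u : K -> Z) :
  (forall n x, c n.+1 (j n x) = c n x) -> (forall n, closed_emb (c n)) ->
  (forall z, exists n x, c n x = z) ->
  (forall C : set Z, (forall n, closed (c n @^-1` C)) -> closed C) ->
  (forall n z, (exists x, j n x = z) \/
     exists E, [/\ closed E, E z & forall x, ~ E (j n x)]) ->
  compact [set: K] -> continuous u ->
  exists n, forall k, exists x, c n x = u k.
Proof.
move=> cj ce cs cC sep cK cu.
have cup n m y : (n <= m)%N -> exists x, c m x = c n y.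
  elim: m => [|m IH]; first by rewrite leqn0 => /eqP n0; subst n; exists y.
  rewrite leq_eqVlt => /predU1P[nm|]; first by subst n; exists y.
  by rewrite ltnS => /IH[x <-]; exists (j m x); rewrite cj.
(* Take the first stage m.+1 that contains z; there z is new, and the closed set
   separating it from stage m stays closed in Z. *)
have sepZ n z : ~ (exists x, c n x = z) ->
    exists E, [/\ closed E, E z & forall x, ~ E (c n x)].
  move=> nz; have exm : exists m, `[< exists x, c m x = z >].
    by have [m [x e]] := cs z; exists m; apply/asboolP; exists x.
  have [m /asboolP[x e] minm] := ex_minnP exm.
  have nm : (n < m)%N.
    by rewrite ltnNge; apply/negP => /(cup _ _ x)[y ey]; apply: nz; exists y; rewrite ey.
  case: m => // m in x e minm nm *.
  have [[y ey]|[E [cE Ex nE]]] := sep m x.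
    have : (m.+1 <= m)%N by apply: minm; apply/asboolP; exists y; rewrite -e -ey cj.
    by rewrite ltnn.
  exists (c m.+1 @` E); split; [exact: (ce _).2 | by exists x | move=> y [x' Ex' e']].
  have [y' ey'] := cup n m y nm; apply: (nE y').
  suff <- : x' = j m y' by [].
  by apply: (ce m.+1).1; rewrite e' -ey' cj.
apply: contrapT => nf.
have {}nf n : exists k, ~ exists x, c n x = u k.
  by apply: contrapT => h; apply: nf; exists n => k; apply: contrapT => h'; apply: h;
    exists k.
have /choice[E HE] : forall n, exists E : set Z,
    [/\ closed E, exists k, E (u k) & forall x, ~ E (c n x)].
  move=> n; have [k /sepZ[E [cE Ek nE]]] := nf n; exists E; split=> //.
  by exists k.
pose F m := [set z | exists2 n, (m <= n)%N & E n z].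
have FX m l x : F m (c l x) -> exists2 n, (m <= n < l)%N & E n (c l x).
  move=> [n mn En]; exists n => //; rewrite mn ltnNge; apply/negP => ln.
  by have [y ey] := cup _ _ x ln; have [_ _] := HE n => /(_ y); rewrite ey.
have cF m : closed (F m).
  apply: cC => l.
  rewrite (_ : _ @^-1` _ = [set x | exists2 n, (m <= n < l)%N & (c l @^-1` E n) x]).
    apply: finite_union_closed => n; have [cE _ _] := HE n.
    by have /continuous_closedP := @isvt_continuous _ _ _ (c l); exact.
  by apply/seteqP; split=> x => [/FX //|[n /andP[mn _] En]]; exists n.
have /compact_near_coveringP/(_ nat \oo (fun m k => ~ F m (u k)) _) := cK.
case.
- move=> k _; have [l [x e]] := cs (u k).
  have nF : ~ F l (u k).
    by rewrite -e => /FX[n /andP[ln nl]]; have := leq_ltn_trans ln nl; rewrite ltnn.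
  exists (u @^-1` (~` F l), [set m | (l <= m)%N]) => /=.
    split; last by exists l.
    apply: open_nbhs_nbhs; split=> //.
    by have /continuousP := cu; apply; rewrite openC.
  move=> [k' m] [/= nFk lm] [n mn En]; apply: nFk; exists n => //.
  exact: leq_trans lm mn.
move=> m _ H; have [_ [k Ek] _] := HE m.
by apply: (H m (leqnn m) k) => //; exists m.
Qed.

(** * The small object argument *)

Lemma iterate_step (T : Type) (J : T -> T -> Type) (Q : forall s s', J s s' -> Prop) :
  (forall s, exists s' (j : J s s'), Q s s' j) ->
  forall s0, exists (s : nat -> T) (j : forall n, J (s n) (s n.+1)),
    s 0%N = s0 /\ forall n, Q (s n) (s n.+1) (j n).
Proof.
move=> step s0; pose next s := sval (cid (step s)).
exists (fun n => iter n next s0), (fun n => sval (cid (svalP (cid (step (iter n next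
  s0)))))).
by split=> // n; exact: (svalP (cid (svalP (cid (step (iter n next s0)))))).
Qed.

Section Soa.
Variables (R : realType) (G : finGroupType).
Local Notation II := (set_type (@unit_interval R)).
Local Notation DD n := (set_type (disk R n)).
Local Notation SS n := (set_type (bsphere R n)).
Local Notation Dl H := (link_simplex R H).
Implicit Types X Y Z E : gspace G.

Lemma simplex_cpt_hausdorff k : cpt_hausdorff (set_type (simplex R k)).
Proof.
apply: cpt_hausdorff_subset; first exact: rV_hausdorff.
have cB : compact [set v : 'rV[R]_k.+1 | forall i, `[0, 1]%classic (v ord0 i)].
  exact: (@rV_compact R k.+1 (fun=> `[0, 1]%classic) (fun=> @segment_compact R _ _)).
rewrite (_ : simplex R k =
    [set v : 'rV[R]_k.+1 | forall i, `[0, 1]%classic (v ord0 i)] `&`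
    (fun v : 'rV[R]_k.+1 => \sum_i v 0 i) @^-1` [set t | t = 1]); last first.
  by apply/seteqP; split=> v [h1 h2]; split=> // i; have := h1 i; rewrite /= in_itv.
have cS : closed ((fun v : 'rV[R]_k.+1 => \sum_i v 0 i) @^-1` [set t | t = 1]).
  have /continuous_closedP H : continuous (fun v : 'rV[R]_k.+1 => \sum_i v 0 i).
    by apply: (cont_sum (W := 'rV[R]_k.+1)) => i; exact: coord_continuous.
  exact: (H [set t | t = 1] (@closed_eq R 1)).
apply: (subclosed_compact _ cB); last by move=> v [].
apply: closedI => //; apply: compact_closed => //; exact: rV_hausdorff.
Qed.

Lemma discrete_cpt_hausdorff : cpt_hausdorff (discrete_topology G).
Proof.
split; last exact: discrete_hausdorff.
by apply: finite_compact; exact: (@finite_finset G).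
Qed.

(** The linking simplex is a quotient of G x Delta^k; the space G x Delta^k x K is
    compact Hausdorff, so the map from it to the product is a probe. *)
Lemma link_cell_compact (H : link_chain G) (K : topologicalType) :
  cpt_hausdorff K -> compact [set: gprod (Dl H) K].
Proof.
move=> hK; set k := chain_len H.
have hGS := cpt_hausdorff_prod discrete_cpt_hausdorff (simplex_cpt_hausdorff k).
pose P := (discrete_topology G * set_type (simplex R k))%type.
have cl : continuous (fun p : P => @link_class R G H p.1 p.2 : Dl H).
  rewrite (_ : (fun p => _) = (fun p => \pi_(quotient_topology {eq_quot (link_equiv R
    H)})%qT (p : pre_link R H))).
    apply: (continuous_after (f := (id : P -> pre_link R H))); last exact: pi_continuous.
    by apply: kify_probe; [exact: hGS.1 | exact: hGS.2 | exact: continuous_idfun].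
  by apply: funext => -[].
have hM := cpt_hausdorff_prod hGS hK.
pose m (q : P * K) : gprod (Dl H) K := (@link_class R G H q.1.1 q.1.2, q.2).
have cm : continuous m.
  apply: (gprod_probe hM); last exact: continuous_snd_pair.
  exact: (continuous_after (@continuous_fst_pair _ _) cl).
have -> : [set: gprod (Dl H) K] = m @` [set: P * K].
  apply/seteqP; split=> // -[q t] _.
  set p := generic_quotient.repr (q : {eq_quot (link_equiv R H)}%qT).
  by exists ((p.1, p.2), t) => //; rewrite /m /= link_classK.
apply: continuous_compact; last exact: hM.1.
exact: continuous_subspaceT.
Qed.

Definition all_afib X Y (p : isvt_map X Y) := forall H, serre_afib R (Dl H) p.

Definition llp_afib X Y (i : isvt_map X Y) :=
  forall E Z (p : isvt_map E Z), all_afib p -> lifts i p.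

Record cell_square X Y (f : isvt_map X Y) := CellSquare {
  cs_chain : link_chain G;
  cs_dim : nat;
  cs_top : isvt_map (gprod (Dl cs_chain) (SS cs_dim)) X;
  cs_bot : isvt_map (gprod (Dl cs_chain) (DD cs_dim)) Y;
  cs_comm : forall a s, f (cs_top (a, s)) = cs_bot (a, sphere_incl s) }.

Lemma closed_emb_sphere (A : gspace G) n :
  closed_emb (gprod_map A (@sphere_incl_continuous R n)).
Proof. by apply: closed_emb_gprod; [exact: sphere_cpt_hausdorff | exact:
  (disk_cpt_hausdorff _ _).2 | exact: sphere_incl_inj]. Qed.

(** Attach a cell for each commutative square from a generating cofibration to f,
    all at once. *)
Lemma soa_step X Y (f : isvt_map X Y) :
  exists (q : {X' : gspace G & isvt_map X' Y}) (j : isvt_map X (projT1 q)),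
  [/\ forall x, projT2 q (j x) = f x, closed_emb j, llp_afib j,
      forall (l : cell_square f), exists g : isvt_map (gprod (Dl (cs_chain l)) (DD
        (cs_dim l))) (projT1 q),
        (forall a s, g (a, sphere_incl s) = j (cs_top l (a, s))) /\
        (forall y, projT2 q (g y) = cs_bot l y) &
      forall z, (exists x, j x = z) \/
        exists C : set (projT1 q), [/\ closed C, C z & forall x, ~ C (j x)]].
Proof.
have [P [j [g [gj univ surj cj sep]]]] := @attach_exists G X (cell_square f)
  (fun l => gprod (Dl (cs_chain l)) (SS (cs_dim l)))
  (fun l => gprod (Dl (cs_chain l)) (DD (cs_dim l)))
  (fun l => gprod_map (Dl (cs_chain l)) (@sphere_incl_continuous R (cs_dim l)))
  (fun l => @cs_top _ _ _ l) (fun l => @closed_emb_sphere _ _).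
have [|p [pj pg]] := univ Y f (fun l => @cs_bot _ _ _ l).
  by move=> l [a s]; rewrite cs_comm.
exists (existT _ P p), j; split=> //.
- move=> E Z q aq u v uv.
  have ek : forall l : cell_square f, exists k : isvt_map (gprod (Dl (cs_chain l)) (DD
    (cs_dim l))) E,
      (forall a s, k (a, sphere_incl s) = u (cs_top l (a, s))) /\
      (forall y, q (k y) = v (g l y)).
    move=> l; have [a s|h [h1 h2]] := aq (cs_chain l) (cs_dim l)
        (isvt_comp u (cs_top l)) (isvt_comp v (g l)).
      by rewrite /= uv -gj.
    by exists h.
  pose k l := sval (cid (ek l)); have hk l := svalP (cid (ek l)).
  have [|h [hj hg]] := univ E u k; first by move=> l [a s]; rewrite (hk l).1.
  exists h; split=> // z; have [[x <-]|[l [b [_ <-]]]] := surj z.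
    by rewrite hj.
  by rewrite hg (hk l).2.
- by move=> l; exists (g l); split=> [a s|y]; [exact: (gj l (a, s)) | exact: pg].
move=> z; have [?|[l [[b1 b2] [nb <-]]]] := surj z; first by left.
right.
have cC : closed [set b' : gprod (Dl (cs_chain l)) (DD (cs_dim l)) | b'.2 = b2].
  have /continuous_closedP := @gsnd_continuous G (Dl (cs_chain l)) (DD (cs_dim l)).
  move=> /(_ [set b2]) H; apply: H.
  exact/accessible_closed_set1/hausdorff_accessible/(disk_cpt_hausdorff _ _).2.
have [|c1 c2] := sep l _ cC.
  by move=> [a s] /= e; apply: nb; exists (b1, s); rewrite /= -e.
exists (g l @` [set b' | b'.2 = b2]); split=> //; first by exists (b1, b2).
by move=> x [b' e' /c2]; apply.
Qed.

(** Iterate [soa_step].  A boundary map into the colimit factors through some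
    stage, so the square it belongs to has been solved at the next one. *)
Lemma small_object_factorization X Y (f : isvt_map X Y) :
  exists (Z : gspace G) (i : isvt_map X Z) (p : isvt_map Z Y),
    [/\ forall x, p (i x) = f x, llp_afib i & all_afib p].
Proof.
have [s [j0 [s0 jP]]] := iterate_step
  (fun s : {X : gspace G & isvt_map X Y} => soa_step (projT2 s)) (existT _ X f).
suff : exists (Z : gspace G) (i : isvt_map (projT1 (s 0%N)) Z) (p : isvt_map Z Y),
    [/\ forall x, p (i x) = projT2 (s 0%N) x, llp_afib i & all_afib p].
  by rewrite s0.
pose X_ n := projT1 (s n); pose f_ n : isvt_map (X_ n) Y := projT2 (s n).
pose j n : isvt_map (X_ n) (X_ n.+1) := j0 n.
have fj n x : f_ n.+1 (j n x) = f_ n x by have [h _ _ _ _] := jP n; exact: h.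
have ej n : closed_emb (j n) by have [_ h _ _ _] := jP n.
have lj n : llp_afib (j n) by have [_ _ h _ _] := jP n.
have gj n (l : cell_square (f_ n)) : exists g : isvt_map (gprod (Dl (cs_chain l)) (DD
  (cs_dim l))) (X_ n.+1),
    (forall a s, g (a, sphere_incl s) = j n (cs_top l (a, s))) /\
    (forall y, f_ n.+1 (g y) = cs_bot l y).
  by have [_ _ _ h _] := jP n; exact: h.
have sj n z : (exists x, j n x = z) \/
    exists C : set (X_ n.+1), [/\ closed C, C z & forall x, ~ C (j n x)].
  by have [_ _ _ _ h] := jP n; exact: h.
have [Z [c [cj univ ce cs cC]]] := chain_colimit ej.
have [p pc] := univ Y f_ fj.
exists Z, (c 0%N), p; split=> [x||H n u v uv].
- exact: (pc 0%N x).
- move=> E W q aq u v uv.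
  pose St n := {h : isvt_map (X_ n) E | forall x, q (h x) = v (c n x)}.
  have nxt n (h : St n) : exists h' : St n.+1, forall x, sval h' (j n x) = sval h x.
    have [|h' [h1 h2]] := lj n E W q aq (sval h) (isvt_comp v (c n.+1)).
      by move=> x; rewrite (svalP h) /= cj.
    by exists (exist _ h' h2).
  pose h n : St n := nat_rect St (exist _ u uv) (fun n h => sval (cid (nxt n h))) n.
  have hj n x : sval (h n.+1) (j n x) = sval (h n) x.
    exact: (svalP (cid (nxt n (h n)))).
  have [w hw] := univ E (fun n => sval (h n)) hj.
  exists w; split=> [x|z]; first exact: (hw 0%N).
  by have [n [x <-]] := cs z; rewrite hw (svalP (h n)).
have [m hm] := chain_compact cj ce cs cC sj (link_cell_compact (H := H)
  (sphere_cpt_hausdorff R n))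
  (@isvt_continuous _ _ _ u).
have [u' hu'] := closed_emb_factor (ce m) hm.
have comm a t : f_ m (u' (a, t)) = v (a, sphere_incl t) by rewrite -pc hu' uv.
have [g [g1 g2]] := gj m (CellSquare comm).
exists (isvt_comp (c m.+1) g); split=> [a t|y] /=; last by rewrite pc g2.
by rewrite g1 cj hu'.
Qed.

End Soa.

(** * Relative cell complexes and smallness *)

Section Retracts.
Variables (C : category) (A : Type) (I : arrow_family C A).

Lemma rlp_retract : retract_closed (fun X Y p => @rlp C A I X Y p).
Proof.
move=> X Y X' Y' f f' [i [r [j [s [ri sj fi fr]]]]] lf' a u v uv.
have [|h [hu hv]] := lf' a (i \oc u) (j \oc v).
  by rewrite Defs.compA fi -Defs.compA uv Defs.compA.
exists (r \oc h); split; first by rewrite -Defs.compA hu Defs.compA ri comp1m.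
by rewrite Defs.compA fr -Defs.compA hv Defs.compA sj comp1m.
Qed.

Lemma llp_retract (P : mor_class C) :
  retract_closed (fun X Y i => forall (E Z : C) (p : mhom E Z), P E Z p -> has_lift i p).
Proof.
move=> X Y X' Y' f f' [i [r [j [s [ri sj fi fr]]]]] lf' E Z p Pp u v uv.
have [|h [hu hv]] := lf' E Z p Pp (u \oc r) (v \oc s).
  by rewrite Defs.compA uv -Defs.compA fr Defs.compA.
exists (h \oc j); split; first by rewrite -Defs.compA -fi Defs.compA hu -Defs.compA ri
  compm1.
by rewrite Defs.compA hv -Defs.compA sj compm1.
Qed.

End Retracts.

Section Smallness.
Variable G : finGroupType.
Implicit Types X Y Z : gspace G.
Let C := isvtTop G.

Definition emb_class : mor_class C := fun X Y (f : isvt_map X Y) => closed_emb f.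

(** A pushout or colimit specified by its universal property is compared with an
    explicit one by an injective map w. *)
Lemma closed_emb_of_comp X Y Z (f : isvt_map X Y) (w : isvt_map Y Z) (g : isvt_map X Z) :
  injective w -> (forall x, w (f x) = g x) -> closed_emb g -> closed_emb f.
Proof.
move=> wI wf [gI gC]; split=> [x y e|K cK]; first by apply: gI; rewrite -!wf e.
rewrite (_ : f @` K = w @^-1` (g @` K)).
  by have /continuous_closedP := @isvt_continuous _ _ _ w; apply; exact: gC.
apply/seteqP; split=> [_ [x Kx <-]|y [x Kx e]]; exists x => //.
by apply: wI; rewrite wf.
Qed.

Lemma pushout_closed_emb (B : Type) (I : arrow_family C B) :
  (forall b, emb_class (mor (I b))) ->
  forall (X P : C) (j : mhom X P), pushout_of I j -> emb_class j.
Proof.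
move=> eI X P j [b [f [g [gi univ]]]].
have [Q [j' [g' [gj' univ' _ ej' _]]]] := @attach_exists G X unit
  (fun=> src (I b)) (fun=> tgt (I b)) (fun=> mor (I b)) (fun=> f) (fun=> eI b).
have e' : (g' tt : mhom (tgt (I b)) (Q : C)) \oc mor (I b) = (j' : mhom X (Q : C)) \oc f.
  by apply: isvt_mapP => a; exact: gj'.
have [w [[wg wj] _]] := univ Q (g' tt) j' e'.
have gi' (a : src (I b)) : (g : isvt_map _ _) ((mor (I b) : isvt_map _ _) a) =
    (j : isvt_map _ _) ((f : isvt_map _ _) a).
  exact: (congr1 (fun k : isvt_map (src (I b)) P => k a) gi).
have [w' [w'j w'g]] := univ' P j (fun=> g) (fun _ => gi').
have [u0 [_ uniq]] := univ P g j gi.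
have ww : (w' : mhom (Q : C) P) \oc w = Defs.idm P.
  rewrite -(uniq (Defs.idm P)); last by rewrite !comp1m.
  apply/esym/uniq; split; rewrite -Defs.compA.
    by rewrite wg; apply: isvt_mapP => y; exact: w'g.
  by rewrite wj; apply: isvt_mapP => y; exact: w'j.
apply: (@closed_emb_of_comp X P Q j w j') => //.
  apply: (can_inj (g := w')) => y.
  exact: (congr1 (fun k : isvt_map P P => k y) ww).
by move=> x; exact: (congr1 (fun k : isvt_map X Q => k x) wj).
Qed.

Section Seq.
Variables (L : wo_type) (S : Defs.sequence C L).

Lemma colimit_closed_emb (D : set L)
    (eS : forall i j (Di : D i) (Dj : D j) (ij : (i <= j)%O), closed_emb (smap_fun S ij))
    (Y : gspace G) (c : forall i, D i -> isvt_map (S i) Y) :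
  @is_colimit C L S D Y c ->
  (forall i Di, closed_emb (c i Di)) /\ (forall y, exists i Di x, c i Di x = y).
Proof.
move=> [cc cu]; have [Z [d [[dc du] de ds _]]] := seq_colimit_exists eS.
have [w [wc _]] := cu Z d dc.
have [w' [w'd _]] := du Y c cc.
have [u0 [_ uniq]] := cu Y c cc.
have ww : (w' : mhom (Z : C) (Y : C)) \oc w = Defs.idm (Y : C).
  rewrite -(uniq (Defs.idm (Y : C))); last by move=> i Di; rewrite comp1m.
  by apply/esym/uniq => i Di; rewrite -Defs.compA wc w'd.
have w'w y : w' (w y) = y := congr1 (fun k : isvt_map Y Y => k y) ww.
split=> [i Di|y].
  apply: (@closed_emb_of_comp _ _ _ (c i Di) w (d i Di)) => //.
    exact: (can_inj w'w).
  by move=> x; exact: (congr1 (fun k : isvt_map (S i) Z => k x) (wc i Di)).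
have [i [Di [x e]]] := ds (w y); exists i, Di, x.
rewrite -[y]w'w -e.
exact: (esym (congr1 (fun k : isvt_map (S i) Y => k x) (w'd i Di))).
Qed.

(** Transfinite induction on the larger index; at limit stages
    [colimit_closed_emb] applies. *)
Lemma seq_closed_emb : is_continuous_seq S -> steps_in emb_class S ->
  forall i j (ij : (i <= j)%O), closed_emb (smap_fun S ij).
Proof.
move=> cS sS i j; elim/(well_founded_ind (@wo_wf L)): j i => j IH i ij.
have [e|ne] := eqVneq i j.
  subst j; split=> [x y|K cK]; first by rewrite !smap_fun1.
  rewrite (_ : _ @` K = K) //; apply/seteqP.
  by split=> [_ [x Kx <-]|x Kx]; [rewrite smap_fun1 | exists x; rewrite ?smap_fun1].
have lij : (i < j)%O by rewrite lt_neqAle ne.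
have [[k kj]|nk] := pselect (exists k, is_succ k j).
  have ik : (i <= k)%O.
    rewrite leNgt; apply/negP => /(kj.2 i); rewrite leNgt.
    by rewrite lij.
  have kj' := ltW kj.1.
  have [I1 C1] := closed_emb_comp (sS k j kj' kj) (IH k kj.1 i ik).
  split=> [x y e|K /C1].
    by apply: I1; rewrite /= !smap_funD.
  congr closed; apply/seteqP; split=> _ [x Kx <-]; exists x => //.
    exact: (esym (smap_funD ik kj' ij x)).
  exact: (smap_funD ik kj' ij x).
have lj : is_limit j.
  split=> [b|k kj]; last by apply: nk; exists k.
  by have := b i; rewrite leNgt lij.
have [|ce _] := colimit_closed_emb _ (cS j lj).
  by move=> i' j' Di Dj ij'; exact: IH.
by have := ce i lij; rewrite (_ : ltW _ = ij) //; exact: bool_irrelevance.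
Qed.

End Seq.

Lemma rel_cell_closed_emb (B : Type) (I : arrow_family C B) :
  (forall b, emb_class (mor (I b))) ->
  forall (X Y : C) (f : mhom X Y), rel_cell I f -> emb_class f.
Proof.
move=> eI X Y f; case=> L S b Z c bb cS sS cc.
have eS := seq_closed_emb cS (fun i j ij h => pushout_closed_emb eI (sS i j ij h)).
by have [ce _] := colimit_closed_emb (fun i j _ _ => @eS i j) cc; exact: ce.
Qed.

(** The cardinal is that of A: the stages in which the points of A land have an
    upper bound. *)
Lemma small_rel_closed_emb (P : mor_class C) (A : C) :
  (forall (X Y : C) (f : mhom X Y), P X Y f -> emb_class f) -> small_rel P A.
Proof.
move=> PE; exists (carrier A : Type) => L [_ _ fL] S cS sS Y c cc.
have eS := seq_closed_emb cS (fun i j ij h => PE _ _ _ (sS i j ij h)).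
have [ce cs] := colimit_closed_emb (fun i j _ _ => @eS i j) cc.
have cD i j (ij : (i <= j)%O) x : (c j Logic.I : isvt_map _ _) (smap_fun S ij x) =
    (c i Logic.I : isvt_map _ _) x.
  exact: (congr1 (fun f : isvt_map (S i) Y => f x) (cc.1 i j Logic.I Logic.I ij)).
have fac (h : isvt_map A Y) : exists i, exists k : isvt_map (A : gspace G) (S i),
    (c i Logic.I : isvt_map _ _) \o k = h.
  have /choice[I hI] : forall a : A, exists i, exists x, (c i Logic.I : isvt_map _ _) x =
    h a.
    by move=> a; have [i [[] [x e]]] := cs (h a); exists i, x.
  have [i ub] := fL (range I) (card_image_le _ _).
  have [|k hk] := closed_emb_factor (c := c i Logic.I) (u := h) (ce i Logic.I).
    move=> a; have [x e] := hI a; have le : (I a <= i)%O by apply: ub; exists a.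
    by exists (smap_fun S le x); rewrite cD.
  by exists i, k; apply: funext => a; exact: hk.
split=> [i j Di Dj ij|T d dc].
  apply: funext => h; case: Di Dj => -[].
  by apply: isvt_mapP => a; exact: (cD i j ij (h a)).
have /choice[u hu] : forall h : isvt_map A Y, exists t : T,
    forall i (k : isvt_map (A : gspace G) (S i)),
    (c i Logic.I : isvt_map _ _) \o k = h -> d i Logic.I k = t.
  move=> h; have [i [k hk]] := fac h; exists (d i Logic.I k) => j l hl.
  wlog ij : i j k l hk hl / (i <= j)%O.
    move=> W; have /orP[ij|ji] := le_total i j; first exact: (W i j k l hk hl ij).
    exact: (esym (W j i l k hl hk ji)).
  have <- := congr1 (fun f => f k) (dc i j Logic.I Logic.I ij).
  congr (d j Logic.I _); apply: isvt_mapP => a.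
  apply: (ce j Logic.I).1.
  have -> : (c j Logic.I : isvt_map _ _) (smap_fun S ij (k a)) = h a.
    by rewrite cD -hk.
  by rewrite -hl.
exists u; split=> [i [] |u' hu'].
  by apply: funext => k; apply/esym/hu.
apply: funext => h; have [i [k hk]] := fac h.
rewrite -(hu h i k hk) -(congr1 (fun f => f k) (hu' i Logic.I)) /=.
by congr u'; apply: isvt_mapP => a; rewrite -hk.
Qed.

End Smallness.

(** * The model structure *)

Section Model.
Variables (R : realType) (G : finGroupType).
Local Notation II := (set_type (@unit_interval R)).
Local Notation DD n := (set_type (disk R n)).
Local Notation SS n := (set_type (bsphere R n)).
Local Notation i0 := (i0 R).
Local Notation i1 := (i1 R).
Local Notation Dl H := (link_simplex R H).
Local Notation C := (isvtTop G).
Implicit Types X Y Z E : gspace G.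

Definition all_fib X Y (p : isvt_map X Y) := forall H : link_chain G, serre_fib R (Dl H) p.
Definition all_weq X Y (f : isvt_map X Y) := forall H : link_chain G, serre_weq R (Dl H) f.

Lemma rlp_gen_cof X Y (p : isvt_map X Y) : @rlp C _ (gen_cof R G) X Y p <-> all_afib R p.
Proof.
split=> [h H n u v uv|h [H n]].
  have /has_liftP/(_ u v)[[a s]|k [ku kv]] := h (H, n); first exact: uv.
  by exists k; split=> // a s; exact: (ku (a, s)).
apply/has_liftP => u v uv.
have [a s|k [ku kv]] := h H n u v; first exact: (uv (a, s)).
by exists k; split=> // -[a s]; exact: ku.
Qed.

Lemma rlp_gen_acof X Y (p : isvt_map X Y) :
  @rlp C _ (gen_acof R G) X Y p <-> all_fib p.
Proof.
have z0 (t : set_type [set (0 : R)]) : set_incl (@zero_unit_interval R) t = i0.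
  by apply: set_val_inj; rewrite i0E; exact: (set_valP t).
have zz : [set (0 : R)] 0 by [].
pose z : set_type [set (0 : R)] := exist _ 0 (mem_set zz).
have zE (t : set_type [set (0 : R)]) : t = z.
  by apply: set_val_inj; rewrite (set_valP t : set_val t = 0).
split=> [h H n w V wV|h [H n]].
  have /has_liftP/(_ (isvt_comp w (gfst _ _)) V)[[x t]|k [kw kV]] := h (H, n).
    by rewrite /= wV; congr (V (_, _)); rewrite z0.
  exists k; split=> // x; rewrite -[RHS](kw (x, z)) /=.
  by congr (k (_, _)); rewrite z0.
apply/has_liftP => u v uv.
have [x|k [ku kv]] := h H n (isvt_comp u (gslice _ z)) v.
  by rewrite [LHS](uv (x, z)) /=; congr (v (_, _)); rewrite z0.
exists k; split=> // -[x t]; rewrite (zE t) -[RHS](ku x) /=.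
by congr (k (_, _)); rewrite z0.
Qed.

(** N is functorial, so a retract of f makes N f -> Y a retract. *)
Lemma all_weq_retract : @retract_closed C (fun X Y f => all_weq f).
Proof.
move=> X Y X' Y' f f' [i [r [j [s [ri sj fi fr]]]]] wf' H.
move: i r j s ri sj fi fr => /= i r j s ri sj fi fr.
have pt (A B : gspace G) (k k' : isvt_map A B) : k = k' -> forall x, k x = k' x.
  by move=> ->.
have st1 n : isvt_comp j (mpath_eval R f) (n, i0) = f' (isvt_comp i (mpath_src R f) n).
  rewrite [RHS](pt _ _ _ _ fi) /=; congr (j _); exact: mpath_eval0.
have st2 n : isvt_comp s (mpath_eval R f') (n, i0) = f (isvt_comp r (mpath_src R f') n).
  rewrite [RHS](pt _ _ _ _ fr) /=; congr (s _); exact: mpath_eval0.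
suff : @is_retract C _ _ _ _ (mpath_tgt R f) (mpath_tgt R f').
  move=> /rlp_retract ret.
  have /rlp_gen_cof : rlp (gen_cof R G) (mpath_tgt R f : @mhom C _ _).
    by apply: ret; apply/rlp_gen_cof.
  exact.
exists (mpath_pair st1), (mpath_pair st2), j, s; split=> //; apply: isvt_mapP => n //.
by apply: mpath_ext => [|t]; [exact: (pt _ _ _ _ ri) | exact: (pt _ _ _ _ sj)].
Qed.

Lemma weq_fibP X Y (p : isvt_map X Y) : (all_weq p /\ all_fib p) <-> all_afib R p.
Proof.
split=> [[w f] H|h]; first exact: afib_of_weq.
by split=> H; [exact: weq_of_afib | exact: afib_fib].
Qed.

(** The lift l of the identity along N j -> B is a retraction r : B -> A with a
    homotopy H from j r to the identity, constant on A.  So p u r is homotopic to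
    v relative to A, and it remains to lift this homotopy relative to A starting
    at u r; this is a lifting problem of j against [mpath_gap p]. *)
Lemma acyclic_cofibration_lifts A B X Y (j : isvt_map A B) (p : isvt_map X Y) :
  llp_afib R j -> all_weq j -> all_fib p -> lifts j p.
Proof.
move=> cj wj fp u v uv.
have [//|l [lj lt]] := cj _ _ (mpath_tgt R j) wj (mpath_const R j) (isvt_id B).
pose r := isvt_comp (mpath_src R j) l.
pose H := isvt_comp (mpath_eval R j) (gtimes l II).
have rj a : r (j a) = a by rewrite /r /= lj.
have Hj a t : H (j a, t) = j a by rewrite /H /= lj.
have start x : isvt_comp v H (x, i0) = p (isvt_comp u r x).
  by rewrite [RHS]uv /=; congr (v _); exact: (mpath_eval0 (l x)).
have [a|m [m1 m2]] := cj _ _ (mpath_gap R p) (fun K => mpath_gap_afib (fp K))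
  (isvt_comp (mpath_const R (isvt_id X)) u) (mpath_pair start).
  apply: mpath_ext => [|t]; first by rewrite mpath_pair_src /= lj.
  by rewrite mpath_pair_eval [RHS](congr1 v (Hj a t)) -uv.
exists (isvt_comp (mpath_tgt R (isvt_id X)) m); split=> [a|b].
  by rewrite /= m1.
transitivity (mpath_eval R p (mpath_gap R p (m b), i1)); first by [].
by rewrite m2 mpath_pair_eval /=; congr (v _); exact: lt.
Qed.

Definition weq_class : mor_class C := fun X Y f => all_weq f.
Definition fib_class : mor_class C := fun X Y f => all_fib f.
Definition afib_class : mor_class C := fun X Y f => all_afib R f.
Definition cof_class : mor_class C := fun X Y i =>
  forall (E Z : C) (p : mhom E Z), afib_class p -> has_lift i p.

Lemma cof_llp X Y (i : isvt_map X Y) : @cof_class X Y i <-> llp_afib R i.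
Proof. by split=> h E Z p /h; move/has_liftP. Qed.

Lemma weq_class_two_of_three : two_of_three weq_class.
Proof.
move=> X Y Z f g; split=> h1 h2 H.
- exact: weq_comp (h1 H) (h2 H).
- exact: weq_cancelr (h1 H) (h2 H).
- exact: weq_cancell (h1 H) (h2 H).
Qed.

Lemma all_weq_id X : all_weq (isvt_id X).
Proof. by move=> H; apply: weq_of_afib => n u v uv; exists v; split=> // a s; rewrite
  -uv. Qed.

Lemma fib_class_retract : retract_closed fib_class.
Proof.
move=> X Y X' Y' f f' ret ff'; apply/rlp_gen_acof; apply: (rlp_retract ret).
by apply/rlp_gen_acof.
Qed.

Lemma cof_class_lift : lifts_against cof_class (mor_and weq_class fib_class).
Proof. by move=> A B X Y i p ci /weq_fibP ap; exact: ci. Qed.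

Lemma acof_class_lift : lifts_against (mor_and weq_class cof_class) fib_class.
Proof.
move=> A B X Y i p [wi /cof_llp ci] fp; apply/has_liftP.
exact: acyclic_cofibration_lifts.
Qed.

Lemma factor_cof_class : factors_as cof_class (mor_and weq_class fib_class).
Proof.
move=> X Y f; have [Z [i [p [pi ci ap]]]] := small_object_factorization R (f : isvt_map X
  Y).
exists Z, i, p; split; first exact/cof_llp.
  exact/weq_fibP.
exact: isvt_mapP.
Qed.

(** The cofibration i is a weak equivalence because its composite with the
    acyclic fibration q is the strong deformation retract X -> N f. *)
Lemma factor_fib_class : factors_as (mor_and weq_class cof_class) fib_class.
Proof.
move=> X Y f.
have [Z [i [q [qi ci aq]]]] := small_object_factorization R (mpath_const R (f : isvt_map
  X Y)).
exists Z, i, (isvt_comp (mpath_tgt R (f : isvt_map X Y)) q); split.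
- split; last exact/cof_llp.
  move=> H; apply: (weq_cancell (weq_of_afib (aq H))).
  have -> : isvt_comp q i = isvt_comp (isvt_id _) (mpath_const R (f : isvt_map X Y)).
    exact: isvt_mapP.
  by apply/weq_sdr; [exact: mpath_const_sdr | exact: all_weq_id].
- by move=> H; apply: fib_comp; [exact: mpath_tgt_fib | exact: afib_fib].
by apply: isvt_mapP => x; rewrite /= qi.
Qed.

Definition isvt_model : model_structure C :=
  ModelStructure weq_class_two_of_three all_weq_retract fib_class_retract
    (@llp_retract C afib_class) cof_class_lift acof_class_lift factor_cof_class
      factor_fib_class.

Lemma gen_cof_emb b : emb_class (mor (gen_cof R G b)).
Proof. by case: b => H n; exact: closed_emb_sphere. Qed.

Lemma gen_acof_emb b : emb_class (mor (gen_acof R G b)).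
Proof.
case: b => H n; apply: closed_emb_gprod.
- by apply: cpt_hausdorff_subset; [exact: Rhausdorff | exact: compact_set1].
- exact: (I_cpt_hausdorff R).2.
- by move=> t t' e; apply: set_val_inj; exact: (congr1 set_val e).
Qed.

End Model.

Theorem theorem2p2 (R : realType) (G : finGroupType) :
  exists M : model_structure (isvtTop G),
    cofibrantly_generated M (gen_cof R G) (gen_acof R G).
Proof.
exists (isvt_model R G); split.
- move=> b; apply: small_rel_closed_emb => X Y f.
  exact: (rel_cell_closed_emb (@gen_cof_emb R G)).
- move=> b; apply: small_rel_closed_emb => X Y f.
  exact: (rel_cell_closed_emb (@gen_acof_emb R G)).
- by move=> X Y p; split=> h; apply/rlp_gen_acof.
by move=> X Y p; rewrite rlp_gen_cof; exact: weq_fibP.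
Qed.
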